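(* Let $(X,Y,\langle\cdot,\cdot\rangle)$ be a dual pair of normed vector spaces such that $|\langle x,y\rangle|\le\|x\|\,\|y\|$ for all $x\in X$, $y\in Y$, and such that $\{x\in X:\|x\|\le1\}$ is $\sigma(X,Y)$-closed and $\{y\in Y:\|y\|\le1\}$ is $\sigma(Y,X)$-closed. Let $f:X\to\overline{R}$ be proper convex. Then $f$ is lower semi-continuous if and only if $$f(x)=\sup_{y\in Y_c}\{\langle x,y\rangle_c-f^\ast(y)\}\quad\text{for all }x\in X,$$ where $f^\ast(y):=\sup_{x\in X}\{\langle x,y\rangle_c-f(x)\}$ for all $y\in Y_c$.
   Context: Fix a complete non-degenerate Boolean algebra $\mathcal{A}=(\mathcal{A},\wedge,\vee,{}^c,0,1)$, with $a\le b$ iff $a\wedge b=a$. A partition is a family $(a_i)$ in $\mathcal{A}$ with $a_i\wedge a_j=0$ for $i\ne j$ and $\vee a_i=1$ (entries may be $0$). Conditional sets. A conditional set of a non-empty set $X$ and $\mathcal{A}$ is a collection $\mathbf{X}$ of objects $x|a$ ($x\in X$, $a\in\mathcal{A}$) such that (C1) $x|b=y|a$ implies $a=b$; (C2) $x|b=y|b$ and $a\le b$ imply $x|a=y|a$; (C3) for each partition $(a_i)$ and each family $(x_i)$ in $X$ there is a unique $x\in X$ with $x|a_i=x_i|a_i$ for all $i$; it is written $x=\sum x_i|a_i$ (concatenation). Products carry componentwise concatenation. A function $f:X\to Y$ between sets inducing conditional sets is stable if $f(\sum x_i|a_i)=\sum f(x_i)|a_i$. Step functions. For a non-empty set $E$,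 $E_s$ is the set of families $(x_i,a_i)$ in $E\times\mathcal{A}$ with $(a_i)$ a partition, where $(x_i,a_i)$ and $(y_j,b_j)$ are identified if $\vee\{a_i:x_i=z\}=\vee\{b_j:y_j=z\}$ for all $z\in E$; two classes agree on $a$ if these identities hold after meeting both sides with $a$. $E_s$ induces a conditional set, elements are written $\sum x_i|a_i$, and $E$ is embedded as the constants $x|1$. Conditional real numbers. On $\mathbb{R}_s$: $\sum x_i|a_i\leqslant\sum y_j|b_j$ (resp. $<$) iff $x_i\le y_j$ (resp. $x_i<y_j$) whenever $a_i\wedge b_j>0$; sum, product and absolute value are taken pointwise on the common refinement. $\mathbb{N}_s\subseteq\mathbb{R}_s$ carries the inherited order. A conditional sequence in a conditional set $\mathbf{X}$ is a stable function $\mathbb{N}_s\to X$, $n\mapsto x_n$. The conditional real numbers $\mathbf{R}$ are induced by the set $R$ of conditional Cauchy sequences $(x_n)$ in $\mathbb{R}_s$ (for every $r\in\mathbb{R}_s$, $r>0$, there is $n_0\in\mathbb{N}_s$ with $|x_m-x_n|<r$ for all $m,n\geqslant n_0$), with $(x_n),(y_n)$ identified if $|x_n-y_n|$ converges to $0$ (for every $r\in\mathbb{R}_s$, $r>0$, there is $n_0\in\mathbb{N}_s$ with $|x_n-y_n|<r$ for all $n\geqslant n_0$; agreement on $a$ is the same condition with the inequality required on $a$ only). Operations, absolute value and concatenations are defined representative-wise. $[(x_n)]\leqslant[(y_n)]$ iff for all $r\in\mathbb{R}_s$, $r>0$, there is $n\in\mathbb{N}_s$ with $y_m-x_m>-r$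 for all $m\geqslant n$; $[(x_n)]<[(y_n)]$ iff there are $r\in\mathbb{R}_s$, $r>0$, and $n\in\mathbb{N}_s$ with $y_m-x_m>r$ for all $m\geqslant n$. $R_+=\{x\in R:x\geqslant0\}$, $R_{++}=\{x\in R:x>0\}$, $\mathbb{R}\subseteq\mathbb{R}_s\subseteq R$; $(R,\leqslant)$ is Dedekind complete. Conditional extended reals. $\overline{R}$ (inducing $\overline{\mathbf{R}}$) is the conditional completion of $\overline{\mathbb{R}}=\mathbb{R}\cup\{\pm\infty\}$ (conditional Cauchy sequences in $\overline{\mathbb{R}}_s$ modulo distance tending to $0$, for the step-function version of the metric $|\arctan x-\arctan y|$). Every $x\in\overline{R}$ is of the form $x=\infty|a+r|b+(-\infty)|c$ with $(a,b,c)$ a partition and $r\in R$, so $R\subseteq\overline{R}$; order and arithmetic extend those of $R$ with the usual conventions for $\pm\infty$ on each piece (and $0\cdot(\pm\infty)=0$). $\overline{R}$ is a complete lattice. $-\infty<x$ means $x|a\ne-\infty|a$ for every $a>0$. Conditional completion of a normed space. For a normed space $X$, $X_s$ carries the pointwise operations and the norm $\|\sum x_i|a_i\|_s=\sum\|x_i\||a_i\in\mathbb{R}_s$. $X_c$ is the set of conditional Cauchy sequences in $X_s$ (with respect to $\|\cdot\|_s$, in the same sense as for $\mathbb{R}_s$) modulo $\|x_n-y_n\|_s\to0$; it induces the conditional completion $\mathbf{X_c}$, with representative-wise operations, $R$-scalar multiplication and concatenation, and norm $\|[(x_n)]\|_c=\lim_n\|x_n\|_s\in R_+$. One identifies $X\subseteq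 X_s\subseteq X_c$ via constants. Similarly for $Y$. The pairing extends to the stable $R$-bilinear form $\langle[(x_n)],[(y_n)]\rangle_c=\lim_n\langle x_n,y_n\rangle_s$ on $X_c\times Y_c$, where $\langle\sum x_i|a_i,\sum y_j|b_j\rangle_s=\sum\langle x_i,y_j\rangle|a_i\wedge b_j$. Weak neighbourhoods. For $x\in X_c$, $\mathcal{V}(x)$ is the collection of all sets $V=\{z\in X_c: |\langle z-x,y_l\rangle_c|\leqslant r\text{ for all }l\in\mathbb{N}_s\text{ with }1\leqslant l\leqslant n\}$, where $r\in R_{++}$, $n\in\mathbb{N}_s$, and $(y_l)_{1\leqslant l\leqslant n}$ is a conditionally finite family in $Y_c$, i.e. a stable function $\{l\in\mathbb{N}_s:1\leqslant l\leqslant n\}\to Y_c$. Functions $f:X\to\overline{R}$. Put $f_s:X_s\to\overline{R}$, $f_s(\sum x_i|a_i)=\sum f(x_i)|a_i$. $f$ is lower semi-continuous if $f(x)=\sup_{V\in\mathcal{V}(x)}\inf\{f_s(z):z\in V\cap X_s\}$ for all $x\in X$. $f$ is proper convex if $-\infty<f(x)$ for all $x\in X$, $f(x_0)\in R$ for at least one $x_0\in X$, and $f(\lambda x+(1-\lambda)y)\leqslant\lambda f(x)+(1-\lambda)f(y)$ for all $x,y\in X$ and real $0\le\lambda\le1$. All suprema and infima are taken in $\overline{R}$. *)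

(* Defs.v *)
From HB Require Import structures.
From mathcomp Require Import all_boot all_order all_algebra generic_quotient.
From mathcomp Require Import all_classical all_reals all_analysis.
From mathcomp Require Import ring lra.
Import Order.Theory GRing.Theory Num.Theory.
Import numFieldNormedType.Exports.
Set Implicit Arguments.
Unset Strict Implicit.
Unset Printing Implicit Defensive.
Local Open Scope classical_set_scope.
Local Open Scope order_scope.
Local Open Scope quotient_scope.

HB.mixin Record isCompleteBool d T of Order.CTBDistrLattice d T := {
  bool_complete : forall S : set T, supremums S !=set0;
  bool_nondegenerate : \bot != \top :> T
}.
#[short(type="completeBoolType")]
HB.structure Definition CompleteBool d :=
  {T of isCompleteBool d T & Order.CTBDistrLattice d T}.

Section BooleanSup.
Context {d : Order.disp_t} {A : completeBoolType d}.
Implicit Types (a b c : A) (S : set A).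

Definition bsup S : A := supremum \bot S.

Lemma bsup_ub S a : S a -> a <= bsup S.
Proof.
move=> Sa; rewrite /bsup /supremum; case: ifPn => [/eqP S0|_].
  by rewrite S0 in Sa.
by have [xu _] := xgetPex \bot (bool_complete S); exact: xu.
Qed.

Lemma bsup_le S b : (forall a, S a -> a <= b) -> bsup S <= b.
Proof.
move=> h; rewrite /bsup /supremum; case: ifPn => [_|_]; first exact: le0x.
by have [_ xl] := xgetPex \bot (bool_complete S); exact: xl.
Qed.

Lemma bsup_hit S c : c <= bsup S -> c != \bot ->
  exists2 s, S s & c `&` s != \bot.
Proof.
move=> cS c0; apply: contrapT => h.
have : bsup S <= ~` c.
  apply: bsup_le => s Ss; rewrite lexC -disj_leC.
  by apply/negP => cs; apply: h; exists s => //; apply/negP.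
move=> /(le_trans cS); rewrite -disj_leC meetxx => /eqP c00.
by rewrite c00 eqxx in c0.
Qed.

(* a <= b as soon as every nonzero part of a has a nonzero part below b *)
Lemma le_dense a b :
  (forall c, c != \bot -> c <= a -> exists2 e, e != \bot & e <= c `&` b) ->
  a <= b.
Proof.
move=> h; rewrite -diff_eq0; apply/negP => /negP ab0.
have [e e0 ] := h _ ab0 (leBx _ _).
by rewrite diffIK lex0 (negPf e0).
Qed.

End BooleanSup.

Section Conditional.
Context {d : Order.disp_t} (A : completeBoolType d).
Implicit Types (a b c e : A).

Record part (I : Type) := Part {
  piece :> I -> A;
  piece_disj : forall i j, i <> j -> piece i `&` piece j = \bot;
  piece_cover : bsup (range piece) = \top
}.

Lemma part_hit I (p : part I) c : c != \bot ->
  exists i e, [/\ e != \bot, e <= c & e <= p i].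
Proof.
move=> c0; have : c <= bsup (range p) by rewrite piece_cover lex1.
move=> /bsup_hit /(_ c0) [_ [i _ <-] h].
by exists i, (c `&` p i); rewrite h leIl leIr.
Qed.

Lemma part_uniq I (p : part I) c i j : c != \bot -> c <= p i -> c <= p j -> i = j.
Proof.
move=> c0 ci cj; apply: contrapT => /(piece_disj p) ij.
by move: c0; rewrite -lex0 -ij lexI ci cj.
Qed.

Lemma part_ext I (p q : part I) : (forall i, p i = q i) -> p = q.
Proof.
case: p q => [p p1 p2] [q q1 q2] /= /funext pq; case: _ / pq in q1 q2 *.
by congr Part; exact: Prop_irrelevance.
Qed.

Lemma part_subproof I (p : I -> A) :
  (forall c, c != \bot -> exists i e, [/\ e != \bot, e <= c & e <= p i]) ->
  bsup (range p) = \top.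
Proof.
move=> h; apply/eqP; rewrite -le1x; apply: le_dense => c c0 _.
have [i [e [e0 ec ei]]] := h _ c0; exists e => //.
by rewrite lexI ec (le_trans ei)//; apply: bsup_ub; exists i.
Qed.

Section Refine.
Context (I J : Type) (p : part I) (q : part J).
Let r (ij : I * J) : A := p ij.1 `&` q ij.2.

Lemma refine_disj ij kl : ij <> kl -> r ij `&` r kl = \bot.
Proof.
case: ij kl => [i j] [k l] ne; apply/eqP; apply: contrapT => /negP h; apply: ne.
by congr pair; [apply: (part_uniq (p := p) h)|apply: (part_uniq (p := q) h)];
  rewrite /r /= ?(le_trans (leIl _ _) (leIl _ _)) ?(le_trans (leIl _ _) (leIr _ _))
   ?(le_trans (leIr _ _) (leIl _ _)) ?(le_trans (leIr _ _) (leIr _ _)).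
Qed.

Lemma refine_cover : bsup (range r) = \top.
Proof.
apply: part_subproof => c c0.
have [i [e [e0 ec ei]]] := part_hit p c0.
have [j [f [f0 fe fj]]] := part_hit q e0.
exists (i, j), f; split => //; first exact: le_trans ec.
by rewrite lexI fj (le_trans fe ei).
Qed.

Definition refine : part (I * J) := Part refine_disj refine_cover.
End Refine.

Section Pushforward.
Context (I E : Type) (g : I -> E) (p : part I).
Let r (z : E) : A := bsup [set p i | i in [set i | g i = z]].

Lemma pushforward_val c i : c <= p i -> c <= r (g i).
Proof. by move=> h; apply: (le_trans h); apply: bsup_ub; exists i. Qed.

Lemma pushforward_hit c z : c != \bot -> c <= r z ->
  exists i e, [/\ e != \bot, e <= c, e <= p i & g i = z].
Proof.
move=> c0 /bsup_hit /(_ c0) [_ [i <- <-] h].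
by exists i, (c `&` p i); rewrite h leIl leIr.
Qed.

Lemma pushforward_disj z w : z <> w -> r z `&` r w = \bot.
Proof.
move=> ne; apply/eqP; apply: contrapT => /negP h; apply: ne.
have [i [e [e0 ec ei <-]]] := pushforward_hit h (leIl _ _).
have [j [f [f0 fe fj <-]]] := pushforward_hit e0 (le_trans ec (leIr _ _)).
by rewrite (part_uniq f0 (le_trans fe ei) fj).
Qed.

Lemma pushforward_cover : bsup (range r) = \top.
Proof.
apply: part_subproof => c c0.
have [i [e [e0 ec ei]]] := part_hit p c0.
by exists (g i), e; split => //; exact: pushforward_val.
Qed.

Definition push_part : part E := Part pushforward_disj pushforward_cover.
End Pushforward.

Lemma trivial_disj (i j : unit) : i <> j -> (\top : A) `&` \top = \bot.
Proof. by case: i j => [] []. Qed.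
Lemma trivial_cover : bsup (range (fun _ : unit => \top : A)) = \top.
Proof. by apply: part_subproof => c c0; exists tt, c; rewrite lex1 lexx. Qed.
Definition trivial_part : part unit := Part trivial_disj trivial_cover.

Section CutPart.
Context (a : A).
Let r (t : bool) := if t then a else ~` a.
Lemma cut_disj (t u : bool) : t <> u -> r t `&` r u = \bot.
Proof. by case: t u => [] [] //= _; rewrite ?meetxC ?meetCx. Qed.
Lemma cut_cover : bsup (range r) = \top.
Proof.
apply/eqP; rewrite -le1x -(joinxC a) leUx.
by apply/andP; split; apply: bsup_ub; [exists true|exists false].
Qed.
Definition cut_part : part bool := Part cut_disj cut_cover.
End CutPart.

(* x|a = y|b is rendered as [a = b /\ agree a x y]; this encoding makes (C1)
   hold by construction, while the fields below say that x |-> x|a identifies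
   along an equivalence for each a, (C2) and (C3) *)
Record condSet := CondSet {
  cs_sort :> Type;
  agree : A -> cs_sort -> cs_sort -> Prop;
  agree_refl : forall a x, agree a x x;
  agree_sym : forall a x y, agree a x y -> agree a y x;
  agree_trans : forall a x y z, agree a x y -> agree a y z -> agree a x z;
  agree_le : forall a b x y, a <= b -> agree b x y -> agree a x y;
  agree_glue : forall (I : Type) (p : part I) (x : I -> cs_sort),
    exists! z, forall i, agree (p i) z (x i)
}.

Definition concat (T : condSet) (I : Type) (p : part I) (x : I -> T) : T :=
  sval (cid (agree_glue p x)).

Lemma concatP (T : condSet) I (p : part I) (x : I -> T) i :
  agree (p i) (concat p x) (x i).
Proof. by rewrite /concat; case: cid => z [/= h _]. Qed.

Lemma concat_uniq (T : condSet) I (p : part I) (x : I -> T) z :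
  (forall i, agree (p i) z (x i)) -> z = concat p x.
Proof.
by move=> h; rewrite /concat; case: cid => w [/= _ hw]; rewrite (hw z h).
Qed.

(* D is meant to be closed under concatenations *)
Definition stable_on (S T : condSet) (D : set S) (f : S -> T) :=
  forall (I : Type) (p : part I) (x : I -> S), (forall i, D (x i)) ->
    f (concat p x) = concat p (fun i => f (x i)).

Definition stable (S T : condSet) (f : S -> T) := stable_on setT f.

Lemma stableP (S T : condSet) (f : S -> T) :
  stable f <-> forall a x y, agree a x y -> agree a (f x) (f y).
Proof.
split=> [st a x y xy|h I p x _]; last first.
  by apply: concat_uniq => i; apply: h; exact: concatP.
pose z (t : bool) := if t then x else y.
have -> : y = concat (cut_part a) z.
  by apply: concat_uniq => -[] /=; [exact: agree_sym|exact: agree_refl].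
by rewrite st//; apply: agree_sym; exact: (concatP (cut_part a) (fun t => f (z t)) true).
Qed.

(* The class of a family (x_i, a_i) is determined by the map
   z |-> sup {a_i : x_i = z}, which is itself a partition indexed by E and, as
   the family (z, a_z), a representative of the class. So E_s is the type of
   E-indexed partitions, and sum_i x_i|a_i is [push_part x a]. *)
Definition step (E : Type) := part E.

Section StepCondSet.
Context (E : Type).
Implicit Types p q r : step E.

Definition step_agree a p q := forall z, p z `&` a = q z `&` a.

Lemma step_agreeP a p q : step_agree a p q <->
  forall c z, c != \bot -> c <= a -> c <= p z -> c <= q z.
Proof.
split=> [h c z c0 ca cp|h z].
  by have := leIl (q z) a; rewrite -h; apply: le_trans; rewrite lexI cp.
apply/eqP; rewrite eq_le !lexI !leIr !andbT; apply/andP; split; last first.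
  apply: le_dense => c c0; rewrite lexI => /andP[cq ca].
  have [w [e [e0 ec ep]]] := part_hit p c0; exists e => //; rewrite lexI ec/=.
  have eq' := h _ _ e0 (le_trans ec ca) ep.
  by rewrite (part_uniq e0 (le_trans ec cq) eq').
apply: le_dense => c c0; rewrite lexI => /andP[cq ca].
by exists c => //; rewrite lexI lexx; exact: h.
Qed.

Section Concat.
Context (I : Type) (a : part I) (x : I -> step E).
Let r (z : E) : A := bsup [set a i `&` x i z | i in setT].
Let r_hit c z : c != \bot -> c <= r z ->
  exists i e, [/\ e != \bot, e <= c, e <= a i & e <= x i z].
Proof.
move=> c0 /bsup_hit /(_ c0) [_ [i _ <-] h].
exists i, (c `&` (a i `&` x i z)); split => //; first exact: leIl.
  by rewrite (le_trans (leIr _ _))// leIl.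
by rewrite (le_trans (leIr _ _))// leIr.
Qed.
Let r_val c i z : c <= a i -> c <= x i z -> c <= r z.
Proof.
by move=> ca cx; apply: (@le_trans _ _ (a i `&` x i z));
  [rewrite lexI ca|apply: bsup_ub; exists i].
Qed.
Lemma step_concat_disj z w : z <> w -> r z `&` r w = \bot.
Proof.
move=> ne; apply/eqP; apply: contrapT => /negP h; apply: ne.
have [i [e [e0 ec ei ez]]] := r_hit h (leIl _ _).
have [j [f [f0 fe fj fw]]] := r_hit e0 (le_trans ec (leIr _ _)).
have ij := part_uniq f0 (le_trans fe ei) fj; rewrite -ij in fw.
exact: (part_uniq f0 (le_trans fe ez) fw).
Qed.
Lemma step_concat_cover : bsup (range r) = \top.
Proof.
apply: part_subproof => c c0.
have [i [e [e0 ec ei]]] := part_hit a c0.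
have [z [f [f0 fe fz]]] := part_hit (x i) e0.
exists z, f; split => //; first exact: le_trans ec.
exact: r_val (le_trans fe ei) fz.
Qed.
Definition step_concat : step E := Part step_concat_disj step_concat_cover.
Lemma step_concatP i : step_agree (a i) step_concat (x i).
Proof.
apply/step_agreeP => c z c0 ca; apply: contraPP => /negP nz cr.
have : c <= x i z.
  apply: le_dense => e e0 ec.
  have [j [f [f0 fe fj fz]]] := r_hit e0 (le_trans ec cr).
  have ij := part_uniq f0 fj (le_trans (le_trans fe ec) ca).
  by exists f => //; rewrite lexI fe -ij.
by move: nz => /[swap] ->.
Qed.
End Concat.

Lemma step_agree_glue I (a : part I) (x : I -> step E) :
  exists! z, forall i, step_agree (a i) z (x i).
Proof.
exists (step_concat a x); split; first exact: step_concatP.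
move=> q hq; apply: part_ext => z.
have : step_agree \top (step_concat a x) q; last first.
  by move=> /(_ z); rewrite !meetx1.
apply/step_agreeP => c w c0 _ cw.
apply: le_dense => e e0 ec.
have [i [f [f0 fe fi]]] := part_hit a e0.
exists f => //; rewrite lexI fe/=.
have h : step_agree (a i) (step_concat a x) q.
  by move=> v; rewrite hq step_concatP.
by apply: (proj1 (step_agreeP _ _ _) h) => //; exact: le_trans fe (le_trans ec cw).
Qed.

Lemma step_agree_le a b p q : a <= b -> step_agree b p q -> step_agree a p q.
Proof.
move=> ab /step_agreeP h; apply/step_agreeP => c z c0 ca.
exact: h c0 (le_trans ca ab).
Qed.

Canonical step_condSet : condSet := @CondSet (step E) step_agree
  (fun a p z => erefl)
  (fun a p q h z => esym (h z))
  (fun a p q r h k z => etrans (h z) (k z))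
  step_agree_le
  step_agree_glue.

Definition step_cst (z : E) : step E := push_part (fun=> z) trivial_part.

End StepCondSet.

(* pointwise extensions of functions and relations to step functions *)
Definition smap (E F : Type) (g : E -> F) (p : step E) : step F := push_part g p.

Definition smap2 (E F G : Type) (g : E -> F -> G) (p : step E) (q : step F) : step G :=
  push_part (fun xy => g xy.1 xy.2) (refine p q).

(* the relation r between p and q, required on a only *)
Definition srel_on a (E F : Type) (r : E -> F -> Prop) (p : step E) (q : step F) :=
  forall z w, a `&` (p z `&` q w) != \bot -> r z w.

Definition srel (E F : Type) (r : E -> F -> Prop) (p : step E) (q : step F) :=
  srel_on \top r p q.

End Conditional.

Section Values.
Context {d : Order.disp_t} {A : completeBoolType d}.
Implicit Types a b c : A.

Lemma srel_onP a (E F : Type) (r : E -> F -> Prop) (p : step A E) (q : step A F) :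
  srel_on a r p q <->
  forall c z w, c != \bot -> c <= a -> c <= p z -> c <= q w -> r z w.
Proof.
split=> [h c z w c0 ca cp cq|h z w h0]; last first.
  by apply: (h _ z w h0); rewrite ?leIl// (le_trans (leIr _ _))// ?leIl ?leIr.
by apply: h; move: c0; apply: contra_neq => h; apply/eqP; rewrite -lex0 -h !lexI ca cp.
Qed.

Lemma srelP (E F : Type) (r : E -> F -> Prop) (p : step A E) (q : step A F) :
  srel r p q <-> forall c z w, c != \bot -> c <= p z -> c <= q w -> r z w.
Proof.
rewrite /srel srel_onP; split=> h c z w c0; last by move=> _; exact: h.
by apply: h => //; exact: lex1.
Qed.

Lemma srel_on_le a b (E F : Type) (r : E -> F -> Prop) (p : step A E) (q : step A F) :
  a <= b -> srel_on b r p q -> srel_on a r p q.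
Proof.
move=> ab /srel_onP h; apply/srel_onP => c z w c0 ca.
by apply: h => //; exact: le_trans ab.
Qed.

Lemma step_agree_eq a (E : Type) (p q : step A E) :
  agree a p q <-> srel_on a eq p q.
Proof.
rewrite srel_onP; split=> [/step_agreeP h c z w c0 ca cp cq|h].
  exact: (part_uniq c0 (h _ _ c0 ca cp) cq).
apply/step_agreeP => c z c0 ca cp; apply: le_dense => e e0 ec.
have [w [f [f0 fe fw]]] := part_hit q e0; exists f => //; rewrite lexI fe/=.
have fc := le_trans fe ec.
by rewrite (h f z w)// ?(le_trans fc).
Qed.

Lemma smap_at (E F : Type) (g : E -> F) (p : step A E) c x z :
  c != \bot -> c <= p x -> c <= smap g p z -> z = g x.
Proof.
move=> c0 cx cz; apply: (part_uniq c0 cz); exact: pushforward_val.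
Qed.

Lemma smap2_at (E F G : Type) (g : E -> F -> G) (p : step A E) (q : step A F) c x y z :
  c != \bot -> c <= p x -> c <= q y -> c <= smap2 g p q z -> z = g x y.
Proof.
move=> c0 cx cy cz; apply: (part_uniq c0 cz).
by apply: (@pushforward_val _ _ _ _ (fun xy => g xy.1 xy.2) _ _ (x, y)); rewrite lexI cx.
Qed.

Lemma step_cst_at (E : Type) (x z : E) c :
  c != \bot -> c <= step_cst A x z -> z = x.
Proof.
move=> c0 cz; apply: (part_uniq c0 cz).
by apply: (@pushforward_val _ _ _ _ (fun=> x) (trivial_part A) _ tt); exact: lex1.
Qed.

End Values.

(* refine the current nonzero c so that p takes the value z on it *)
Ltac pick p z hz :=
  match goal with c0 : is_true (?c != \bot) |- _ =>
    let e := fresh "e" in let e0 := fresh "e0" in let ec := fresh "ec" in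
    have [z [e [e0 ec hz]]] := part_hit p c0;
    repeat match goal with h : is_true (c <= ?x) |- _ =>
      let h' := fresh in have h' := le_trans ec h; clear h; rename h' into h end;
    clear ec c0; clear c; rename e into c; rename e0 into c0
  end.

Section Lattice.
Context {d : Order.disp_t} {A : completeBoolType d}.
Implicit Types a b c : A.

Lemma smap_agree (E F : Type) (g : E -> F) a (p p' : step A E) :
  agree a p p' -> agree a (smap g p) (smap g p').
Proof.
move=> /step_agree_eq /srel_onP h.
apply/step_agree_eq/srel_onP => c z w c0 ca cz cw.
pick p x hx; pick p' x' hx'.
rewrite (smap_at c0 hx cz) (smap_at c0 hx' cw).
by rewrite (h _ _ _ c0 ca hx hx').
Qed.

Lemma smap2_agree (E F G : Type) (g : E -> F -> G) a
    (p p' : step A E) (q q' : step A F) :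
  agree a p p' -> agree a q q' -> agree a (smap2 g p q) (smap2 g p' q').
Proof.
move=> /step_agree_eq /srel_onP h /step_agree_eq /srel_onP k.
apply/step_agree_eq/srel_onP => c z w c0 ca cz cw.
pick p x hx; pick p' x' hx'; pick q y hy; pick q' y' hy'.
rewrite (smap2_at c0 hx hy cz) (smap2_at c0 hx' hy' cw).
by rewrite (h _ _ _ c0 ca hx hx') (k _ _ _ c0 ca hy hy').
Qed.

(* the order of N_s inherited from R_s *)
Definition nle : step A nat -> step A nat -> Prop := srel (fun m n => (m <= n)%N).
Definition nle_on a : step A nat -> step A nat -> Prop :=
  srel_on a (fun m n => (m <= n)%N).

Lemma nle_localize a (k n : step A nat) : nle_on a k n ->
  exists2 n', nle k n' & agree a n n'.
Proof.
move=> /srel_onP h; exists (smap2 maxn k n).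
  apply/srelP => c z w c0 cz cw; pick n x hx.
  by rewrite (smap2_at c0 cz hx cw) leq_maxl.
apply/step_agree_eq/srel_onP => c z w c0 ca cz cw; pick k x hx.
by rewrite (smap2_at c0 hx cz cw); apply/esym/maxn_idPr; exact: h hx cz.
Qed.

Lemma nle_on_le a b k n : a <= b -> nle_on b k n -> nle_on a k n.
Proof. exact: srel_on_le. Qed.

Lemma nle_max_l a k k' n : nle_on a (smap2 maxn k k') n -> nle_on a k n.
Proof.
move=> /srel_onP h; apply/srel_onP => c z w c0 ca cz cw; pick k' x hx.
pick (smap2 maxn k k') y hy.
by have := h _ _ _ c0 ca hy cw; rewrite (smap2_at c0 cz hx hy) geq_max => /andP[].
Qed.

Lemma nle_max_r a k k' n : nle_on a (smap2 maxn k k') n -> nle_on a k' n.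
Proof.
move=> /srel_onP h; apply/srel_onP => c z w c0 ca cz cw; pick k x hx.
pick (smap2 maxn k k') y hy.
by have := h _ _ _ c0 ca hy cw; rewrite (smap2_at c0 hx cz hy) geq_max => /andP[].
Qed.

Lemma nle_concat I (p : part A I) (k : I -> step A nat) n i b :
  b <= p i -> nle_on b (concat p k) n -> nle_on b (k i) n.
Proof.
move=> bp /srel_onP h; apply/srel_onP => c z w c0 cb cz cw.
have /step_agree_eq/srel_onP ag := concatP p k i.
pick (concat p k : step A nat) y hy.
by rewrite -(ag _ _ _ c0 (le_trans cb bp) hy cz); exact: h hy cw.
Qed.

End Lattice.

Record metric (R : realType) (E : Type) := Metric {
  mdist :> E -> E -> R;
  mdist_refl : forall x, mdist x x = 0%R;
  mdist_eq0 : forall x y, mdist x y = 0%R -> x = y;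
  mdist_sym : forall x y, mdist x y = mdist y x;
  mdist_triangle : forall x y z, (mdist x z <= mdist x y + mdist y z)%R
}.

Lemma mdist_ge0 R E (m : metric R E) x y : (0 <= m x y)%R.
Proof.
by have := mdist_triangle m x y x; rewrite mdist_refl (mdist_sym m y x)
  -mulr2n pmulrn_lge0.
Qed.

Section Completion.
Context {d : Order.disp_t} (A : completeBoolType d) {R : realType}.
Implicit Types a b c : A.

Definition slt_on a : step A R -> step A R -> Prop := srel_on a (fun s t => (s < t)%R).
Definition slt : step A R -> step A R -> Prop := srel (fun s t => (s < t)%R).
Definition spos (r : step A R) := slt (step_cst A 0%R) r.

Context {E : Type} (m : metric R E).

Definition sdist : step A E -> step A E -> step A R := smap2 m.

Definition is_cauchy (u : step A nat -> step A E) :=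
  forall r, spos r -> exists n0, forall k n, nle n0 k -> nle n0 n ->
    slt (sdist (u k) (u n)) r.

(* |u_n - v_n| converges to 0 on a *)
Definition close_on a (u v : step A nat -> step A E) :=
  forall r, spos r -> exists n0, forall n, nle n0 n ->
    slt_on a (sdist (u n) (v n)) r.

Record cauchySeq := Cauchy {
  cseq :> step A nat -> step A E;
  cseq_stable : stable cseq;
  cseq_cauchy : is_cauchy cseq
}.

Lemma slt_on_agree a p p' (r : step A R) : agree a p p' -> slt_on a p' r -> slt_on a p r.
Proof.
move=> /step_agree_eq /srel_onP ag /srel_onP h; apply/srel_onP => c z w c0 ca cz cw.
pick p' z' hz'.
by rewrite (ag _ _ _ c0 ca cz hz'); exact: h hz' cw.
Qed.

Lemma cauchy_on (u : cauchySeq) r : spos r -> exists n0, forall a k n,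
  nle_on a n0 k -> nle_on a n0 n -> slt_on a (sdist (u k) (u n)) r.
Proof.
move=> /(cseq_cauchy u)[n0 h]; exists n0 => a k n.
move=> /nle_localize[k' k'0 kk'] /nle_localize[n' n'0 nn'].
have st := proj1 (stableP u) (cseq_stable u).
apply: (@slt_on_agree _ _ (sdist (u k') (u n'))); last first.
  by apply: (srel_on_le (lex1 _)); exact: h.
by apply: smap2_agree; exact: st.
Qed.

Lemma close_onP a (u v : cauchySeq) : close_on a u v <->
  forall r, spos r -> exists n0, forall b n, b <= a -> nle_on b n0 n ->
    slt_on b (sdist (u n) (v n)) r.
Proof.
split=> h r r0; have [n0 {}h] := h r r0; exists n0; last first.
  by move=> n n0n; apply: h => //; exact: srel_on_le n0n.
move=> b n ba /nle_localize[n' n'0 nn'].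
have stu := proj1 (stableP u) (cseq_stable u).
have stv := proj1 (stableP v) (cseq_stable v).
apply: (@slt_on_agree _ _ (sdist (u n') (v n'))); last first.
  by apply: (srel_on_le ba); exact: h.
by apply: smap2_agree; [exact: stu|exact: stv].
Qed.

Lemma close_on_le a b (u v : cauchySeq) : a <= b -> close_on b u v -> close_on a u v.
Proof.
move=> ab h r r0; have [n0 {}h] := h r r0; exists n0 => n n0n.
by apply: (srel_on_le ab); exact: h.
Qed.

Lemma agree_close_on a (u v : cauchySeq) : (forall n, agree a (u n) (v n)) -> close_on a u v.
Proof.
move=> h r /srelP r0; exists (step_cst A 0%N) => n _.
have /step_agree_eq/srel_onP ag := h n.
apply/srel_onP => c z w c0 ca cz cw.
pick (u n) x hx; pick (v n) y hy; pick (step_cst A 0%R : step A R) t ht.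
rewrite (smap2_at c0 hx hy cz) (ag _ _ _ c0 ca hx hy) mdist_refl.
by rewrite -(step_cst_at c0 ht); exact: r0 c0 ht cw.
Qed.

Lemma close_on_refl a (u : cauchySeq) : close_on a u u.
Proof. by apply: agree_close_on => n; exact: agree_refl. Qed.

Lemma close_on_sym a (u v : cauchySeq) : close_on a u v -> close_on a v u.
Proof.
move=> h r r0; have [n0 {}h] := h r r0; exists n0 => n n0n.
have /srel_onP {}h := h n n0n.
apply/srel_onP => c z w c0 ca cz cw.
pick (u n) x hx; pick (v n) y hy; pick (sdist (u n) (v n)) t ht.
rewrite (smap2_at c0 hy hx cz) mdist_sym -(smap2_at c0 hx hy ht).
exact: h _ ht cw.
Qed.

Lemma spos_half (r : step A R) : spos r -> spos (smap (fun t => (t / 2%:R)%R) r).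
Proof.
move=> /srelP r0; apply/srelP => c z w c0 cz cw.
pick r x hx; rewrite (step_cst_at c0 cz) (smap_at c0 hx cw).
by rewrite divr_gt0// -(step_cst_at c0 cz); exact: r0 cz hx.
Qed.

Lemma close_on_trans a (u v w : cauchySeq) :
  close_on a u v -> close_on a v w -> close_on a u w.
Proof.
move=> /close_onP h /close_onP k; apply/close_onP => r r0.
have [n1 {}h] := h _ (spos_half r0); have [n2 {}k] := k _ (spos_half r0).
exists (smap2 maxn n1 n2) => b n ba n0n.
have /srel_onP {}h := h b n ba (nle_max_l n0n).
have /srel_onP {}k := k b n ba (nle_max_r n0n).
apply/srel_onP => c z t c0 cb cz ct.
pick (u n) x hx; pick (v n) y hy; pick (w n) s hs.
pick (sdist (u n) (v n)) e he; pick (sdist (v n) (w n)) f hf.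
pick (smap (fun t => (t / 2%:R)%R) r) g hg.
rewrite (smap2_at c0 hx hs cz) (splitr t) -(smap_at c0 ct hg).
apply: (le_lt_trans (mdist_triangle m x y s)); apply: ltrD.
  by rewrite -(smap2_at c0 hx hy he); exact: h he hg.
by rewrite -(smap2_at c0 hy hs hf); exact: k hf hg.
Qed.

HB.instance Definition _ := gen_eqMixin cauchySeq.
HB.instance Definition _ := gen_choiceMixin cauchySeq.

Definition cauchy_eq (u v : cauchySeq) : bool := `[< close_on \top u v >].

Lemma cauchy_eq_refl : reflexive cauchy_eq.
Proof. by move=> u; apply/asboolP; exact: close_on_refl. Qed.
Lemma cauchy_eq_sym : symmetric cauchy_eq.
Proof. by move=> u v; apply/asboolP/asboolP; exact: close_on_sym. Qed.
Lemma cauchy_eq_trans : transitive cauchy_eq.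
Proof.
by move=> v u w /asboolP h /asboolP k; apply/asboolP; exact: close_on_trans h k.
Qed.
Canonical cauchy_equiv := EquivRel cauchy_eq cauchy_eq_refl cauchy_eq_sym cauchy_eq_trans.

Definition completion := {eq_quot cauchy_eq}.

Definition completion_agree a (x y : completion) := close_on a (repr x) (repr y).

Lemma repr_pi_close a (u : cauchySeq) : close_on a (repr (\pi_completion u)) u.
Proof.
apply: (close_on_le (lex1 a)).
by have /eqmodP/asboolP : \pi_completion (repr (\pi_completion u)) = \pi_completion u
  by rewrite reprK.
Qed.

Section Glue.
Context (I : Type) (p : part A I) (u : I -> cauchySeq).
Let w (n : step A nat) : step A E := concat p (fun i => u i n).
Lemma glue_stable : stable w.
Proof.
apply/stableP => a k n kn; apply/step_agree_eq/srel_onP => c x y c0 ca cx cy.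
pick p i ei.
have /step_agree_eq/srel_onP hk := concatP p (fun i => u i k) i.
have /step_agree_eq/srel_onP hn := concatP p (fun i => u i n) i.
have /step_agree_eq/srel_onP ag := proj1 (stableP (u i)) (cseq_stable (u i)) _ _ _ kn.
pick (u i k) x' hx'; pick (u i n) y' hy'.
rewrite (hk _ _ _ c0 ei cx hx') (hn _ _ _ c0 ei cy hy').
exact: ag c0 ca hx' hy'.
Qed.
Lemma glue_cauchy : is_cauchy w.
Proof.
move=> r r0; have [N hN] := choice (fun i => cauchy_on (u i) r0).
exists (concat p N) => k n n0k n0n.
apply/srelP => c z t c0 cz ct.
pick p i ei.
have /step_agree_eq/srel_onP hk := concatP p (fun i => u i k) i.
have /step_agree_eq/srel_onP hn := concatP p (fun i => u i n) i.
have /srel_onP h := hN i c k n (nle_concat ei (srel_on_le (lex1 _) n0k))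
   (nle_concat ei (srel_on_le (lex1 _) n0n)).
have cc := lexx c; set b := {-2}c in h cc; move: b h cc => b h cc.
pick (u i k) x hx; pick (u i n) y hy; pick (w k) x' hx'; pick (w n) y' hy'.
pick (sdist (u i k) (u i n)) s hs.
rewrite (smap2_at c0 hx' hy' cz) (hk _ _ _ c0 ei hx' hx) (hn _ _ _ c0 ei hy' hy).
rewrite -(smap2_at c0 hx hy hs); exact: h c0 cc hs ct.
Qed.
Definition glue : cauchySeq := Cauchy glue_stable glue_cauchy.
End Glue.

Lemma completion_glue I (p : part A I) (x : I -> completion) :
  exists! z, forall i, completion_agree (p i) z (x i).
Proof.
exists (\pi_completion (glue p (fun i => repr (x i)))); split.
  move=> i; apply: (close_on_trans (repr_pi_close _ _)).
  by apply: agree_close_on => n; exact: (concatP p (fun i => repr (x i) n) i).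
move=> z hz; rewrite -[RHS]reprK; apply/eqmodP/asboolP/close_onP => r r0.
have h i : close_on (p i) (glue p (fun i => repr (x i))) (repr z).
  apply: close_on_trans (close_on_sym (hz i)).
  by apply: agree_close_on => n; exact: (concatP p (fun i => repr (x i) n) i).
have [N hN] := choice (fun i => proj1 (close_onP _ _ _) (h i) r r0).
exists (concat p N) => b n _ n0n; apply/srel_onP => c s t c0 cb cs ct.
have [i [e [e0 ec ei]]] := part_hit p c0.
have /srel_onP k := hN i e n ei (nle_concat ei (srel_on_le (le_trans ec cb) n0n)).
exact: k e0 (lexx _) (le_trans ec cs) (le_trans ec ct).
Qed.

Canonical completion_condSet : condSet A := @CondSet _ A completion completion_agree
  (fun a x => close_on_refl a (repr x))
  (fun a x y => @close_on_sym a (repr x) (repr y))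
  (fun a x y z => @close_on_trans a (repr x) (repr y) (repr z))
  (fun a b x y => @close_on_le a b (repr x) (repr y))
  completion_glue.

Section Constant.
Context (p : step A E).
Lemma cst_stable : stable (fun _ : step A nat => p).
Proof. by apply/stableP => a k n _; exact: agree_refl. Qed.
Lemma cst_cauchy : is_cauchy (fun _ : step A nat => p).
Proof.
move=> r /srelP r0; exists (step_cst A 0%N) => k n _ _.
apply/srelP => c z w c0 cz cw.
pick p x hx; pick (step_cst A 0%R : step A R) t ht.
by rewrite (smap2_at c0 hx hx cz) mdist_refl -(step_cst_at c0 ht); exact: r0 c0 ht cw.
Qed.
(* the embeddings E_s -> E_c and E -> E_c *)
Definition completion_step : completion := \pi_completion (Cauchy cst_stable cst_cauchy).
End Constant.

Definition completion_cst (x : E) : completion := completion_step (step_cst A x).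

End Completion.

Section Lift.
Context {d : Order.disp_t} {A : completeBoolType d} {R : realType}.

Section Lift1.
Context {E F : Type} {m1 : metric R E} {m2 : metric R F} (g : E -> F).
Hypothesis g_lip : forall x y, (m2 (g x) (g y) <= m1 x y)%R.
Section Seq.
Context (u : cauchySeq A m1).
Let w (n : step A nat) : step A F := smap g (u n).
Lemma lift1_stable : stable w.
Proof.
apply/stableP => a k n kn; apply: smap_agree.
exact: (proj1 (stableP u) (cseq_stable u)).
Qed.
Lemma lift1_cauchy : is_cauchy m2 w.
Proof.
move=> r r0; have [n0 h] := cseq_cauchy u r0; exists n0 => k n n0k n0n.
have /srelP {}h := h k n n0k n0n; apply/srelP => c z t c0 cz ct.
pick (u k) x hx; pick (u n) y hy; pick (w k) x' hx'; pick (w n) y' hy'.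
pick (sdist m1 (u k) (u n)) s hs.
rewrite (smap2_at c0 hx' hy' cz) (smap_at c0 hx hx') (smap_at c0 hy hy').
apply: (le_lt_trans (g_lip _ _)).
by rewrite -(smap2_at c0 hx hy hs); exact: h hs ct.
Qed.
Definition lift1_seq : cauchySeq A m2 := Cauchy lift1_stable lift1_cauchy.
End Seq.
Definition lift1 (x : completion A m1) : completion A m2 := \pi_(completion A m2) (lift1_seq (repr x)).
End Lift1.

Section Lift2.
Context {E F G : Type} {m1 : metric R E} {m2 : metric R F} {m3 : metric R G}.
Context (g : E -> F -> G) (L : R) (x0 : E) (y0 : F).
Hypothesis L_ge0 : (0 <= L)%R.
Hypothesis g_lip : forall x x' y y', (m3 (g x y) (g x' y') <=
  m1 x x' * (L + m2 y y0) + (L + m1 x' x0) * m2 y y')%R.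

Section Seq.
Context (u : cauchySeq A m1) (v : cauchySeq A m2).
Let w (n : step A nat) : step A G := smap2 g (u n) (v n).
Lemma lift2_stable : stable w.
Proof.
apply/stableP => a k n kn; apply: smap2_agree.
  exact: (proj1 (stableP u) (cseq_stable u)).
exact: (proj1 (stableP v) (cseq_stable v)).
Qed.
Lemma lift2_cauchy : is_cauchy m3 w.
Proof.
have pos1 : spos (step_cst A (1%R : R)).
  apply/srelP => c z t c0 cz ct.
  by rewrite (step_cst_at c0 cz) (step_cst_at c0 ct) ltr01.
have [N1 H1] := cseq_cauchy u pos1; have [N2 H2] := cseq_cauchy v pos1.
pose M x y : R := (L + (1 + m1 x x0) + (1 + m2 y y0))%R.
have M_gt0 x y : (0 < M x y)%R.
  rewrite /M ltr_wpDl ?ltr_pwDl ?addr_ge0 ?mdist_ge0//.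
pose K := smap2 M (u N1) (v N2).
move=> r /srelP r0; pose r' := smap2 (fun t s => t / (2%:R * s))%R r K.
have r'0 : spos r'.
  apply/srelP => c z t c0 cz ct; pick r s hs; pick K k hk; pick (u N1) x hx; pick (v N2) y hy.
  rewrite (step_cst_at c0 cz) (smap2_at c0 hs hk ct) (smap2_at c0 hx hy hk).
  rewrite divr_gt0 ?mulr_gt0//.
  by rewrite -(step_cst_at c0 cz); exact: r0 cz hs.
have [N3 H3] := cseq_cauchy u r'0; have [N4 H4] := cseq_cauchy v r'0.
pose n0 := smap2 maxn (smap2 maxn N1 N2) (smap2 maxn N3 N4).
have nn (k : step A nat) : nle k k.
  by apply/srelP => c z t c0 cz ct; rewrite (part_uniq c0 cz ct).
exists n0 => k n n0k n0n.
have /srelP h1 := H1 k N1 (nle_max_l (nle_max_l n0k)) (nn _).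
have /srelP h1' := H1 n N1 (nle_max_l (nle_max_l n0n)) (nn _).
have /srelP h2 := H2 k N2 (nle_max_r (nle_max_l n0k)) (nn _).
have /srelP h3 := H3 k n (nle_max_l (nle_max_r n0k)) (nle_max_l (nle_max_r n0n)).
have /srelP h4 := H4 k n (nle_max_r (nle_max_r n0k)) (nle_max_r (nle_max_r n0n)).
apply/srelP => c z t c0 cz ct.
pick (u k) x hx; pick (u n) x' hx'; pick (v k) y hy; pick (v n) y' hy'.
pick (u N1) X hX; pick (v N2) Y hY; pick K K1 hK1; pick r' t' ht'.
pick (step_cst A (1%R : R)) o ho; have o1 := step_cst_at c0 ho.
pick (sdist m1 (u n) (u N1)) s1 hs1; have e1 := smap2_at c0 hx' hX hs1.
pick (sdist m2 (v k) (v N2)) s2 hs2; have e2 := smap2_at c0 hy hY hs2.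
pick (sdist m1 (u k) (u n)) s3 hs3; have e3 := smap2_at c0 hx hx' hs3.
pick (sdist m2 (v k) (v n)) s4 hs4; have e4 := smap2_at c0 hy hy' hs4.
have {}h1' := h1' _ _ _ c0 hs1 ho; have {}h2 := h2 _ _ _ c0 hs2 ho.
have {}h3 := h3 _ _ _ c0 hs3 ht'; have {}h4 := h4 _ _ _ c0 hs4 ht'.
have et' := smap2_at c0 ct hK1 ht'; have eK1 := smap2_at c0 hX hY hK1.
pick (w k) W hW; pick (w n) W' hW'.
rewrite (smap2_at c0 hW hW' cz) (smap2_at c0 hx hy hW) (smap2_at c0 hx' hy' hW').
apply: (le_lt_trans (g_lip _ _ _ _)).
have K10 : (0 < K1)%R by rewrite eK1.
have -> : t = (t' * K1 + K1 * t')%R.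
  by rewrite et'; field; rewrite gt_eqF.
rewrite -e3 -e4 in h3 h4 *; rewrite e1 o1 in h1'; rewrite e2 o1 in h2.
have b1 : (L + m2 y y0 <= K1)%R.
  rewrite eK1 /M; have := mdist_triangle m2 y Y y0; have := mdist_ge0 m1 X x0.
  by lra.
have b2 : (L + m1 x' x0 <= K1)%R.
  rewrite eK1 /M; have := mdist_triangle m1 x' X x0; have := mdist_ge0 m2 Y y0.
  by lra.
have p3 : (0 <= s3)%R by rewrite e3 mdist_ge0.
have p4 : (0 <= s4)%R by rewrite e4 mdist_ge0.
apply: ltrD.
  by apply: (@le_lt_trans _ _ (s3 * K1)%R); [rewrite ler_wpM2l|rewrite ltr_pM2r].
by apply: (@le_lt_trans _ _ (K1 * s4)%R); [rewrite ler_wpM2r|rewrite ltr_pM2l].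
Qed.
Definition lift2_seq : cauchySeq A m3 := Cauchy lift2_stable lift2_cauchy.
End Seq.
Definition lift2 (x : completion A m1) (y : completion A m2) : completion A m3 :=
  \pi_(completion A m3) (lift2_seq (repr x) (repr y)).
End Lift2.
End Lift.

Section Metrics.
Context {R : realType}.
Local Open Scope ring_scope.

Section NormMetric.
Context (V : normedZmodType R).
Let dist (x y : V) : R := `|x - y|.
Lemma norm_dist0 x : dist x x = 0.
Proof. by rewrite /dist subrr normr0. Qed.
Lemma norm_dist_eq0 x y : dist x y = 0 -> x = y.
Proof. by move=> /normr0_eq0 /subr0_eq. Qed.
Lemma norm_dist_sym x y : dist x y = dist y x.
Proof. exact: distrC. Qed.
Lemma norm_dist_triangle x y z : dist x z <= dist x y + dist y z.
Proof. exact: ler_distD. Qed.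
Definition norm_metric : metric R V :=
  Metric norm_dist0 norm_dist_eq0 norm_dist_sym norm_dist_triangle.
End NormMetric.

Definition eatan (x : \bar R) : R :=
  match x with r%:E => atan r | +oo%E => pi / 2 | -oo%E => - (pi / 2) end.

Lemma atan_inj : injective (@atan R).
Proof. exact: can_inj (@atanK R). Qed.

Lemma eatan_inj : injective eatan.
Proof.
have p0 := @pi_gt0 R.
move=> [r| |] [s| |] //=; first (by move/atan_inj ->); move=> h; exfalso.
- by have := atan_ltpi2 r; lra.
- by have := atan_gtNpi2 r; lra.
- by have := atan_ltpi2 s; lra.
- by lra.
- by have := atan_gtNpi2 s; lra.
- by lra.
Qed.

Let edist (x y : \bar R) : R := `|eatan x - eatan y|.
Lemma edist0 x : edist x x = 0.
Proof. exact: norm_dist0. Qed.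
Lemma edist_eq0 x y : edist x y = 0 -> x = y.
Proof. by move=> /norm_dist_eq0 /eatan_inj. Qed.
Lemma edist_sym x y : edist x y = edist y x.
Proof. exact: distrC. Qed.
Lemma edist_triangle x y z : edist x z <= edist x y + edist y z.
Proof. exact: ler_distD. Qed.
Definition ereal_metric : metric R (\bar R) :=
  Metric edist0 edist_eq0 edist_sym edist_triangle.

Lemma atan_lip (x y : R) : `|atan x - atan y| <= `|x - y|.
Proof.
wlog xy : x y / x < y.
  move=> h; have [/h//|/h|->] := ltgtP x y; last by rewrite !subrr.
  by rewrite distrC (distrC y).
have cont : {within `[x, y], continuous (@atan R)}.
  by apply: continuous_subspaceT => z; exact: continuous_atan.
have [z _ e] := @MVT R atan (fun z => (1 + z ^+ 2)^-1) x y xy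
  (fun z _ => is_derive1_atan z) cont.
rewrite distrC (distrC x) e normrM ler_piMl//.
rewrite ger0_norm ?invr_ge0 ?addr_ge0 ?sqr_ge0//.
by rewrite invf_le1 ?ltr_pwDl ?sqr_ge0// lerDl sqr_ge0.
Qed.
End Metrics.

Section ConditionalReals.
Context {d : Order.disp_t} (A : completeBoolType d) (R : realType).
Implicit Types a : A.
Local Open Scope ring_scope.

(* the conditional completion of a normed space *)
Definition cond (V : normedZmodType R) := completion A (norm_metric V).
Definition condReal := cond R.
Definition condEReal := completion A (@ereal_metric R).

Section VectorOps.
Context {V : normedZmodType R}.

Lemma lipD (x x' y y' : V) : norm_metric V (x + y) (x' + y') <=
  norm_metric V x x' * (1 + norm_metric V y 0) +
  (1 + norm_metric V x' 0) * norm_metric V y y'.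
Proof.
rewrite /= opprD addrACA (le_trans (ler_normD _ _))// lerD//.
  by rewrite ler_peMr// lerDl.
by rewrite ler_peMl// lerDl.
Qed.
Definition cond_add : cond V -> cond V -> cond V := lift2 ler01 lipD.

Lemma lipN (x y : V) : norm_metric V (- x) (- y) <= norm_metric V x y.
Proof. by rewrite /= -opprD normrN. Qed.
Definition cond_opp : cond V -> cond V := lift1 lipN.

Definition cond_sub (x y : cond V) : cond V := cond_add x (cond_opp y).
End VectorOps.

Definition crcst (t : R) : condReal := completion_cst A (norm_metric R) t.

Lemma lip_abs (x y : R) : norm_metric R `|x| `|y| <= norm_metric R x y.
Proof. exact: ler_dist_dist. Qed.
Definition cond_abs : condReal -> condReal := lift1 lip_abs.

Lemma lipM (x x' y y' : R) : norm_metric R (x * y) (x' * y') <=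
  norm_metric R x x' * (0 + norm_metric R y 0) +
  (0 + norm_metric R x' 0) * norm_metric R y y'.
Proof.
rewrite /= !add0r !subr0 -!normrM.
have -> : x * y - x' * y' = (x - x') * y + x' * (y - y') by ring.
exact: ler_normD.
Qed.
Definition cond_mul : condReal -> condReal -> condReal := lift2 (lexx 0) lipM.

Definition ssub (p q : step A R) : step A R := smap2 (fun s t => s - t) p q.

(* [cle_on a x y] is the inequality x <= y required on a only *)
Definition cle_on a (x y : condReal) :=
  forall r : step A R, spos r -> exists n, forall m, nle n m ->
    slt_on a (smap -%R r) (ssub (repr y m) (repr x m)).

Definition cle (x y : condReal) := cle_on \top x y.

Definition clt (x y : condReal) :=
  exists2 r : step A R, spos r & exists n, forall m, nle n m ->
    slt r (ssub (repr y m) (repr x m)).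

Definition ecst (t : \bar R) : condEReal := completion_cst A (@ereal_metric R) t.

Lemma lip_EFin (x y : R) : @ereal_metric R x%:E y%:E <= norm_metric R x y.
Proof. exact: atan_lip. Qed.
Definition creal_ereal : condReal -> condEReal := lift1 lip_EFin.

(* [\bar condReal] consists of the "pure" extended conditional reals: those
   whose three pieces +oo, finite, -oo are not mixed *)
Definition pure_ereal (u : \bar condReal) : condEReal :=
  match u with
  | r%:E => creal_ereal r
  | +oo%E => ecst +oo%E
  | -oo%E => ecst -oo%E
  end.

(* x = oo|a + r|b + (-oo)|c, where a = epiece x EPos, b = epiece x EFinite,
   c = epiece x ENeg and r = efinite x, which matters on b only *)
Inductive esign := EPos | EFinite | ENeg.

Section Decomposition.
Context (x : condEReal).
Let pos : A := bsup [set a | agree a x (ecst +oo%E)].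
Let neg : A := bsup [set a | agree a x (ecst -oo%E)].
Let pc (k : esign) : A :=
  match k with
  | EPos => pos
  | EFinite => (~` (pos `|` neg))%O
  | ENeg => neg
  end.

Lemma ecst_infty_agree a : agree a (ecst +oo%E) (ecst -oo%E) -> a = \bot%O.
Proof.
move=> h; apply/eqP; apply: contrapT => /negP a0.
have {}h : close_on (@ereal_metric R) a (fun=> step_cst A +oo%E) (fun=> step_cst A -oo%E).
  have k (t : \bar R) := repr_pi_close a (Cauchy (cst_stable (step_cst A t))
    (cst_cauchy (@ereal_metric R) (step_cst A t))).
  exact: (close_on_trans (close_on_sym (k +oo%E)) (close_on_trans h (k -oo%E))).
have p0 := @pi_gt0 R.
have pi_pos : spos (step_cst A (pi : R)).
  apply/srelP => c z t c0 cz ct.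
  by rewrite (step_cst_at c0 cz) (step_cst_at c0 ct).
have [n0 {}h] := h _ pi_pos.
have /h /srel_onP {}h : nle n0 n0.
  by apply/srelP => c z t c0 cz ct; rewrite (part_uniq c0 cz ct).
have aa := lexx a; set b := {-2}a in h aa; move: b h aa => b h aa.
move: a a0 aa => c c0 cb.
pick (step_cst A (+oo%E : \bar R)) s hs; pick (step_cst A (-oo%E : \bar R)) t ht.
pick (step_cst A (pi : R)) w hw.
pick (sdist (@ereal_metric R) (step_cst A +oo%E) (step_cst A -oo%E)) z hz.
have := h _ _ _ c0 cb hz hw.
rewrite (smap2_at c0 hs ht hz) (step_cst_at c0 hs) (step_cst_at c0 ht) (step_cst_at c0 hw) /=.
by rewrite opprK -splitr gtr0_norm// ltxx.
Qed.

Let pos_neg : (pos `&` neg)%O = \bot%O.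
Proof.
apply/eqP; apply: contrapT => /negP c0.
have [a ha {}c0] := bsup_hit (leIl pos neg) c0.
have [b hb] := bsup_hit (le_trans (leIl (pos `&` neg)%O a) (leIr _ _) : _ <= neg)%O c0.
set e := (_ `&` b)%O => e0.
suff e00 : e = \bot%O by rewrite e00 eqxx in e0.
apply: ecst_infty_agree; apply: (agree_trans (y := x)).
  by apply/agree_sym/(agree_le _ ha); rewrite /e (le_trans (leIl _ _))// leIr.
by apply: (agree_le _ hb); rewrite /e leIr.
Qed.

Lemma epiece_disj k l : k <> l -> (pc k `&` pc l)%O = \bot%O.
Proof.
have hp : (pos `&` ~` (pos `|` neg))%O = \bot%O.
  by rewrite complU meetA meetxC meet0x.
have hn : (neg `&` ~` (pos `|` neg))%O = \bot%O.
  by rewrite complU [X in (neg `&` X)%O]meetC meetA meetxC meet0x.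
by case: k l => [] [] //= _; rewrite ?pos_neg ?hp ?hn// meetC ?pos_neg ?hp ?hn.
Qed.
Lemma epiece_cover : bsup (range pc) = \top%O.
Proof.
apply/eqP; rewrite -le1x -(joinxC (pos `|` neg)%O) !leUx.
by rewrite -andbA; apply/and3P; split; apply: bsup_ub;
  [exists EPos|exists ENeg|exists EFinite].
Qed.
Definition epiece : part A esign := Part epiece_disj epiece_cover.

Definition efinite : condReal :=
  xget (crcst 0) [set r | agree (epiece EFinite) x (creal_ereal r)].

Definition evalue (k : esign) : \bar condReal :=
  match k with EPos => +oo%E | EFinite => efinite%:E | ENeg => -oo%E end.
End Decomposition.

(* piecewise extension of operations and of the order to condEReal *)
Definition emap (g : \bar condReal -> \bar condReal) (x : condEReal) : condEReal :=
  concat (epiece x) (fun k => pure_ereal (g (evalue x k))).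

Definition emap2 (g : \bar condReal -> \bar condReal -> \bar condReal)
    (x y : condEReal) : condEReal :=
  concat (refine (epiece x) (epiece y))
    (fun kl => pure_ereal (g (evalue x kl.1) (evalue y kl.2))).

Definition pure_le_on a (u v : \bar condReal) : Prop :=
  match u, v with
  | r%:E, s%:E => cle_on a r s
  | -oo%E, _ | _, +oo%E => True
  | _, _ => a = \bot%O
  end.

Definition ele (x y : condEReal) :=
  forall k l, pure_le_on (epiece x k `&` epiece y l)%O (evalue x k) (evalue y l).

Definition pure_opp (u : \bar condReal) : \bar condReal :=
  match u with r%:E => (cond_opp r)%:E | +oo%E => -oo%E | -oo%E => +oo%E end.

(* oo + (-oo) = -oo, as in [adde]; this case does not occur in the theorem *)
Definition pure_add (u v : \bar condReal) : \bar condReal :=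
  match u, v with
  | r%:E, s%:E => (cond_add r s)%:E
  | -oo%E, _ | _, -oo%E => -oo%E
  | _, _ => +oo%E
  end.

Definition pure_scale (t : R) (u : \bar condReal) : \bar condReal :=
  match u with
  | r%:E => (cond_mul (crcst t) r)%:E
  | +oo%E => if t == 0 then (crcst 0)%:E else if 0 < t then +oo%E else -oo%E
  | -oo%E => if t == 0 then (crcst 0)%:E else if 0 < t then -oo%E else +oo%E
  end.

Definition eadd := emap2 pure_add.
Definition eopp := emap pure_opp.
Definition esub (x y : condEReal) := eadd x (eopp y).
Definition escale (t : R) := emap (pure_scale t).

Definition is_esup (S : set condEReal) (s : condEReal) :=
  (forall x, S x -> ele x s) /\
  (forall t, (forall x, S x -> ele x t) -> ele s t).
Definition is_einf (S : set condEReal) (s : condEReal) :=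
  (forall x, S x -> ele s x) /\
  (forall t, (forall x, S x -> ele t x) -> ele t s).

(* (condEReal, ele) is a complete lattice, so the default is never used *)
Definition esup (S : set condEReal) : condEReal := xget (ecst -oo%E) (is_esup S).
Definition einf (S : set condEReal) : condEReal := xget (ecst +oo%E) (is_einf S).

End ConditionalReals.

Section Duality.
Context {d : Order.disp_t} (A : completeBoolType d) {R : realType}.
Context {X Y : normedModType R}.
Local Open Scope ring_scope.

Record dualPair := DualPair {
  dp_form :> {bilinear X -> Y -> R^o};
  dp_sepl : forall x, (forall y, dp_form x y = 0) -> x = 0;
  dp_sepr : forall y, (forall x, dp_form x y = 0) -> y = 0
}.

(* sigma(X, Y) is the initial topology of x |-> <x, .> in R^Y with the product
   topology, i.e. of the family of functionals <., y>; likewise sigma(Y, X) *)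
Definition weakl (b : dualPair) :=
  initial_topology (fun x : X => (fun y => b x y) : prod_topology (fun _ : Y => R^o)).
Definition weakr (b : dualPair) :=
  initial_topology (fun y : Y => (fun x => b x y) : prod_topology (fun _ : X => R^o)).

Section Pairing.
Context {b : dualPair}.
Hypothesis b_le : forall x y, `|b x y| <= `|x| * `|y|.

Lemma lip_pairing (x x' : X) (y y' : Y) : norm_metric R (b x y) (b x' y') <=
  norm_metric X x x' * (0 + norm_metric Y y 0) +
  (0 + norm_metric X x' 0) * norm_metric Y y y'.
Proof.
rewrite /= !add0r !subr0.
have -> : b x y - b x' y' = b (x - x') y + b x' (y - y').
  by rewrite linearBl linearBr /= addrA subrK.
by rewrite (le_trans (ler_normD _ _))// lerD.
Qed.
Definition pairing : cond A X -> cond A Y -> condReal A R :=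
  lift2 (lexx 0) lip_pairing.

(* the set D = {l in N_s : 1 <= l <= n} indexing a conditionally finite family;
   a stable function on D is a function on N_s that is stable on D, of which
   only the values on D are used *)
Definition sinterval (n : step A nat) : set (step A nat) :=
  [set l | nle (step_cst A 1%N) l /\ nle l n].

Definition weak_nbhd (x : cond A X) (V : set (cond A X)) :=
  exists (r : condReal A R) (n : step A nat) (y : step A nat -> cond A Y),
    [/\ clt (crcst A 0) r, stable_on (sinterval n) y &
        V = [set z | forall l, sinterval n l -> cle (cond_abs (pairing (cond_sub z x) (y l))) r]].

Definition step_ext (f : X -> condEReal A R) (z : step A X) : condEReal A R :=
  concat z f.

Definition cvec (x : X) : cond A X := completion_cst A (norm_metric X) x.

Definition cond_lower_semicontinuous (f : X -> condEReal A R) :=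
  forall x, f x = esup [set einf [set step_ext f z |
    z in [set z | V (completion_step (norm_metric X) z)]] | V in weak_nbhd (cvec x)].

Definition proper_convex (f : X -> condEReal A R) :=
  [/\ forall x (a : A), a != \bot%O -> ~ agree a (f x) (ecst A -oo%E),
      exists x0 r, f x0 = creal_ereal r &
      forall (x y : X) (t : R), 0 <= t <= 1 ->
        ele (f (t *: x + (1 - t) *: y)) (eadd (escale t (f x)) (escale (1 - t) (f y)))].

Definition fenchel_conj (f : X -> condEReal A R) (y : cond A Y) : condEReal A R :=
  esup [set esub (creal_ereal (pairing (cvec x) y)) (f x) | x in setT].

End Pairing.
End Duality.

(* Main.v *)
(* Statements about conditional objects are checked on pieces: an element of a
   completion is known on a nonzero a : A through approximations by genuine
   vectors (or reals), which exist on arbitrarily small pieces, and a conditional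
   extended real x is determined by the pieces on which x <= q, for q real. So
   inequalities reduce to inequalities between real numbers, up to an arbitrarily
   small error.

   The hull of f by weak neighbourhoods and the biconjugate both lie below f. If f
   is its biconjugate, a single y in Y_c bounds f from below near x. Conversely, let
   f be lower semi-continuous, f(x0) > q on some piece, and x1 in the domain of f.
   On a smaller piece, neighbourhoods of x0 and x1 are controlled by a genuinely
   finite family (y_l), and convexity along the segments from x1 yields
   f(z) >= q' - M sum_l |<z - x0, y_l>| with q' > q and M real. The terms
   M |<z - x0, y_l>| are then replaced one at a time by a linear term
   mu_l <z - x0, y_l> with mu_l a conditional real, the supremum of the slopes
   forced by the z with <z - x0, y_l> <= 0; convexity of f, with real
   coefficients, shows that this mu_l also works for the other z. The vector
   sum_l mu_l y_l shows that the biconjugate at x0 exceeds q. *)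
Require Import Defs.
From mathcomp Require Import all_boot all_order all_algebra generic_quotient.
From mathcomp Require Import all_classical all_reals all_analysis.
From mathcomp Require Import ring lra.
Import Order.Theory GRing.Theory Num.Theory.
Import numFieldNormedType.Exports.
Set Implicit Arguments.
Unset Strict Implicit.
Unset Printing Implicit Defensive.
Local Open Scope classical_set_scope.
Local Open Scope ring_scope.
Local Open Scope quotient_scope.

(** The obstacle is a mismatch of scalars: [f] lives on genuine vectors and is convex with real
    coefficients, while the separating functional has conditional coefficients, and conditional
    numbers are comparable only after passing to a smaller piece. The bridge is uniformity. On a
    small enough piece an element [y] of [Y_c] is replaced by one [w] of [Y] that is accurate for
    all vectors of a ball at once; the values [b v w] are then exactly linear in [v], and real
    coefficients computed from them can be fed to convexity.

    The price is the order of choices. The admissible precision depends on the size of quantities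
    that are themselves known only after approximation, so a coarse approximation of radius 1 first
    fixes a bound, and the fine precision is chosen afterwards.

    Conditional reals are built from their upper bounds on pieces. For the slope [mu_l] this works
    because [M] is always admissible and [- M] is imposed as a lower bound; a strict violation on a
    piece always contains a real gap, into which finitely many errors fit. *)

Ltac down c ec :=
  repeat match goal with
  | h : is_true (c <= ?x)%O |- _ =>
    lazymatch h with ec => fail | _ => let h' := fresh in
    have h' := le_trans ec h; clear h; rename h' into h end
  | h : nle_on c _ _ |- _ => let h' := fresh in
    have h' := nle_on_le ec h; clear h; rename h' into h
  end.

(* Replaces the current piece [c] by the nonzero [e <= c], keeping what persists. *)
Ltac shrink c c0 e e0 ec :=
  down c ec; clear ec c0; clear c; rename e into c; rename e0 into c0.

Ltac pickn c c0 p z hz :=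
  let e := fresh "e" in let e0 := fresh "e0" in let ec := fresh "ec" in
  have [z [e [e0 ec hz]]] := part_hit p c0;
  shrink c c0 e e0 ec.

(** * Approximation of elements of a completion by genuine points on small pieces *)

Section Approx.
Context {d : Order.disp_t} {A : completeBoolType d} {R : realType}.
Implicit Types (a b c e : A).

Lemma half_gt0 (t : R) : 0 < t -> 0 < t / 2.
Proof. by move=> t0; rewrite divr_gt0. Qed.

Lemma split_piece a c : c != \bot%O -> exists e,
  [/\ e != \bot%O, (e <= c)%O & (e <= a)%O \/ (e <= ~` a)%O].
Proof.
move=> c0; case: (eqVneq (c `&` a)%O \bot%O) => [h|h].
  by exists c; split => //; right; rewrite -disj_leC h.
by exists (c `&` a)%O; split; rewrite ?leIl//; left; exact: leIr.
Qed.

Section OneSpace.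
Context {E : Type} {m : metric R E}.
Implicit Types (x y : completion A m) (u : cauchySeq A m) (v w : E) (r s : R).

(* The slack [s] makes [approx_seq] depend only on the limit of [u]. *)
Definition approx_seq a u v r := forall s, 0 < s ->
  exists n0 : step A nat, forall c n w, c != \bot%O -> (c <= a)%O ->
    nle_on c n0 n -> (c <= u n w)%O -> m w v <= r + s.

Definition approx a x v r := approx_seq a (repr x) v r.

Lemma spos_cst s : 0 < s -> spos (step_cst A s).
Proof.
move=> s0; apply/srelP => c z w c0 cz cw.
by rewrite (step_cst_at c0 cz) (step_cst_at c0 cw).
Qed.

Lemma nle_on_maxl a (k k' : step A nat) : nle_on a k (smap2 maxn k k').
Proof.
apply/srel_onP => c z w c0 ca cz cw; pick k' x hx.
by rewrite (smap2_at c0 cz hx cw) leq_maxl.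
Qed.

Lemma nle_on_maxr a (k k' : step A nat) : nle_on a k' (smap2 maxn k k').
Proof.
apply/srel_onP => c z w c0 ca cz cw; pick k x hx.
by rewrite (smap2_at c0 hx cz cw) leq_maxr.
Qed.

Lemma nle_on_refl a (k : step A nat) : nle_on a k k.
Proof. by apply/srel_onP => c z w c0 ca cz cw; rewrite (part_uniq c0 cz cw). Qed.

Lemma cauchy_at u s : 0 < s -> exists n0, forall c k n v w, c != \bot%O ->
  nle_on c n0 k -> nle_on c n0 n -> (c <= u k v)%O -> (c <= u n w)%O -> m v w < s.
Proof.
move=> s0; have [n0 h] := cauchy_on u (spos_cst s0).
exists n0 => c k n v w c0 hk hn cv cw; have /srel_onP {}h := h c k n hk hn.
(* [b] retains the piece on which [h] is stated, while the picks below shrink [c]. *)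
have cc := lexx c; set b := {-2}c in h cc; move: b h cc => b h cc; clear hk hn.
pick (sdist m (u k) (u n)) z hz; pick (step_cst A s) t ht.
by have := h _ _ _ c0 cc hz ht; rewrite (smap2_at c0 cv cw hz) (step_cst_at c0 ht).
Qed.

Lemma close_at a u u' s : close_on m a u u' -> 0 < s -> exists n0, forall c n v w,
  c != \bot%O -> (c <= a)%O -> nle_on c n0 n ->
  (c <= u n v)%O -> (c <= u' n w)%O -> m v w < s.
Proof.
move=> /close_onP cl s0; have [n0 h] := cl _ (spos_cst s0).
exists n0 => c n v w c0 ca hn cv cw; have /srel_onP {}h := h c n ca hn.
have cc := lexx c; set b := {-2}c in h cc; move: b h cc => b h cc; clear hn.
pick (sdist m (u n) (u' n)) z hz; pick (step_cst A s) t ht.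
by have := h _ _ _ c0 cc hz ht; rewrite (smap2_at c0 cv cw hz) (step_cst_at c0 ht).
Qed.

Lemma approx_seq_close a u u' v r : close_on m a u u' -> approx_seq a u v r -> approx_seq a u' v r.
Proof.
move=> cl nu s s0; have s20 : 0 < s / 2 by rewrite divr_gt0.
have [n1 h1] := close_at cl s20; have [n2 h2] := nu _ s20.
exists (smap2 maxn n1 n2) => c n w c0 ca hn cw.
pickn c c0 (u n) t ht.
have l1 := h1 _ _ _ _ c0 ca (nle_max_l hn) ht cw.
have l2 := h2 _ _ _ c0 ca (nle_max_r hn) ht.
have := mdist_triangle m w t v; rewrite (mdist_sym m w t); lra.
Qed.

Lemma approx_pi a u v r : approx a (\pi_(completion A m) u) v r <-> approx_seq a u v r.
Proof.
split; apply: approx_seq_close; first exact: repr_pi_close.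
by apply: close_on_sym; exact: repr_pi_close.
Qed.

Lemma approx_agree a x y v r : agree a x y -> approx a x v r -> approx a y v r.
Proof. exact: approx_seq_close. Qed.

Lemma approx_sub a b x v r : (b <= a)%O -> approx a x v r -> approx b x v r.
Proof.
move=> ba h s s0; have [n0 {}h] := h s s0; exists n0 => c n w c0 cb.
by apply: h => //; exact: le_trans ba.
Qed.

Lemma approx_triangle a x v w r : approx a x v r -> approx a x w (r + m v w).
Proof.
move=> h s s0; have [n0 {}h] := h s s0; exists n0 => c n t c0 ca hn ct.
have := h _ _ _ c0 ca hn ct; have := mdist_triangle m t v w; lra.
Qed.

Lemma approx_le a x v r r' : r <= r' -> approx a x v r -> approx a x v r'.
Proof.
move=> rr h s s0; have [n0 {}h] := h s s0; exists n0 => c n t c0 ca hn ct.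
have := h _ _ _ c0 ca hn ct; lra.
Qed.

Lemma approx_pick x r c : 0 < r -> c != \bot%O ->
  exists v e, [/\ e != \bot%O, (e <= c)%O & approx e x v r].
Proof.
move=> r0 c0; have [n0 h] := cauchy_at (repr x) r0.
have [v [e [e0 ec ev]]] := part_hit (repr x n0) c0.
exists v, e; split=> // s s0; exists n0 => b n w b0 be hn bw.
by have := h _ _ _ _ _ b0 hn (@nle_on_refl _ _) bw (le_trans be ev); lra.
Qed.

Lemma approx_seq_late a u v r n1 s c : approx_seq a u v r -> 0 < s -> c != \bot%O -> (c <= a)%O ->
  exists n w e, [/\ e != \bot%O, (e <= c)%O, nle_on e n1 n, (e <= u n w)%O & m w v <= r + s].
Proof.
move=> h s0 c0 ca; have [n0 {}h] := h s s0; exists (smap2 maxn n0 n1).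
have [w [e [e0 ec ew]]] := part_hit (u (smap2 maxn n0 n1)) c0.
exists w, e; split=> //; first exact: nle_on_maxr.
by apply: (h _ _ _ e0 (le_trans ec ca) _ ew); exact: nle_on_maxl.
Qed.

(** At a late index on a small piece, a single value of the sequence is close to both [v] and [w];
    the slack then tends to zero. *)
Lemma approx_coh c x v w r s : c != \bot%O -> approx c x v r -> approx c x w s -> m v w <= r + s.
Proof.
move=> c0 h k; apply/ler_addgt0Pr => t t0.
have t2 : 0 < t / 2 by rewrite divr_gt0.
have [n1 {}h] := h _ t2.
have [n [z [e [e0 ec hn ez hz]]]] := approx_seq_late n1 k t2 c0 (lexx c).
have := h _ _ _ e0 ec hn ez.
have := mdist_triangle m v z w; rewrite (mdist_sym m v z); lra.
Qed.

Lemma spos_scale k (r : step A R) : 0 < k -> spos r -> spos (smap (fun t => t * k) r).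
Proof.
move=> k0 /srelP r0; apply/srelP => c z w c0 cz cw.
pickn c c0 r x hx; rewrite (step_cst_at c0 cz) (smap_at c0 hx cw).
by rewrite mulr_gt0// -(step_cst_at c0 cz); exact: r0 cz hx.
Qed.

Lemma spos_at (r : step A R) c t : spos r -> c != \bot%O -> (c <= r t)%O -> 0 < t.
Proof.
move=> /srelP r0 c0 ct; pickn c c0 (step_cst A (0 : R)) o ho.
by rewrite -(step_cst_at c0 ho); exact: r0 ct.
Qed.

(* The precision is a step function, so it may vary with the piece. *)
Lemma cauchy_approx x (r : step A R) : spos r -> exists n0, forall c n v t,
  nle_on c n0 n -> (c <= repr x n v)%O -> (c <= r t)%O -> approx c x v t.
Proof.
move=> r0; have [n0 h] := cauchy_on (repr x) r0; exists n0 => c n v t hn cv ct s s0.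
exists n0 => b k w b0 bc hk bw.
have hn' := nle_on_le bc hn; have /srel_onP {}h := h b k n hk hn'.
clear hn hn' hk; have bv := le_trans bc cv; have bt := le_trans bc ct.
have [b' bE bb] : exists2 b', b' = b & (b <= b')%O by exists b.
rewrite -bE in h; clear bE; clear bc; pickn b b0 (sdist m (repr x k) (repr x n)) z hz.
have := h _ _ _ b0 bb hz bt; rewrite (smap2_at b0 bw bv hz); lra.
Qed.

(** Agreement is tested by common approximations, so that identities between operations on
    completions reduce to identities between genuine vectors. *)
Lemma agree_approx a x y :
  (forall c s, c != \bot%O -> (c <= a)%O -> 0 < s -> exists e v,
    [/\ e != \bot%O, (e <= c)%O, approx e x v s & approx e y v s]) -> agree a x y.
Proof.
move=> h r r0.
have r40 : spos (smap (fun t => t * 4^-1) r) by apply: spos_scale.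
have [n1 h1] := cauchy_approx x r40; have [n2 h2] := cauchy_approx y r40.
exists (smap2 maxn n1 n2) => n hn; apply/srel_onP => c z t c0 ca cz ct.
have hnc : nle_on c (smap2 maxn n1 n2) n by apply: srel_on_le hn; exact: lex1.
pickn c c0 (smap (fun t => t * 4^-1) r) u hu; have eu := smap_at c0 ct hu.
pickn c c0 (repr x n) p hp; pickn c c0 (repr y n) q hq.
have nx := h1 _ _ _ _ (nle_max_l hnc) hp hu.
have ny := h2 _ _ _ _ (nle_max_r hnc) hq hu.
have t0 := spos_at r0 c0 ct.
(* Two distances [t / 4] from the terms to the limits and two distances [t / 8] from the limits to
   [v] add up to less than [t]. *)
have t8 : 0 < t / 8 by rewrite divr_gt0.
have [e [v [e0 ec kx ky]]] := h _ _ c0 ca t8.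
rewrite (smap2_at c0 hp hq cz).
have := approx_coh e0 (approx_sub ec nx) kx; have := approx_coh e0 ky (approx_sub ec ny).
have := mdist_triangle m p v q; rewrite eu; lra.
Qed.

Lemma agree_local a x y :
  (forall c, c != \bot%O -> (c <= a)%O -> exists e, [/\ e != \bot%O, (e <= c)%O & agree e x y]) ->
  agree a x y.
Proof.
move=> h; apply: agree_approx => c s c0 ca s0.
have [e [e0 ec ag]] := h c c0 ca.
have [v [f [f0 fe nx]]] := approx_pick x s0 e0.
exists f, v; split=> //; first exact: le_trans ec.
by apply: approx_agree nx; exact: agree_le ag.
Qed.

Lemma agree_top x y : agree \top%O x y -> x = y.
Proof. by move=> h; rewrite -[x]reprK -[y]reprK; apply/eqmodP/asboolP. Qed.

Lemma approx_step a (p : step A E) v : (a <= p v)%O -> approx a (completion_step m p) v 0.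
Proof.
move=> ap; apply/approx_pi => s s0; exists (step_cst A 0%N) => c n w c0 ca _ cw.
by rewrite (part_uniq c0 cw (le_trans ca ap)) mdist_refl add0r ltW.
Qed.

Lemma approx_cst a v : approx a (completion_cst A m v) v 0.
Proof.
apply: approx_step; apply: (@pushforward_val _ A _ _ (fun=> v) _ _ tt); exact: lex1.
Qed.

End OneSpace.

Lemma approx_lift1 (E F : Type) (m1 : metric R E) (m2 : metric R F) (g : E -> F)
    (gl : forall x y, m2 (g x) (g y) <= m1 x y) a x v r :
  approx a x v r -> approx a (lift1 (A := A) gl x) (g v) r.
Proof.
move=> h; apply/approx_pi => s s0; have [n0 {}h] := h s s0.
exists n0 => c n w c0 ca hn cw; pickn c c0 (repr x n) t ht.
rewrite (smap_at c0 ht cw); apply: (le_trans (gl _ _)).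
exact: h ht.
Qed.

Lemma approx_lift2 (E F G : Type) (m1 : metric R E) (m2 : metric R F) (m3 : metric R G)
    (g : E -> F -> G) (L : R) (x0 : E) (y0 : F) (L0 : 0 <= L)
    (gl : forall x x' y y', m3 (g x y) (g x' y') <=
      m1 x x' * (L + m2 y y0) + (L + m1 x' x0) * m2 y y') a x y v w z r1 r2 r3 :
  approx a x v r1 -> approx a y w r2 ->
  (forall s, 0 < s -> exists2 t, 0 < t & forall v' w',
     m1 v' v <= r1 + t -> m2 w' w <= r2 + t -> m3 (g v' w') z <= r3 + s) ->
  approx a (lift2 (A := A) L0 gl x y) z r3.
Proof.
move=> h k gz; apply/approx_pi => s s0; have [t t0 {}gz] := gz s s0.
have [n1 {}h] := h _ t0; have [n2 {}k] := k _ t0.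
exists (smap2 maxn n1 n2) => c n b c0 ca hn cb.
pickn c c0 (repr x n) x' hx; pickn c c0 (repr y n) y' hy.
rewrite (smap2_at c0 hx hy cb).
by apply: gz; [exact: h (nle_max_l hn) hx|exact: k (nle_max_r hn) hy].
Qed.

Lemma approx_lift2_lip (E F G : Type) (m1 : metric R E) (m2 : metric R F) (m3 : metric R G)
    (g : E -> F -> G) (L : R) (x0 : E) (y0 : F) (L0 : 0 <= L)
    (gl : forall x x' y y', m3 (g x y) (g x' y') <=
      m1 x x' * (L + m2 y y0) + (L + m1 x' x0) * m2 y y') a x y v w r s :
  0 <= r -> 0 <= s -> approx a x v r -> approx a y w s ->
  approx a (lift2 (A := A) L0 gl x y) (g v w)
    (r * (L + m2 w y0 + s) + (L + m1 v x0) * s).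
Proof.
move=> r0 s0 nx ny; apply: (approx_lift2 _ _ nx ny) => t t0.
have wy := Defs.mdist_ge0 m2 w y0; have vx := Defs.mdist_ge0 m1 v x0.
(* [K] is the total coefficient of the slack [u] in the excess over the claimed radius; the 1
   accounts for [u * u <= u]. *)
pose K := 1 + (L + m2 w y0 + s) + (L + m1 v x0) + r.
have K0 : 0 < K by rewrite /K; lra.
have m0 : 0 < Num.min 1 (t / K) by rewrite lt_min ltr01 divr_gt0.
exists (Num.min 1 (t / K)) => // v' w'.
set u := Num.min _ _ in m0 * => hv hw.
have u1 : u <= 1 by rewrite ge_min lexx.
have uK : u * K <= t by rewrite -ler_pdivlMr// ge_min lexx orbT.
apply: (le_trans (gl _ _ _ _)).
have h1 := mdist_triangle m2 w' w y0.
have h2 : m1 v' v * (L + m2 w' y0) <= (r + u) * (L + m2 w y0 + s + u).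
  by apply: ler_pM => //; rewrite ?addr_ge0 ?Defs.mdist_ge0//; lra.
have h3 : (L + m1 v x0) * m2 w' w <= (L + m1 v x0) * (s + u).
  by apply: ler_wpM2l => //; lra.
have h4 : u * u <= u by rewrite -[leRHS]mulr1 ler_wpM2l// ltW.
apply: (le_trans (lerD h2 h3)); move: uK; rewrite /K; lra.
Qed.

End Approx.

(** * Inequalities and operations on conditional reals through approximations *)

Section Reals.
Context {d : Order.disp_t} {A : completeBoolType d} {R : realType}.
Implicit Types (a b c e : A) (x y : condReal A R) (p q r s t : R).

(* the inequality [x <= q] required on [c] only *)
Definition rle c x q := forall e p r, e != \bot%O -> (e <= c)%O -> approx e x p r -> p - r <= q.

Lemma rle_sub a b x q : (b <= a)%O -> rle a x q -> rle b x q.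
Proof. by move=> ba h e p r e0 eb; apply: h => //; exact: le_trans ba. Qed.

Lemma rle_trans c x q q' : q <= q' -> rle c x q -> rle c x q'.
Proof. by move=> qq h e p r e0 ec /(h _ _ _ e0 ec) /le_trans; apply. Qed.

(** The factor [k] allows an approximation of radius [s] to cost a fixed multiple of [s]; it is
    chosen before [s], which tends to zero. *)
Lemma rleI k c x q : 0 <= k ->
  (forall e s, e != \bot%O -> (e <= c)%O -> 0 < s -> exists f p,
    [/\ f != \bot%O, (f <= e)%O, approx f x p s & p <= q + k * s]) -> rle c x q.
Proof.
move=> k0 h e p r e0 ec np; apply/ler_addgt0Pr => t t0.
have k1 : 0 < 1 + k by rewrite ltr_pwDl.
have s0 : 0 < t / (1 + k) by rewrite divr_gt0.
have [f [p' [f0 fe np' le']]] := h e _ e0 ec s0.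
have := approx_coh f0 (approx_sub fe np) np'; rewrite /= ler_norml => /andP[_].
have : t = t / (1 + k) + k * (t / (1 + k)) by field; rewrite gt_eqF.
lra.
Qed.

Lemma rle_local c x q :
  (forall e, e != \bot%O -> (e <= c)%O -> exists f, [/\ f != \bot%O, (f <= e)%O & rle f x q]) ->
  rle c x q.
Proof.
move=> h e p r e0 ec np; have [f [f0 fe rf]] := h e e0 ec.
exact: rf f0 (lexx _) (approx_sub fe np).
Qed.

Lemma rle_rc c x q : (forall q', q < q' -> rle c x q') -> rle c x q.
Proof.
move=> h e p r e0 ec np; apply/ler_addgt0Pr => t t0.
by apply: (h (q + t) _ e p r e0 ec np); rewrite ltrDl.
Qed.

Lemma approx_rle c x p r q : approx c x p r -> p + r <= q -> rle c x q.
Proof.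
move=> np le' e p' r' e0 ec np'.
have := approx_coh e0 (approx_sub ec np) np'; rewrite /= ler_norml => /andP[]; lra.
Qed.

Lemma not_rle c x q : ~ rle c x q -> exists e p r,
  [/\ e != \bot%O, (e <= c)%O, approx e x p r & q < p - r].
Proof.
move=> h; apply: contrapT => k; apply: h => e p r e0 ec np.
by rewrite leNgt; apply/negP => lt'; apply: k; exists e, p, r.
Qed.

Lemma rle_agree c x y q : agree c x y -> rle c x q -> rle c y q.
Proof.
move=> xy h e p r e0 ec np; apply: (h e p r e0 ec).
by apply: approx_agree np; apply: agree_sym; exact: agree_le ec xy.
Qed.

Lemma approx_ball c x p q r s : approx c x p r -> approx c x q s -> c != \bot%O ->
  p - r <= q + s.
Proof.
move=> h k c0; have := approx_coh c0 h k; rewrite /= ler_norml => /andP[]; lra.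
Qed.

(** Frees the order from sequences and indices: it fails exactly when some pair of approximations on
    a common piece contradicts it. *)
Lemma cle_onP a x y : cle_on a x y <-> forall c p q r s, c != \bot%O -> (c <= a)%O ->
  approx c x p r -> approx c y q s -> p - r <= q + s.
Proof.
split=> [h c p q r s c0 ca nx ny|h t t0].
  apply/ler_addgt0Pr => t t0.
  have t4 : 0 < t / 4 by rewrite divr_gt0.
  have [n1 {}h] := h _ (spos_cst t4).
  have [n2 {}nx] := nx _ t4; have [n3 {}ny] := ny _ t4.
  pose n := smap2 maxn n1 (smap2 maxn n2 n3).
  have n1n : nle n1 n by exact: nle_on_maxl.
  have nn : nle_on c (smap2 maxn n2 n3) n by exact: nle_on_maxr.
  have {}h := proj1 (srel_onP _ _ _ _) (h n n1n).
  have [b' bE bb] : exists2 b', b' = c & (c <= b')%O by exists c.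
  rewrite -bE in nx ny; clear bE.
  pickn c c0 (repr x n) v hv; pickn c c0 (repr y n) w hw.
  pickn c c0 (smap -%R (step_cst A (t / 4))) z hz.
  pickn c c0 (step_cst A (t / 4)) o ho.
  pickn c c0 (ssub (repr y n) (repr x n)) u hu.
  have := h _ _ _ c0 ca hz hu.
  rewrite (smap_at c0 ho hz) (step_cst_at c0 ho) (smap2_at c0 hw hv hu).
  have := nx _ _ _ c0 bb (nle_max_l nn) hv; have := ny _ _ _ c0 bb (nle_max_r nn) hw.
  rewrite /= !ler_norml => /andP[? ?] /andP[? ?]; lra.
have t40 : spos (smap (fun t => t * 4^-1) t) by apply: spos_scale.
have [n1 h1] := cauchy_approx x t40; have [n2 h2] := cauchy_approx y t40.
exists (smap2 maxn n1 n2) => n hn; apply/srel_onP => c z w c0 ca cz cw.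
have hnc : nle_on c (smap2 maxn n1 n2) n by apply: srel_on_le hn; exact: lex1.
pickn c c0 t t' ht; pickn c c0 (smap (fun t => t * 4^-1) t) u hu; have eu := smap_at c0 ht hu.
pickn c c0 (repr x n) p hp; pickn c c0 (repr y n) q hq.
have nx := h1 _ _ _ _ (nle_max_l hnc) hp hu.
have ny := h2 _ _ _ _ (nle_max_r hnc) hq hu.
have := h _ _ _ _ _ c0 ca nx ny.
have := spos_at t0 c0 ht.
rewrite (smap_at c0 ht cz) (smap2_at c0 hq hp cw) eu; lra.
Qed.

(** The strict order provides a positive step function below [x]; where it is constant, its value is
    a real lower bound. This turns the conditional radius of a neighbourhood into a real one. *)
Lemma clt_pos x : clt (crcst A (0 : R)) x -> forall c, c != \bot%O ->
  exists e r, [/\ e != \bot%O, (e <= c)%O, 0 < r &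
    forall f p s, f != \bot%O -> (f <= e)%O -> approx f x p s -> r <= p + s].
Proof.
move=> [t t0 [n1 h]] c c0.
have [r [e [e0 ec er]]] := part_hit t c0.
exists e, r; split=> //; first exact: spos_at er.
move=> f p s f0 fe nf; have fr := le_trans fe er.
apply/ler_addgt0Pr => u u0; have u2 : 0 < u / 2 by rewrite divr_gt0.
have nz : approx f (crcst A (0 : R)) 0 0 := approx_cst (m := norm_metric R) f 0.
have [n2 {}nf] := nf _ u2; have [n3 {}nz] := nz _ u2.
pose n := smap2 maxn n1 (smap2 maxn n2 n3).
have n1n : nle n1 n by exact: nle_on_maxl.
have nn : nle_on f (smap2 maxn n2 n3) n by exact: nle_on_maxr.
have {}h := proj1 (srelP _ _ _) (h n n1n).
have [b' bE bb] : exists2 b', b' = f & (f <= b')%O by exists f.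
rewrite -bE in nf nz; clear bE.
pickn f f0 (repr x n) v hv; pickn f f0 (repr (crcst A (0 : R)) n) w hw.
pickn f f0 (ssub (repr x n) (repr (crcst A (0 : R)) n)) z hz.
have := h _ _ _ f0 fr hz; rewrite (smap2_at f0 hv hw hz).
have := nf _ _ _ f0 bb (nle_max_l nn) hv; have := nz _ _ _ f0 bb (nle_max_r nn) hw.
rewrite /= !ler_norml => /andP[? ?] /andP[? ?]; lra.
Qed.

Lemma approx_crcst c p : approx c (crcst A p) p 0.
Proof. exact: approx_cst. Qed.

Lemma clt_cst p : 0 < p -> clt (crcst A (0 : R)) (crcst A p).
Proof.
move=> p0; exists (step_cst A (p / 2)); first by apply: spos_cst; rewrite divr_gt0.
have p4 : 0 < p / 8 by rewrite divr_gt0.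
have [n1 h1] := approx_crcst \top%O p p4; have [n2 h2] := approx_crcst \top%O 0 p4.
exists (smap2 maxn n1 n2) => n hn; apply/srelP => c z w c0 cz cw.
have hnc : nle_on c (smap2 maxn n1 n2) n by apply: srel_on_le hn; exact: lex1.
pickn c c0 (repr (crcst A p) n) v hv; pickn c c0 (repr (crcst A (0 : R)) n) v' hv'.
have := h1 _ _ _ c0 (lex1 _) (nle_max_l hnc) hv.
have := h2 _ _ _ c0 (lex1 _) (nle_max_r hnc) hv'.
rewrite (step_cst_at c0 cz) (smap2_at c0 hv hv' cw).
rewrite /= !ler_norml => /andP[? ?] /andP[? ?]; lra.
Qed.

Lemma approx_abs c x p r : approx c x p r -> approx c (cond_abs x) `|p| r.
Proof. exact: approx_lift1. Qed.

Lemma approx_mul c x y p q r s : 0 <= r -> 0 <= s -> approx c x p r -> approx c y q s ->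
  approx c (cond_mul x y) (p * q) (r * (`|q| + s) + `|p| * s).
Proof.
move=> r0 s0 nx ny; have := approx_lift2_lip (lexx 0) (@lipM R) r0 s0 nx ny.
by rewrite /= !subr0 !add0r.
Qed.

Section Add.
Context {V : normedZmodType R}.
Implicit Types (u v : V) (X Y : cond A V).

Lemma approx_add c X Y u v r s : approx c X u r -> approx c Y v s ->
  approx c (cond_add X Y) (u + v) (r + s).
Proof.
move=> nx ny; apply: (approx_lift2 _ _ nx ny) => t t0.
exists (t / 2); first by rewrite divr_gt0.
move=> v' w' /= h1 h2; rewrite opprD addrACA.
apply: (le_trans (ler_normD _ _)); lra.
Qed.

Lemma approx_opp c X u r : approx c X u r -> approx c (cond_opp X) (- u) r.
Proof. exact: approx_lift1. Qed.

Lemma approx_csub c X Y u v r s : approx c X u r -> approx c Y v s ->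
  approx c (cond_sub X Y) (u - v) (r + s).
Proof. by move=> nx ny; apply: approx_add => //; exact: approx_opp. Qed.
End Add.

End Reals.

(** * Realizing a locally bounded cut by a conditional real *)

Section Cut.
Context {d : Order.disp_t} {A : completeBoolType d} {R : realType}.
Implicit Types (a b c e : A) (p q r s t : R).

(* [P a q] stands for [x <= q] on [a], where [x] is a possibly infinite
   conditional number; see [rcut] and [ecut]. *)
Record cut (P : A -> R -> Prop) : Prop := Cut {
  cut_sub : forall a b q, (b <= a)%O -> P a q -> P b q;
  cut_trans : forall a q q', q <= q' -> P a q -> P a q';
  cut_local : forall a q, (forall c, c != \bot%O -> (c <= a)%O ->
    exists e, [/\ e != \bot%O, (e <= c)%O & P e q]) -> P a q;
  cut_rc : forall a q, (forall q', q < q' -> P a q') -> P a q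
}.

Section RealCut.
Context (P : A -> R -> Prop).
Hypothesis P_cut : cut P.
Hypothesis P_ub : forall c, c != \bot%O ->
  exists e q, [/\ e != \bot%O, (e <= c)%O & P e q].
Hypothesis P_lb : forall c, c != \bot%O ->
  exists e q, [/\ e != \bot%O, (e <= c)%O &
    forall f, f != \bot%O -> (f <= e)%O -> ~ P f q].

(** On the whole of [c] the number to be built lies between two consecutive points of the grid of
    mesh [1 / (k + 1)]; the second clause runs over all parts because failure on [c] alone would not
    pass to smaller pieces. *)
Let at_grid k (j : int) c := P c ((j + 1)%:~R / k.+1%:R) /\
  forall f, f != \bot%O -> (f <= c)%O -> ~ P f (j%:~R / k.+1%:R).

Let grid_piece k (j : int) : A := bsup [set c | at_grid k j c].

Let grid_hit k j c : c != \bot%O -> (c <= grid_piece k j)%O ->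
  exists e, [/\ e != \bot%O, (e <= c)%O & at_grid k j e].
Proof.
move=> c0 /bsup_hit /(_ c0) [e [h1 h2] ce0]; exists (c `&` e)%O; split=> //.
  exact: leIl.
split; first by apply: (cut_sub P_cut _ h1); exact: leIr.
by move=> f f0 fe; apply: h2 => //; exact: le_trans fe (leIr _ _).
Qed.

Let frac_le k (j l : int) : (j <= l)%R -> (j%:~R / k.+1%:R : R) <= l%:~R / k.+1%:R.
Proof. by move=> jl; rewrite ler_pM2r ?invr_gt0// ler_int. Qed.

Let grid_disj k i j : i <> j -> (grid_piece k i `&` grid_piece k j)%O = \bot%O.
Proof.
move=> ne; apply/eqP; apply: contrapT => /negP h; apply: ne.
have [e [e0 ec [hi hi']]] := grid_hit h (leIl _ _).
have [f [f0 fe [hj hj']]] := grid_hit e0 (le_trans ec (leIr _ _)).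
apply/eqP; rewrite eq_le !leNgt; apply/andP; split; apply/negP => lt'.
- apply: (hi' f f0 fe); apply: (cut_trans P_cut _ hj).
  by rewrite frac_le// lezD1.
- apply: (hj' f f0 (lexx _)); apply: (cut_trans P_cut _ (cut_sub P_cut fe hi)).
  by rewrite frac_le// lezD1.
Qed.

Let grid_cover k : bsup (range (grid_piece k)) = \top%O.
Proof.
apply: part_subproof => c c0.
have [e1 [q1 [e10 ec1 lb]]] := P_lb c0; have [e2 [q2 [e20 ec2 ub]]] := P_ub e10.
pose j0 := Num.floor (q1 * k.+1%:R).
have hj0 : (j0%:~R / k.+1%:R : R) <= q1.
  by rewrite ler_pdivrMr// Num.Theory.floor_le.
(* For the least such [n], the preceding grid point fails on every part of the piece found. The
   value 0 is excluded, since the grid point of index [j0] is below the local lower bound [q1]. *)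
pose Q (n : nat) :=
  `[< exists f, [/\ f != \bot%O, (f <= e2)%O & P f ((j0 + n%:Z)%:~R / k.+1%:R)] >].
have exQ : exists n, Q n.
  exists `|Num.ceil (q2 * k.+1%:R) - j0|%N; apply/asboolP; exists e2; split => //.
  apply: (cut_trans P_cut _ ub); rewrite ler_pdivlMr//.
  apply: (le_trans (Num.Theory.ceil_ge _)); rewrite ler_int abszE -lerBlDl.
  exact: ler_norm.
case: (ex_minnP exQ) => n /asboolP[f [f0 fe Pf]] nmin.
case: n Pf nmin => [Pf|n Pf nmin].
  exfalso; apply: (lb f f0 (le_trans fe ec2)).
  by apply: (cut_trans P_cut _ Pf); rewrite addr0.
exists (j0 + n%:Z), f; split => //; first exact: le_trans fe (le_trans ec2 ec1).
apply: bsup_ub; split; first by move: Pf; rewrite -addrA intS (addrC 1).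
move=> g g0 gf Pg.
have /nmin : Q n by apply/asboolP; exists g; split=> //; exact: le_trans fe.
by rewrite ltnn.
Qed.

Let grid k : part A int := Part (@grid_disj k) (@grid_cover k).
Let u k : step A R := push_part (fun j : int => j%:~R / k.+1%:R) (grid k).
(** A conditional index is itself a partition indexed by [nat], so it can be concatenated along: the
    term is [u k] where [n] equals [k]. *)
Let w (n : step A nat) : step A R := concat n u.

(* [t <= x <= t + 1 / (k + 1)] on [e], where [x] is the cut being realized *)
Let val k t e := P e (t + k.+1%:R^-1) /\ forall f, f != \bot%O -> (f <= e)%O -> ~ P f t.

Let w_val (n : step A nat) k t c : c != \bot%O -> (c <= n k)%O -> (c <= w n t)%O ->
  exists e, [/\ e != \bot%O, (e <= c)%O & val k t e].
Proof.
move=> c0 cn cw.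
have /step_agreeP ag : step_agree (n k) (w n) (u k) by exact: (concatP n u k).
have [j [e [e0 ec ej je]]] := pushforward_hit c0 (ag _ _ c0 cn cw).
have [f [f0 fe [h1 h2]]] := grid_hit e0 ej.
exists f; split => //; first exact: le_trans ec.
rewrite -je; split => //.
by rewrite intrD mulrDl mul1r in h1.
Qed.

Let val_close e k k' t t' : e != \bot%O -> val k t e -> val k' t' e ->
  t - t' < k'.+1%:R^-1.
Proof.
move=> e0 [h1 h2] [h3 h4]; rewrite ltNge; apply/negP => le'.
by apply: (h2 e e0 (lexx _)); apply: (cut_trans P_cut _ h3); rewrite addrC -lerBrDr.
Qed.

Let val_sub e f k t : (f <= e)%O -> val k t e -> val k t f.
Proof.
move=> fe [h1 h2]; split; first exact: (cut_sub P_cut fe).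
by move=> g g0 gf; apply: h2 => //; exact: le_trans fe.
Qed.

Let w_stable : stable w.
Proof.
apply/stableP => a n n' /step_agree_eq/srel_onP h.
apply/step_agree_eq/srel_onP => c x y c0 ca cx cy.
pickn c c0 n k hk; pickn c c0 n' k' hk'.
have kk := h _ _ _ c0 ca hk hk'; rewrite -kk in hk'.
have /step_agreeP ag : step_agree (n k) (w n) (u k) by exact: (concatP n u k).
have /step_agreeP ag' : step_agree (n' k) (w n') (u k) by exact: (concatP n' u k).
exact: (part_uniq c0 (ag _ _ c0 hk cx) (ag' _ _ c0 hk' cy)).
Qed.

Let inv_le (k l : nat) : (k <= l)%N -> (l.+1%:R^-1 : R) <= k.+1%:R^-1.
Proof. by move=> kl; rewrite lef_pV2 ?posrE// ler_nat. Qed.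

Let w_close (n n' : step A nat) k c x y : c != \bot%O -> (c <= n k)%O -> nle_on c n n' ->
  (c <= w n x)%O -> (c <= w n' y)%O -> `|x - y| < k.+1%:R^-1.
Proof.
move=> c0 ck hn cx cy.
have [l [b [b0 bc bl]]] := part_hit n' c0.
have kl : (k <= l)%N.
  by move/srel_onP: hn => hn; exact: (hn _ _ _ b0 bc (le_trans bc ck) bl).
have [e [e0 eb v1]] := w_val b0 (le_trans bc ck) (le_trans bc cx).
have [f [f0 fe v2]] := w_val e0 (le_trans eb bl) (le_trans eb (le_trans bc cy)).
have h1 := val_close f0 (val_sub fe v1) v2; have h2 := val_close f0 v2 (val_sub fe v1).
rewrite ltr_norml ltrNl opprB h2 /=; exact: lt_le_trans h1 (inv_le kl).
Qed.

Let w_cauchy : is_cauchy (norm_metric R) w.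
Proof.
(* From this index on the mesh is below [t / 2], and both terms are compared with the term at
   [n0]. *)
move=> r r0; pose n0 : step A nat := smap (fun t => Num.truncn (2 / t)) r.
exists n0 => n n' hn hn'; apply/srelP => c z t c0 cz ct.
pickn c c0 n0 k hk; have ek := smap_at c0 ct hk.
have hnc : nle_on c n0 n by apply: srel_on_le hn; exact: lex1.
have hnc' : nle_on c n0 n' by apply: srel_on_le hn'; exact: lex1.
pickn c c0 (w n) x hx; pickn c c0 (w n') y hy; pickn c c0 (w n0) v hv.
rewrite (smap2_at c0 hx hy cz) /=.
have h1 := w_close c0 hk hnc hv hx; have h2 := w_close c0 hk hnc' hv hy.
have t0 := spos_at r0 c0 ct.
have kt : k.+1%:R^-1 < t / 2.
  rewrite -[t / 2]invrK ltf_pV2 ?posrE ?invr_gt0 ?divr_gt0//.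
  by rewrite invf_div ek truncnS_gt.
rewrite (distrC v) in h1.
apply: (le_lt_trans (ler_distD v _ _)); apply: (lt_trans (ltrD h1 h2)).
by rewrite [ltRHS]splitr ltrD.
Qed.

Let inv_small (s : R) : 0 < s -> exists k : nat, k.+1%:R^-1 < s.
Proof.
move=> s0; exists (Num.truncn (s^-1)); rewrite -[s in ltRHS]invrK ltf_pV2 ?posrE ?invr_gt0//.
exact: truncnS_gt.
Qed.

Let val_approx c k s : c != \bot%O -> k.+1%:R^-1 <= s -> exists e t,
  [/\ e != \bot%O, (e <= c)%O, val k t e &
      approx e (\pi_(condReal A R) (Cauchy w_stable w_cauchy) : condReal A R) t s].
Proof.
move=> c0 ks.
pose n : step A nat := step_cst A k.
have cn : (c <= n k)%O.
  by apply: (@pushforward_val _ A _ _ (fun=> k) _ _ tt); exact: lex1.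
have [t [b [b0 bc bt]]] := part_hit (w n) c0.
have [e [e0 eb v]] := w_val b0 (le_trans bc cn) bt.
exists e, t; split => //; first exact: le_trans bc.
apply/approx_pi => s' s'0; exists n => f n' t' f0 fe hn ft'.
have fc := le_trans fe (le_trans eb bc).
have := w_close f0 (le_trans fc cn) hn (le_trans fe (le_trans eb bt)) ft'.
rewrite /= distrC => /ltW /le_trans; apply.
by rewrite (le_trans ks)// lerDl ltW.
Qed.

(** Grid values determine the limit up to the mesh, and right continuity of the cut removes the
    mesh. *)
Lemma rcut : exists x : condReal A R, forall c q, rle c x q <-> P c q.
Proof.
exists (\pi_(condReal A R) (Cauchy w_stable w_cauchy)) => c q; split=> h.
  apply: (cut_rc P_cut) => q' qq'; apply: (cut_local P_cut) => e e0 ec.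
  have s0 : 0 < (q' - q) / 2 by rewrite divr_gt0// subr_gt0.
  have [k hk] := inv_small s0.
  have [f [t [f0 fe [v _] nt]]] := val_approx e0 (ltW hk).
  exists f; split => //; apply: (cut_trans P_cut _ v).
  have := h f _ _ f0 (le_trans fe ec) nt; move: hk; move: (k.+1%:R^-1) => a; lra.
apply: (@rleI _ _ _ 1) => // e s e0 ec s0.
have [k hk] := inv_small s0.
have [f [t [f0 fe [_ v] nt]]] := val_approx e0 (ltW hk).
exists f, t; split => //; rewrite leNgt; apply/negP => lt'.
apply: (v f f0 (lexx _)).
apply: (cut_trans P_cut _ (cut_sub P_cut (le_trans fe ec) h)); lra.
Qed.
End RealCut.

End Cut.

(** * Extended conditional reals on the arctangent scale *)

Section EReals.
Context {d : Order.disp_t} {A : completeBoolType d} {R : realType}.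
Implicit Types (a b c e : A) (x y : condEReal A R) (p q r s t : R).

Lemma lift1_agree (E F : Type) (m1 : metric R E) (m2 : metric R F) (g : E -> F)
    (gl : forall v w, m2 (g v) (g w) <= m1 v w) a (x y : completion A m1) :
  agree a x y -> agree a (lift1 gl x) (lift1 gl y).
Proof.
move=> xy; apply: agree_approx => c s c0 ca s0.
have [v [e [e0 ec nx]]] := approx_pick x s0 c0.
exists e, (g v); split => //; apply: approx_lift1 => //.
by apply: approx_agree nx; exact: agree_le (le_trans ec ca) xy.
Qed.

Lemma lip_eatan (u v : \bar R) : norm_metric R (eatan u) (eatan v) <= @ereal_metric R u v.
Proof. by []. Qed.
Definition eat : condEReal A R -> condReal A R := lift1 lip_eatan.

(** [eatan] is an isometry for the metric that defines [condEReal], hence lifts. Comparing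
    arctangents tests [x <= q] without separating the finite part of [x] from the infinite ones. *)
Definition le_at c x q := rle c (eat x) (atan q).

Lemma eatan_ge (u : \bar R) : - (pi / 2) <= eatan u.
Proof.
have p0 := @pi_gt0 R.
by case: u => [u| |] /=; [have := atan_gtNpi2 u|..]; lra.
Qed.

Lemma eatan_le (u : \bar R) : eatan u <= pi / 2.
Proof.
have p0 := @pi_gt0 R.
by case: u => [u| |] /=; [have := atan_ltpi2 u|..]; lra.
Qed.

Lemma atanD q t : 0 <= t -> atan (q + t) <= atan q + t.
Proof.
move=> t0; have := atan_lip (q + t) q.
rewrite [in leRHS]addrAC subrr add0r (ger0_norm t0) ler_norml => /andP[_]; lra.
Qed.

Lemma approx_eat c x v r : approx c x v r -> approx c (eat x) (eatan v) r.
Proof. exact: approx_lift1. Qed.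

Lemma le_at_cut x : cut (fun c q => le_at c x q).
Proof.
split.
- by move=> a b q; exact: rle_sub.
- by move=> a q q' /le_atan; exact: rle_trans.
- by move=> a q; exact: rle_local.
- move=> a q h; apply: rle_rc => t tq.
  apply: (rle_trans _ (h (q + (t - atan q)) _)); last by rewrite ltrDl subr_gt0.
  apply: (le_trans (atanD _ _)); first by rewrite subr_ge0 ltW.
  by rewrite subrKC.
Qed.

Lemma le_at_agree c x y q : agree c x y -> le_at c x q -> le_at c y q.
Proof. by move=> xy; apply: rle_agree; exact: lift1_agree. Qed.

Lemma le_at_sub a b x q : (b <= a)%O -> le_at a x q -> le_at b x q.
Proof. exact: rle_sub. Qed.

Lemma not_le_at c x q : ~ le_at c x q -> exists e,
  [/\ e != \bot%O, (e <= c)%O & forall f, f != \bot%O -> (f <= e)%O -> ~ le_at f x q].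
Proof.
move=> h; apply: contrapT => k; apply: h.
apply: (cut_local (le_at_cut x)) => e e0 ec; apply: contrapT => h; apply: k.
by exists e; split => // f f0 fe lx; apply: h; exists f.
Qed.

Definition clip t : R := Num.max (- (pi / 2)) (Num.min (pi / 2) t).

(** The inverse of [eatan] after the retraction [clip] onto its range; defined on the whole line and
    1-Lipschitz, it lifts to the completions. *)
Definition etan t : \bar R :=
  if pi / 2 <= t then +oo%E else if t <= - (pi / 2) then -oo%E else (tan t)%:E.

Lemma eatan_etan t : eatan (etan t) = clip t.
Proof.
have p0 := @pi_gt0 R.
rewrite /etan /clip; case: (leP (pi / 2) t) => h1 /=.
  by rewrite max_r//; lra.
case: (leP t (- (pi / 2))) => h2 /=; first by [].
by rewrite tanK// in_itv /= h1 h2.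
Qed.

Variant clip_spec t : R -> Prop :=
  | ClipHigh of pi / 2 <= t : clip_spec t (pi / 2)
  | ClipLow of t <= - (pi / 2) : clip_spec t (- (pi / 2))
  | ClipMid of - (pi / 2) <= t & t <= pi / 2 : clip_spec t t.

Lemma clipP t : clip_spec t (clip t).
Proof.
have p0 := @pi_gt0 R; rewrite /clip; case: (leP (pi / 2) t) => h1.
  by rewrite max_r; [constructor|lra].
by case: leP => h2; constructor; rewrite // ltW.
Qed.

Lemma lip_etan s t : @ereal_metric R (etan s) (etan t) <= norm_metric R s t.
Proof.
have p0 := @pi_gt0 R.
have h1 := ler_norm (s - t); have := ler_norm (t - s); rewrite (distrC t s) => h2.
rewrite /= !eatan_etan ler_norml.
by case: (clipP s) => *; case: (clipP t) => *; apply/andP; split; lra.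
Qed.

Section ERealCut.
Context (P : A -> R -> Prop).
Hypothesis P_cut : cut P.

(** The cut [P] transported to the arctangent scale. The lower bound is imposed on nonzero pieces
    only, since a cut holds vacuously at [\bot]. *)
Let Q c t := (c != \bot%O -> - (pi / 2) <= t) /\ forall q, t < atan q -> P c q.

Let Q_cut : cut Q.
Proof.
split.
- move=> a b q ba [h1 h2]; split.
    by move=> b0; apply: h1; apply: contra_neq b0 => a0; apply/eqP; rewrite -lex0 -a0.
  by move=> q' /h2; exact: (cut_sub P_cut).
- move=> a q q' qq [h1 h2]; split; first by move=> /h1 /le_trans; apply.
  by move=> t qt; apply: h2; exact: le_lt_trans qt.
- move=> a q h; split.
    by move=> a0; have [e [e0 ea [h1 _]]] := h a a0 (lexx _); exact: h1.
  move=> t qt; apply: (cut_local P_cut) => c c0 ca.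
  have [f [f0 fc [_ h2]]] := h c c0 ca; exists f; split => //; exact: h2.
- move=> a q h; split.
    move=> a0; apply/ler_addgt0Pr => t t0; have qt : q < q + t by rewrite ltrDl.
    by have [h1 _] := h _ qt; exact: h1.
  move=> t qt; have [] : q < (q + atan t) / 2 /\ (q + atan t) / 2 < atan t by split; lra.
  by move=> /h[_]; apply.
Qed.

(** On the arctangent scale the cut is bounded, infinite values becoming [pi / 2] and [- pi / 2]; so
    it comes from a conditional real, which is carried back by [etan]. *)
Lemma ecut : exists x : condEReal A R, forall c q, le_at c x q <-> P c q.
Proof.
have p0 := @pi_gt0 R.
have ub c : c != \bot%O -> exists e q, [/\ e != \bot%O, (e <= c)%O & Q e q].
  move=> c0; exists c, (pi / 2); split => //; split; first by move=> _; lra.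
  by move=> q; rewrite ltNge => /negP[]; rewrite ltW// atan_ltpi2.
have lb c : c != \bot%O -> exists e q, [/\ e != \bot%O, (e <= c)%O &
    forall f, f != \bot%O -> (f <= e)%O -> ~ Q f q].
  move=> c0; exists c, (- (pi / 2) - 1); split => // f f0 _ [/(_ f0)]; lra.
have [s hs] := rcut Q_cut ub lb.
exists (lift1 lip_etan s) => c q.
have sup : rle c s (pi / 2).
  apply/hs; split; first by move=> _; lra.
  by move=> t; rewrite ltNge => /negP[]; rewrite ltW// atan_ltpi2.
have sub f : f != \bot%O -> rle f s (- (pi / 2) - 1) -> False.
  by move=> f0 /hs[/(_ f0)]; lra.
transitivity (rle c s (atan q)); last first.
  rewrite hs; split=> [[_ h]|h].
    by apply: (cut_rc P_cut) => q' qq; apply: h; exact: lt_atan.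
  split=> [_|t qt]; first by rewrite ltW// atan_gtNpi2.
  apply: (cut_trans P_cut _ h); rewrite leNgt; apply/negP => /lt_atan; lra.
have q1 := atan_ltpi2 q; have q2 := atan_gtNpi2 q.
split=> h; apply: (@rleI _ _ _ 2) => // e u e0 ec u0;
  have [p [f [f0 fe np]]] := approx_pick s u0 e0; exists f.
- exists p; split => //.
  have := approx_eat (approx_lift1 lip_etan np); rewrite eatan_etan => np'.
  have := h _ _ _ f0 (le_trans fe ec) np'.
  have := sup _ _ _ f0 (le_trans fe ec) np.
  by case: (clipP p) np' => *; lra.
- have := approx_eat (approx_lift1 lip_etan np); rewrite eatan_etan => np'.
  exists (clip p); split => //.
  have := h _ _ _ f0 (le_trans fe ec) np.
  by case: clipP => *; lra.
Qed.
End ERealCut.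

Lemma le_at_approx f x y v w r : f != \bot%O -> 0 < r ->
  (forall q, le_at f y q -> le_at f x q) ->
  approx f x v r -> approx f y w r -> eatan v <= eatan w + 2 * r.
Proof.
move=> f0 r0 h nx ny; rewrite leNgt; apply/negP => lt'.
have p0 := @pi_gt0 R.
have := eatan_le v; have := eatan_ge w => h1 h2.
(* The midpoint is strictly inside the range of [atan] and more than [r] away from both values, so
   [tan t] is a real number separating [y] from [x]. *)
pose t := (eatan w + eatan v) / 2.
have et : atan (tan t) = t by rewrite tanK// in_itv /= /t; apply/andP; split; lra.
have /h : le_at f y (tan t).
  by apply: (approx_rle (approx_eat ny)); rewrite et /t; lra.
move=> /(_ f _ _ f0 (lexx _) (approx_eat nx)); rewrite et /t; lra.
Qed.

Lemma le_at_inj a x y : (forall c, c != \bot%O -> (c <= a)%O ->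
  forall q, le_at c x q <-> le_at c y q) -> agree a x y.
Proof.
move=> h; apply: agree_approx => c s c0 ca s0.
have s8 : 0 < s / 8 by rewrite divr_gt0.
have [v [e [e0 ec nx]]] := approx_pick x s8 c0.
have [w [f [f0 fe ny]]] := approx_pick y s8 e0.
have fa := le_trans fe (le_trans ec ca).
have {}nx := approx_sub fe nx.
have h1 := le_at_approx f0 s8 (fun q => proj2 (h f f0 fa q)) nx ny.
have h2 := le_at_approx f0 s8 (fun q => proj1 (h f f0 fa q)) ny nx.
exists f, v; split => //; first exact: le_trans ec.
  by apply: approx_le nx; lra.
apply: approx_le (approx_triangle v ny).
by rewrite /= -lerBrDl ler_norml; apply/andP; split; lra.
Qed.

Lemma le_at_creal c (x : condReal A R) q : le_at c (creal_ereal x) q <-> rle c x q.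
Proof.
split=> h.
  apply: rle_rc => q' qq'; have gap := lt_atan qq'.
  have g0 : 0 < (atan q' - atan q) / 2 by rewrite divr_gt0// subr_gt0.
  apply: (@rleI _ _ _ 0) => // e u e0 ec u0.
  (* With half the gap as precision, [atan p] stays below [atan q']. *)
  have m0 : 0 < Num.min u ((atan q' - atan q) / 2) by rewrite lt_min u0.
  have [p [f [f0 fe np]]] := approx_pick x m0 e0.
  exists f, p; split => //.
    by apply: approx_le np; rewrite ge_min lexx.
  have {}np : approx f x p ((atan q' - atan q) / 2).
    by apply: approx_le np; rewrite ge_min lexx orbT.
  have := h _ _ _ f0 (le_trans fe ec) (approx_eat (approx_lift1 (@lip_EFin R) np)).
  rewrite /= mul0r addr0 => le'; rewrite leNgt; apply/negP => /lt_atan; lra.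
apply: (@rleI _ _ _ 1) => // e u e0 ec u0.
have [p [f [f0 fe np]]] := approx_pick x u0 e0.
exists f, (atan p); split => //.
  exact: (approx_eat (approx_lift1 (@lip_EFin R) np)).
have le' := h _ _ _ f0 (le_trans fe ec) np; rewrite mul1r.
apply: le_trans (atanD _ (ltW u0)); apply: le_atan; lra.
Qed.

Lemma le_at_pinfty c q : c != \bot%O -> ~ le_at c (ecst A +oo%E) q.
Proof.
move=> c0 /(_ c _ _ c0 (lexx _) (approx_eat (approx_cst _ _))) /=.
by have := atan_ltpi2 q; lra.
Qed.

Lemma le_at_ninfty c q : le_at c (ecst A -oo%E) q.
Proof.
apply: (approx_rle (approx_eat (approx_cst _ _))) => /=.
by have := atan_gtNpi2 q; lra.
Qed.

Lemma agree_pinfty a x : (forall c q, c != \bot%O -> (c <= a)%O -> ~ le_at c x q) ->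
  agree a x (ecst A +oo%E).
Proof.
move=> h; apply: le_at_inj => c c0 ca q; split; first by move=> /(h _ _ c0 ca).
by move=> /(le_at_pinfty c0).
Qed.

Lemma agree_ninfty a x : (forall q, le_at a x q) -> agree a x (ecst A -oo%E).
Proof.
move=> h; apply: le_at_inj => c c0 ca q; split => _; first exact: le_at_ninfty.
exact: le_at_sub ca (h q).
Qed.

End EReals.

(** * Order, suprema and arithmetic of extended conditional reals *)

Section Order.
Context {d : Order.disp_t} {A : completeBoolType d} {R : realType}.
Implicit Types (a b c e : A) (x y : condEReal A R) (p q r s t : R).

Lemma bsup_agree x y c : c != \bot%O -> (c <= bsup [set a | agree a x y])%O ->
  exists e, [/\ e != \bot%O, (e <= c)%O & agree e x y].
Proof.
move=> c0 /bsup_hit /(_ c0)[a ha ca]; exists (c `&` a)%O; split=> //.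
  exact: leIl.
by apply: agree_le ha; exact: leIr.
Qed.

Lemma epiece_fin_not x c k : c != \bot%O -> (c <= epiece x EFinite)%O ->
  k <> EFinite -> ~ (c <= epiece x k)%O.
Proof. by move=> c0 cf nk ck; apply: nk; exact: (part_uniq (p := epiece x) c0 ck cf). Qed.

Lemma finite_part x : exists r : condReal A R, agree (epiece x EFinite) x (creal_ereal r).
Proof.
set fin := epiece x EFinite.
(* Off [fin] this is the cut of 0, so that real bounds exist near every piece and [rcut] applies. *)
pose P c q := forall e, e != \bot%O -> (e <= c)%O ->
  ((e <= fin)%O -> le_at e x q) /\ ((e <= ~` fin)%O -> 0 <= q).
have no e : e != \bot%O -> (e <= fin)%O -> (e <= ~` fin)%O -> False.
  by move=> e0 e1 e2; move: e0; rewrite -lex0 -(meetxC fin) lexI e1 e2.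
have Pfin e q : (e <= fin)%O -> le_at e x q -> P e q.
  move=> ef h f f0 fe; split=> [_|fn]; first exact: le_at_sub h.
  by case: (no f f0 (le_trans fe ef) fn).
have P_cut : cut P.
  split.
  - by move=> a b q ba h e e0 eb; apply: h => //; exact: le_trans ba.
  - move=> a q q' qq h e e0 ea; have [h1 h2] := h e e0 ea.
    split; first by move=> /h1; exact: (cut_trans (le_at_cut x)).
    by move=> /h2 /le_trans; apply.
  - move=> a q h e e0 ea; split.
      move=> ef; apply: (cut_local (le_at_cut x)) => c c0 ce.
      have [f [f0 fc Pf]] := h c c0 (le_trans ce ea); exists f; split => //.
      by apply: (proj1 (Pf f f0 (lexx _))); rewrite (le_trans fc)// (le_trans ce).
    move=> ef; have [f [f0 fe Pf]] := h e e0 ea.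
    by apply: (proj2 (Pf f f0 (lexx _))); exact: le_trans ef.
  - move=> a q h e e0 ea; split.
      move=> ef; apply: (cut_rc (le_at_cut x)) => q' qq.
      exact: (proj1 (h _ qq e e0 ea)).
    move=> ef; apply/ler_addgt0Pr => t t0.
    by apply: (proj2 (h (q + t) _ e e0 ea)) => //; rewrite ltrDl.
have Pout c q : (c <= ~` fin)%O -> 0 <= q -> P c q.
  move=> cf q0 e e0 ec; split => // ef.
  by case: (no e e0 ef (le_trans ec cf)).
have ub c : c != \bot%O -> exists e q, [/\ e != \bot%O, (e <= c)%O & P e q].
  move=> /(split_piece fin)[e [e0 ec [ef|en]]]; last first.
    by exists e, 0; split => //; exact: Pout.
  (* If no part of [e] carried an upper bound, [x] would be [+oo] on [e], against [e <= fin]. *)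
  apply: contrapT => h.
  apply: (epiece_fin_not (k := EPos) e0 ef) => //; apply: bsup_ub.
  apply: agree_pinfty => f q f0 fe lf; apply: h; exists f, q; split => //.
    exact: le_trans ec.
  by apply: Pfin => //; exact: le_trans ef.
have lb c : c != \bot%O -> exists e q, [/\ e != \bot%O, (e <= c)%O &
    forall f, f != \bot%O -> (f <= e)%O -> ~ P f q].
  move=> /(split_piece fin)[e [e0 ec [ef|en]]]; last first.
    exists e, (-1); split => // f f0 fe Pf.
    by have := proj2 (Pf f f0 (lexx _)) (le_trans fe en); lra.
  apply: contrapT => h.
  apply: (epiece_fin_not (k := ENeg) e0 ef) => //; apply: bsup_ub.
  apply: agree_ninfty => q; apply: contrapT => /not_le_at[g [g0 ge hg]].
  apply: h; exists g, q; split => //; first exact: le_trans ec.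
  move=> f f0 fg Pf; apply: (hg f f0 fg).
  by apply: (proj1 (Pf f f0 (lexx _))); rewrite (le_trans fg)// (le_trans ge).
have [r hr] := rcut P_cut ub lb; exists r.
apply: le_at_inj => c c0 cf q; rewrite le_at_creal hr; split; first exact: Pfin.
by move=> /(_ c c0 (lexx _))[/(_ cf)].
Qed.

Lemma epieceP x k : agree (epiece x k) x (pure_ereal (evalue x k)).
Proof.
case: k => /=.
- by apply: agree_local => c c0 /(bsup_agree c0).
- have [r hr] := finite_part x.
  exact: (@xgetPex _ (crcst A (0 : R)) [set r | agree (epiece x EFinite) x (creal_ereal r)]
    (ex_intro _ r hr)).
- by apply: agree_local => c c0 /(bsup_agree c0).
Qed.

Definition ple_at c (u : \bar (condReal A R)) q : Prop :=
  match u with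
  | (r%:E)%E => rle c r q
  | +oo%E => False
  | -oo%E => True
  end.

Lemma ple_atP c u q : c != \bot%O -> le_at c (pure_ereal u) q <-> ple_at c u q.
Proof.
move=> c0; case: u => [r| |] /=; first exact: le_at_creal.
  by split=> // /(le_at_pinfty c0).
by split=> // _; exact: le_at_ninfty.
Qed.

Lemma le_at_epiece x k c q : c != \bot%O -> (c <= epiece x k)%O ->
  le_at c x q <-> ple_at c (evalue x k) q.
Proof.
move=> c0 ck; rewrite -ple_atP//; have h := agree_le ck (epieceP x k).
by split; apply: le_at_agree => //; exact: agree_sym.
Qed.

Lemma cle_rle a c (x y : condReal A R) q : cle_on a x y -> (c <= a)%O -> rle c y q -> rle c x q.
Proof.
move=> /cle_onP h ca ly e p r e0 ec nx; apply/ler_addgt0Pr => t t0.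
have t2 : 0 < t / 2 by rewrite divr_gt0.
have [v [f [f0 fe ny]]] := approx_pick y t2 e0.
have := h f _ _ _ _ f0 (le_trans fe (le_trans ec ca)) (approx_sub fe nx) ny.
have := ly f _ _ f0 (le_trans fe ec) ny; lra.
Qed.

Lemma rle_cle a (x y : condReal A R) :
  (forall c q, c != \bot%O -> (c <= a)%O -> rle c y q -> rle c x q) -> cle_on a x y.
Proof.
move=> h; apply/cle_onP => c p q r s c0 ca nx ny.
by apply: (h c (q + s) c0 ca _ c p r c0 (lexx _) nx); exact: approx_rle ny _.
Qed.

(** Replaces the case analysis on the pieces of both arguments by a comparison of real upper
    bounds. *)
Lemma eleP x y : ele x y <-> forall c q, c != \bot%O -> le_at c y q -> le_at c x q.
Proof.
split=> [h c q c0 ly|h k l].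
  apply: (cut_local (le_at_cut x)) => e e0 ec.
  have [k [f [f0 fe fk]]] := part_hit (epiece x) e0.
  have [l [g [g0 gf gl]]] := part_hit (epiece y) f0.
  have gk := le_trans gf fk; have ge := le_trans gf fe.
  exists g; split => //.
  have := h k l; have {ly} : le_at g y q by exact: le_at_sub (le_trans ge ec) ly.
  have gkl : (g <= epiece x k `&` epiece y l)%O by rewrite lexI gk gl.
  rewrite (le_at_epiece _ g0 gl) (le_at_epiece _ g0 gk).
  have bot a : (g <= a)%O -> a = \bot%O -> False.
    by move=> ga a0; move: g0; rewrite -lex0 -a0 ga.
  case: (evalue x k) => [r| |]; case: (evalue y l) => [s| |] //= h1 h2.
  - exact: cle_rle h2 gkl h1.
  - by case: (bot _ gkl h2).
  - by case: (bot _ gkl h2).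
  - by case: (bot _ gkl h2).
set a := (_ `&` _)%O.
have ak : (a <= epiece x k)%O by exact: leIl.
have al : (a <= epiece y l)%O by exact: leIr.
have {}h c q : c != \bot%O -> (c <= a)%O -> ple_at c (evalue y l) q -> ple_at c (evalue x k) q.
  move=> c0 ca; rewrite -(le_at_epiece _ c0 (le_trans ca al)).
  by rewrite -(le_at_epiece _ c0 (le_trans ca ak)); exact: h.
have bot : (a != \bot%O -> False) -> a = \bot%O by move=> na; apply/eqP/negPn/negP => /na.
case: (evalue x k) h => [r| |]; case: (evalue y l) => [s| |] //= h.
- exact: rle_cle.
- apply: bot => a0; have [p [e [e0 ea np]]] := approx_pick r ltr01 a0.
  have := h e (p - 2) e0 ea I e p 1 e0 (lexx _) np; lra.
- apply: bot => a0; have [p [e [e0 ea np]]] := approx_pick s ltr01 a0.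
  exact: (h e (p + 1) e0 ea (approx_rle np (lexx _))).
- by apply: bot => a0; exact: (h a 0 a0 (lexx _) I).
Qed.

Lemma le_at_bot x q : le_at \bot%O x q.
Proof.
apply: (cut_local (le_at_cut x)) => c c0; rewrite lex0 => /eqP c00.
by rewrite c00 eqxx in c0.
Qed.

Lemma ele_anti x y : ele x y -> ele y x -> x = y.
Proof.
move=> /eleP h /eleP k; apply: agree_top; apply: le_at_inj => c c0 _ q.
by split; [exact: k|exact: h].
Qed.

(** An intersection of cuts is a cut, and [ecut] realizes it; this yields at once the existence of
    suprema and their upper bounds on each piece. *)
Lemma esup_cut (S : set (condEReal A R)) : exists2 s, is_esup S s &
  forall c q, le_at c s q <-> forall x, S x -> le_at c x q.
Proof.
pose P c q := forall x, S x -> le_at c x q.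
have P_cut : cut P.
  split.
  - by move=> a b q ba h x /h; exact: le_at_sub.
  - by move=> a q q' qq h x /h; exact: (cut_trans (le_at_cut x)).
  - move=> a q h x Sx; apply: (cut_local (le_at_cut x)) => c c0 ca.
    by have [e [e0 ec Pe]] := h c c0 ca; exists e; split => //; exact: Pe.
  - by move=> a q h x Sx; apply: (cut_rc (le_at_cut x)) => q' qq; exact: h.
have [s hs] := ecut P_cut; exists s => //; split.
  by move=> x Sx; apply/eleP => c q c0 /hs; exact.
by move=> t ht; apply/eleP => c q c0 lt'; apply/hs => x /ht/eleP; exact.
Qed.

Lemma is_esup_esup (S : set (condEReal A R)) : is_esup S (esup S).
Proof. by have [s hs _] := esup_cut S; apply: xgetPex; exists s. Qed.

Lemma is_einf_einf (S : set (condEReal A R)) : is_einf S (einf S).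
Proof.
apply: xgetPex; have [h1 h2] := is_esup_esup [set t | forall x, S x -> ele t x].
exists (esup [set t | forall x, S x -> ele t x]); split => [x Sx|t ht]; last exact: h1.
by apply: h2 => t; exact.
Qed.

Lemma le_at_esup (S : set (condEReal A R)) c q : c != \bot%O ->
  le_at c (esup S) q <-> forall x, S x -> le_at c x q.
Proof.
move=> c0; split=> [h x Sx|h].
  by have [/(_ x Sx)/eleP h1 _] := is_esup_esup S; exact: h1.
have [s [h1 _] hs] := esup_cut S.
have [_ /(_ s h1)/eleP le'] := is_esup_esup S.
by apply: le' => //; apply/hs.
Qed.

Lemma emap_at g x k c : (c <= epiece x k)%O ->
  agree c (emap g x) (pure_ereal (g (evalue x k))).
Proof.
move=> ck; apply: agree_le ck _.
exact: (concatP (epiece x) (fun k => pure_ereal (g (evalue x k))) k).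
Qed.

Lemma emap2_at g x y k l c : (c <= epiece x k)%O -> (c <= epiece y l)%O ->
  agree c (emap2 g x y) (pure_ereal (g (evalue x k) (evalue y l))).
Proof.
move=> ck cl; have h : (c <= refine (epiece x) (epiece y) (k, l))%O by rewrite lexI ck.
apply: agree_le h _.
exact: (concatP (refine (epiece x) (epiece y))
  (fun kl => pure_ereal (g (evalue x kl.1) (evalue y kl.2))) (k, l)).
Qed.

Lemma le_at_emap g x k c q : c != \bot%O -> (c <= epiece x k)%O ->
  le_at c (emap g x) q <-> ple_at c (g (evalue x k)) q.
Proof.
move=> c0 ck; rewrite -ple_atP//; have h := emap_at g ck.
by split; apply: le_at_agree => //; exact: agree_sym.
Qed.

Lemma le_at_emap2 g x y k l c q : c != \bot%O -> (c <= epiece x k)%O -> (c <= epiece y l)%O ->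
  le_at c (emap2 g x y) q <-> ple_at c (g (evalue x k) (evalue y l)) q.
Proof.
move=> c0 ck cl; rewrite -ple_atP//; have h := emap2_at g ck cl.
by split; apply: le_at_agree => //; exact: agree_sym.
Qed.

Lemma le_at_eadd c x y q s : le_at c x q -> le_at c y s -> le_at c (eadd x y) (q + s).
Proof.
move=> lx ly; apply: (cut_local (le_at_cut _)) => e e0 ec.
have [k [f [f0 fe fk]]] := part_hit (epiece x) e0.
have [l [g [g0 gf gl]]] := part_hit (epiece y) f0.
have gk := le_trans gf fk; have gc := le_trans (le_trans gf fe) ec.
exists g; split => //; first exact: le_trans fe.
rewrite (le_at_emap2 _ _ g0 gk gl).
move/(le_at_sub gc): lx; rewrite (le_at_epiece _ g0 gk).
move/(le_at_sub gc): ly; rewrite (le_at_epiece _ g0 gl).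
case: (evalue x k) => [r| |]; case: (evalue y l) => [t| |] //= ly lx.
apply: (@rleI _ _ _ 2) => // h u h0 hg u0.
have [v [i [i0 ih nr]]] := approx_pick r (half_gt0 u0) h0.
have [w [j [j0 ji nt]]] := approx_pick t (half_gt0 u0) i0.
have {}nr := approx_sub ji nr.
have jg := le_trans ji (le_trans ih hg).
exists j, (v + w); split => //; first exact: le_trans ih.
  by apply: approx_le (approx_add nr nt); rewrite -splitr.
have := lx _ _ _ j0 jg nr; have := ly _ _ _ j0 jg nt; lra.
Qed.

Lemma le_at_escale c x t q : 0 < t -> le_at c x q -> le_at c (escale t x) (t * q).
Proof.
move=> t0 lx; apply: (cut_local (le_at_cut _)) => e e0 ec.
have [k [f [f0 fe fk]]] := part_hit (epiece x) e0; have fc := le_trans fe ec.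
exists f; split => //; rewrite (le_at_emap _ _ f0 fk).
move/(le_at_sub fc): lx; rewrite (le_at_epiece _ f0 fk).
case: (evalue x k) => [r| |] //= lx; last by rewrite gt_eqF// t0.
apply: (@rleI _ _ _ (2 * t)); first by rewrite mulr_ge0// ltW.
move=> g u g0 gf u0.
have v0 : 0 < Num.min u (u / t) by rewrite lt_min u0 divr_gt0.
have [v [h [h0 hg nr]]] := approx_pick r v0 g0.
exists h, (t * v); split => //.
  apply: approx_le (approx_mul _ _ (approx_crcst _ t) nr) => //; last exact: ltW.
  by rewrite mul0r add0r (gtr0_norm t0) -ler_pdivlMl// mulrC ge_min lexx orbT.
have := lx _ _ _ h0 (le_trans hg gf) nr.
have : Num.min u (u / t) <= u by rewrite ge_min lexx.
nra.
Qed.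

(** A lower bound expressed through upper bounds on all parts; unlike the negation of [le_at] it
    passes to smaller pieces. *)
Definition ge_at c x q := forall e s, e != \bot%O -> (e <= c)%O -> le_at e x s -> q <= s.

Lemma le_at_eopp c x q : le_at c (eopp x) q <-> ge_at c x (- q).
Proof.
split=> [h e s e0 ec lx|h].
  have [k [f [f0 fe fk]]] := part_hit (epiece x) e0; have fc := le_trans fe ec.
  move/(le_at_sub fc): h; rewrite (le_at_emap _ _ f0 fk).
  move/(le_at_sub fe): lx; rewrite (le_at_epiece _ f0 fk).
  case: (evalue x k) => [r| |] //= lx h.
  apply/ler_addgt0Pr => t t0.
  have [v [g [g0 gf nr]]] := approx_pick r (half_gt0 t0) f0.
  have := lx _ _ _ g0 gf nr; have := h _ _ _ g0 gf (approx_opp nr); lra.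
apply: (cut_local (le_at_cut _)) => e e0 ec.
have [k [f [f0 fe fk]]] := part_hit (epiece x) e0; have fc := le_trans fe ec.
exists f; split => //; rewrite (le_at_emap _ _ f0 fk).
have {}h g s : g != \bot%O -> (g <= f)%O -> ple_at g (evalue x k) s -> - q <= s.
  move=> g0 gf; rewrite -(le_at_epiece _ g0 (le_trans gf fk)).
  exact: h g0 (le_trans gf fc).
case: (evalue x k) h => [r| |] //= h.
  apply: (@rleI _ _ _ 1) => // g u g0 gf u0.
  have [v [i [i0 ig nr]]] := approx_pick r u0 g0.
  exists i, (- v); split => //; first exact: approx_opp.
  have := h i (v + u) i0 (le_trans ig gf) (approx_rle nr (lexx _)); lra.
by have := h f (- q - 1) f0 (lexx _) I; lra.
Qed.

(** This is [y <= q - p]. As [q - p] is not a real number, [p] enters through its approximations,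
    with their radius conceded. *)
Lemma le_at_eadd_creal c (p : condReal A R) y q :
  le_at c (eadd (creal_ereal p) y) q <->
  forall e v r, e != \bot%O -> (e <= c)%O -> approx e p v r -> le_at e y (q - v + r).
Proof.
set x := creal_ereal p.
have piece c' : c' != \bot%O -> exists l g, [/\ g != \bot%O, (g <= c')%O, (g <= epiece y l)%O &
    forall e q, e != \bot%O -> (e <= g)%O ->
      (le_at e (eadd x y) q <-> ple_at e (pure_add p%:E%E (evalue y l)) q)].
  move=> c0; have [k [f [f0 fe fk]]] := part_hit (epiece x) c0.
  have [l [g [g0 gf gl]]] := part_hit (epiece y) f0.
  have gk := le_trans gf fk; exists l, g; split => //; first exact: le_trans fe.
  move=> e t e0 eg.
  rewrite (le_at_emap2 _ _ e0 (le_trans eg gk) (le_trans eg gl)).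
  have {}fk h s : h != \bot%O -> (h <= e)%O -> ple_at h (evalue x k) s <-> rle h p s.
    move=> h0 hf; rewrite -(le_at_epiece _ h0 (le_trans hf (le_trans eg gk))).
    exact: le_at_creal.
  (* The finite value [r] attached to [x] is tied to [p] on this piece only, so the two are
     exchanged through their real bounds; infinite values contradict the bounds of [p]. *)
  case: (evalue x k) fk => [r| |] /= fk.
  - case: (evalue y l) => [s| |] //=.
    have ag : agree e (creal_ereal r) (creal_ereal p).
      by apply: le_at_inj => h h0 hf s'; rewrite !le_at_creal fk.
    have sub (u v : condReal A R) : (forall h s, h != \bot%O -> (h <= e)%O ->
        rle h u s -> rle h v s) -> rle e (cond_add u s) t -> rle e (cond_add v s) t.
      move=> uv hu; apply: (@rleI _ _ _ 4) => // h w h0 hf w0.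
      have w2 : 0 < w / 2 by rewrite divr_gt0.
      have [a [i [i0 ih nu]]] := approx_pick u w2 h0.
      have [b [j [j0 ji nv]]] := approx_pick v w2 i0.
      have [b' [m [m0 mj ns]]] := approx_pick s w2 j0.
      have {}nu := approx_sub (le_trans mj ji) nu; have {}nv := approx_sub mj nv.
      have mh : (m <= h)%O by rewrite (le_trans mj)// (le_trans ji).
      exists m, (b + b'); split => //.
        by apply: approx_le (approx_add nv ns); rewrite -splitr.
      have := hu _ _ _ m0 (le_trans mh hf) (approx_add nu ns).
      have := uv m (a + w / 2) m0 (le_trans mh hf) (approx_rle nu (lexx _)) m _ _ m0 (lexx _) nv.
      lra.
    by split; apply: sub => h s' h0 hf /(fk h s' h0 hf).
  - have [v [h [h0 hf nv]]] := approx_pick p ltr01 e0.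
    by case: (proj2 (fk h _ h0 hf) (approx_rle nv (lexx _))).
  - have [v [h [h0 hf nv]]] := approx_pick p ltr01 e0.
    have := proj1 (fk h (v - 2) h0 hf) I h _ _ h0 (lexx _) nv; lra.
split=> [h e v r e0 ec nv|h].
  apply: (cut_local (le_at_cut _)) => e' e'0 e'e.
  have [l [g [g0 ge' gl gE]]] := piece e' e'0.
  have ge := le_trans ge' e'e.
  exists g; split => //; rewrite (le_at_epiece _ g0 gl).
  have := proj1 (gE _ _ g0 (lexx _)) (le_at_sub (le_trans ge ec) h).
  case: (evalue y l) => [s| |] //= hs.
  apply: (@rleI _ _ _ 2) => // i u i0 ig u0.
  have [w [j [j0 ji ns]]] := approx_pick s (half_gt0 u0) i0.
  have [z [m [m0 mj np]]] := approx_pick p (half_gt0 u0) j0.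
  have mg := le_trans mj (le_trans ji ig).
  have {}ns := approx_sub mj ns.
  exists m, w; split => //; first exact: le_trans ji.
    by apply: approx_le ns; lra.
  have := hs _ _ _ m0 mg (approx_add np ns).
  have := approx_ball (approx_sub (le_trans mg ge) nv) np m0.
  lra.
apply: (cut_local (le_at_cut _)) => e e0 ec.
have [l [g [g0 ge gl gE]]] := piece e e0; exists g; split => //.
apply/gE => //; have {}h i v r : i != \bot%O -> (i <= g)%O -> approx i p v r ->
    ple_at i (evalue y l) (q - v + r).
  move=> i0 ig nv; rewrite -(le_at_epiece _ i0 (le_trans ig gl)).
  by apply: (h i v r i0 _ nv); rewrite (le_trans ig)// (le_trans ge).
case: (evalue y l) h => [s| |] //= h; last first.
  by have [v [i [i0 ig nv]]] := approx_pick p ltr01 g0; case: (h _ _ _ i0 ig nv).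
apply: (@rleI _ _ _ 2) => // i u i0 ig u0.
have [v [j [j0 ji np]]] := approx_pick p (half_gt0 u0) i0.
have [w [m [m0 mj ns]]] := approx_pick s (half_gt0 u0) j0.
have mi := le_trans mj ji; have {}np := approx_sub mj np.
exists m, (v + w); split => //.
  by apply: approx_le (approx_add np ns); rewrite -splitr.
have := h _ _ _ m0 (le_trans mi ig) np _ _ _ m0 (lexx _) ns; lra.
Qed.

Lemma le_at_esub c (p : condReal A R) x q : le_at c (esub (creal_ereal p) x) q <->
  forall e s, e != \bot%O -> (e <= c)%O -> le_at e x s -> rle e p (q + s).
Proof.
rewrite le_at_eadd_creal; split=> h.
  move=> e s e0 ec lx f v r f0 fe np.
  have := h f v r f0 (le_trans fe ec) np; rewrite le_at_eopp.
  by move=> /(_ f s f0 (lexx _) (le_at_sub fe lx)); lra.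
move=> e v r e0 ec np; rewrite le_at_eopp => f s f0 fe lx.
have := h f s f0 (le_trans fe ec) lx f v r f0 (lexx _) (approx_sub fe np); lra.
Qed.

End Order.

(** * Conjugates, and lower semi-continuity of a biconjugate *)

Section Duality.
Context {d : Order.disp_t} {A : completeBoolType d} {R : realType}.
Context {X Y : normedModType R} {b : @dualPair R X Y}.
Hypothesis b_le : forall x y, `|b x y| <= `|x| * `|y|.
Implicit Types (a c e : A) (x z u v : X) (w : Y) (y : cond A Y) (p q r s t : R).

Lemma approx_pairing c (Z : cond A X) y u w r s : 0 <= r -> 0 <= s ->
  approx c Z u r -> approx c y w s ->
  approx c (pairing b_le Z y) (b u w) (r * (`|w| + s) + `|u| * s).
Proof.
move=> r0 s0 nx ny; have := approx_lift2_lip (lexx 0) (lip_pairing b_le) r0 s0 nx ny.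
by rewrite /= !subr0 !add0r.
Qed.

Definition cpair v y : condReal A R := pairing b_le (cvec A v) y.

Lemma approx_cpair c v y w s : 0 <= s -> approx c y w s -> approx c (cpair v y) (b v w) (`|v| * s).
Proof.
move=> s0 ny; have nv : approx c (cvec A v) v 0 by exact: approx_cst.
by have := approx_pairing (lexx 0) s0 nv ny; rewrite mul0r add0r.
Qed.

(** The error of the pairing is at most [|v|] times the error of [y], so one [w] serves the whole
    ball. *)
Lemma cpair_pick c y N s : c != \bot%O -> 0 <= N -> 0 < s -> exists w e,
  [/\ e != \bot%O, (e <= c)%O & forall v, `|v| <= N -> approx e (cpair v y) (b v w) s].
Proof.
move=> c0 N0 s0; have N1 : 0 < N + 1 by rewrite ltr_wpDl.
have t0 : 0 < s / (N + 1) by rewrite divr_gt0.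
have [w [e [e0 ec ny]]] := approx_pick y t0 c0.
exists w, e; split => // v vN; apply: approx_le (approx_cpair v (ltW t0) ny).
by rewrite mulrA ler_pdivrMr// (mulrC s) ler_wpM2r ?(ltW s0)// (le_trans vN)// lerDl.
Qed.

Section Function.
Context (f : X -> condEReal A R).

Lemma le_at_conj c y q : c != \bot%O -> le_at c (fenchel_conj b_le f y) q <->
  forall x e s, e != \bot%O -> (e <= c)%O -> le_at e (f x) s -> rle e (cpair x y) (q + s).
Proof.
move=> c0; rewrite (le_at_esup _ _ c0); split=> [h x e s e0 ec lf|h _ [x _ <-]].
  exact: (proj1 (le_at_esub _ _ _ _) (h _ (imageT _ x))).
by apply/le_at_esub => e s e0 ec; exact: h.
Qed.

Definition biconj x : condEReal A R :=
  esup [set esub (creal_ereal (pairing b_le (cvec A x) y)) (fenchel_conj b_le f y) |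
    y in [set: cond A Y]].

Lemma le_at_biconj c x q : c != \bot%O -> le_at c (biconj x) q <->
  forall y e s, e != \bot%O -> (e <= c)%O -> le_at e (fenchel_conj b_le f y) s ->
    rle e (cpair x y) (q + s).
Proof.
move=> c0; rewrite (le_at_esup _ _ c0); split=> [h y e s e0 ec lf|h _ [y _ <-]].
  exact: (proj1 (le_at_esub _ _ _ _) (h _ (imageT _ y))).
by apply/le_at_esub => e s e0 ec; exact: h.
Qed.

(** The Fenchel-Young inequality, read for each fixed [y]. *)
Lemma biconj_le x : ele (biconj x) (f x).
Proof.
apply/eleP => c q c0 lf; apply/(le_at_biconj _ _ c0) => y e s e0 ec.
rewrite (le_at_conj _ _ e0) addrC => /(_ x e q e0 (lexx _)); apply.
exact: le_at_sub lf.
Qed.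

Lemma step_ext_at c (z : step A X) v : (c <= z v)%O -> agree c (step_ext f z) (f v).
Proof. by move=> cz; apply: agree_le cz _; exact: (concatP z f v). Qed.

Definition nbhd_inf (V : set (cond A X)) : condEReal A R :=
  einf [set step_ext f z | z in [set z | V (completion_step (norm_metric X) z)]].

Definition lsc_hull x : condEReal A R :=
  esup [set nbhd_inf V | V in weak_nbhd b_le (cvec A x)].

Lemma weak_nbhd_center x V : weak_nbhd b_le (cvec A x) V -> V (cvec A x).
Proof.
move=> [r [n [y [r0 _ ->]]]] l _; apply/cle_onP => c p q s t c0 _ np nr.
have [e [k [e0 ec k0 hk]]] := clt_pos r0 c0.
have [w [g [g0 ge ny]]] := approx_pick (y l) ltr01 e0.
have nv : approx g (cvec A x) x 0 by exact: approx_cst.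
have := approx_abs (approx_pairing (addr_ge0 (lexx 0) (lexx 0)) ler01 (approx_csub nv nv) ny).
rewrite subrr linear0l normr0 !(addr0, mul0r, normr0) => np'.
have := approx_ball (approx_sub (le_trans ge ec) np) np' g0.
have := hk _ _ _ g0 ge (approx_sub (le_trans ge ec) nr); lra.
Qed.

Lemma step_cst_top (E : Type) (v : E) c : (c <= step_cst A v v)%O.
Proof. by apply: (@pushforward_val _ A _ _ (fun=> v) _ _ tt); exact: lex1. Qed.

Lemma nbhd_inf_le V (z : step A X) c q : V (completion_step (norm_metric X) z) ->
  c != \bot%O -> le_at c (step_ext f z) q -> le_at c (nbhd_inf V) q.
Proof.
move=> Vz c0; have [h _] := is_einf_einf
  [set step_ext f z | z in [set z | V (completion_step (norm_metric X) z)]].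
by have /eleP := h _ (imageP _ (Vz : [set z | V (completion_step _ z)] z)); apply.
Qed.

Lemma lsc_hull_le x : ele (lsc_hull x) (f x).
Proof.
apply/eleP => c q c0 lf; apply/(le_at_esup _ _ c0) => _ [V hV <-].
apply: (@nbhd_inf_le V (step_cst A x)) => //.
  exact: weak_nbhd_center.
apply: le_at_agree lf; apply: agree_sym; apply: step_ext_at; exact: step_cst_top.
Qed.

(** The element equal to [q] on [c] and to [-oo] elsewhere is a lower bound of [S], hence below the
    infimum. *)
Lemma einf_ge (S : set (condEReal A R)) c q :
  (forall i, S i -> ge_at c i q) -> ge_at c (einf S) q.
Proof.
move=> h; have [_ hS] := is_einf_einf S.
pose T (t : bool) : condEReal A R := if t then ecst A q%:E else ecst A -oo%E.
have Tc : agree c (concat (cut_part c) T) (ecst A q%:E) by exact: (concatP (cut_part c) T true).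
have Tn : agree (~` c)%O (concat (cut_part c) T) (ecst A -oo%E).
  exact: (concatP (cut_part c) T false).
have qE e s : e != \bot%O -> le_at e (ecst A q%:E) s <-> q <= s.
  move=> e0; have nq : approx e (eat (ecst A q%:E)) (atan q) 0.
    exact: (approx_eat (approx_cst _ _)).
  split=> [l|qs].
    have := l _ _ _ e0 (lexx _) nq; rewrite subr0 leNgt => /negP le'.
    by rewrite leNgt; apply/negP => /lt_atan.
  by apply: (approx_rle nq); rewrite addr0 le_atan.
have /hS/eleP le' : forall i, S i -> ele (concat (cut_part c) T) i.
  move=> x Sx; apply/eleP => e s e0 lx; apply: (cut_local (le_at_cut _)) => g g0 ge.
  case: (eqVneq (g `&` c)%O \bot%O) => [gc|gc].
    have gn : (g <= ~` c)%O by rewrite -disj_leC gc.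
    exists g; split => //.
    by apply: (le_at_agree (agree_sym (agree_le gn Tn))); exact: le_at_ninfty.
  exists (g `&` c)%O; split; rewrite ?leIl//.
  apply: (le_at_agree (agree_sym (agree_le (leIr _ _) Tc))); apply/qE => //.
  by apply: (h x Sx) gc (leIr _ _) _; apply: le_at_sub lx; rewrite (le_trans _ ge)// leIl.
move=> e s e0 ec /(le' e s e0) le''; apply/(qE e) => //.
by apply: le_at_agree le''; exact: agree_le Tc.
Qed.

Lemma biconj_lsc : (forall x, f x = biconj x) -> cond_lower_semicontinuous b_le f.
Proof.
move=> fE x; apply: ele_anti; last exact: lsc_hull_le.
apply/eleP => c q c0 /(le_at_esup _ _ c0) hV.
rewrite fE; apply/(le_at_biconj _ _ c0) => y e s e0 ec ls.
apply: contrapT => /not_rle[e1 [p [r [e10 e1e np pr]]]].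
(* Three quarters of the gap are spent: on the radius of the neighbourhood, on the error in
   [<v - x, y>], and on the errors in [<x, y>] and [<v, y>] together. The last one leaves the bound
   [q + k]. *)
pose k := (p - r - (q + s)) / 4.
have k0 : 0 < k by rewrite divr_gt0// subr_gt0.
pose V := [set Z | forall l, sinterval (step_cst A 1%N) l ->
  cle (cond_abs (pairing b_le (cond_sub Z (cvec A x)) y)) (crcst A k)].
have nV : weak_nbhd b_le (cvec A x) V.
  (* A family of length one, constantly [y]. *)
  exists (crcst A k), (step_cst A 1%N), (fun=> y); split => //; first exact: clt_cst.
  by move=> I a l _; apply: concat_uniq => i; exact: agree_refl.
have {}hV := hV _ (imageP _ nV).
have : ge_at e1 (nbhd_inf V) (q + k).
  apply: einf_ge => _ [z Vz <-] g t g0 ge1 lt'.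
  have [v [h [h0 hg hz]]] := part_hit z g0.
  have he1 := le_trans hg ge1.
  have lv : le_at h (f v) t.
    by apply: le_at_agree (step_ext_at hz) _; exact: le_at_sub lt'.
  have he := le_trans he1 e1e.
  have ls' : le_at h (fenchel_conj b_le f y) s by exact: le_at_sub ls.
  have le1 := proj1 (le_at_conj _ _ h0) ls' v h t h0 (lexx _) lv.
  pose N := `|v| + `|x|.
  have N0 : 0 <= N by rewrite addr_ge0.
  have N1 : 0 < k / (N + 1) by rewrite divr_gt0// ltr_wpDl.
  have [w [m [m0 mh ny]]] := approx_pick y N1 h0.
  set u := k / (N + 1) in N1 ny.
  have uk : N * u <= k.
    by rewrite /u mulrA ler_pdivrMr ?ltr_wpDl// mulrDr mulr1 mulrC lerDl ltW.
  have nz : approx m (completion_step (norm_metric X) z) v 0.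
    by apply: approx_step; exact: le_trans hz.
  have nx : approx m (cvec A x) x 0 by exact: approx_cst.
  have := approx_abs (approx_pairing (addr_ge0 (lexx 0) (lexx 0)) (ltW N1) (approx_csub nz nx) ny).
  rewrite linearBl addr0 mul0r add0r => na.
  have one : sinterval (step_cst A 1%N) (step_cst A 1%N) by split; exact: nle_on_refl.
  have := proj1 (cle_onP _ _ _) (Vz _ one) _ _ _ _ _ m0 (lex1 _) na (approx_crcst _ _).
  have := approx_ball (approx_sub (le_trans mh he1) np) (approx_cpair x (ltW N1) ny) m0.
  have := le1 _ _ _ m0 mh (approx_cpair v (ltW N1) ny).
  have vx : `|v - x| * u <= N * u.
    by rewrite ler_wpM2r ?(ltW N1)// (le_trans (ler_normB _ _)).
  have := ler_norm (b x w - b v w); rewrite distrC.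
  have e4 : q + s = p - r - k * 4 by rewrite /k; field.
  have : `|x| * u + `|v| * u <= k by rewrite -mulrDl addrC.
  lra.
move=> /(_ e1 q e10 (lexx _)) ge.
have := ge (le_at_sub (le_trans e1e ec) hV); lra.
Qed.

End Function.
End Duality.

(** * Sums of absolute pairings, and conditional scalars acting on [Y_c] *)

Section Separation.
Context {d : Order.disp_t} {A : completeBoolType d} {R : realType}.
Context {X Y : normedModType R} {b : @dualPair R X Y}.
Hypothesis b_le : forall x y, `|b x y| <= `|x| * `|y|.
Implicit Types (a c e : A) (x z u v : X) (w : Y) (y : cond A Y) (ys : seq (cond A Y)).
Implicit Types (p q r s t : R).

Local Notation "<< v , y >>" := (cpair b_le v y).

Fixpoint cnorm ys v : condReal A R :=
  if ys is y :: ys' then cond_add (cond_abs <<v, y>>) (cnorm ys' v) else crcst A 0.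

Definition cnonneg (x : condReal A R) := forall c s, c != \bot%O -> 0 < s ->
  exists e p, [/\ e != \bot%O, (e <= c)%O, 0 <= p & approx e x p s].

Lemma cnonneg_abs (x : condReal A R) : cnonneg (cond_abs x).
Proof.
move=> c s c0 s0; have [p [e [e0 ec np]]] := approx_pick x s0 c0.
by exists e, `|p|; split => //; exact: approx_abs.
Qed.

Lemma rle_addl c (x x' : condReal A R) q : cnonneg x' -> rle c (cond_add x x') q -> rle c x q.
Proof.
move=> nx h; apply: (@rleI _ _ _ 2) => // e s e0 ec s0.
have [f [p [f0 fe p0 np]]] := nx e s e0 s0.
have [p' [g [g0 gf np']]] := approx_pick x s0 f0.
exists g, p'; split => //; first exact: le_trans fe.
have := h _ _ _ g0 (le_trans gf (le_trans fe ec)) (approx_add np' (approx_sub gf np)); lra.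
Qed.

Lemma cond_addC (x x' : condReal A R) : cond_add x x' = cond_add x' x.
Proof.
apply: agree_top; apply: agree_approx => c s c0 _ s0.
have [p [e [e0 ec np]]] := approx_pick x (half_gt0 s0) c0.
have [q [f [f0 fe nq]]] := approx_pick x' (half_gt0 s0) e0.
have {}np := approx_sub fe np.
exists f, (p + q); split => //; first exact: le_trans ec.
  by apply: approx_le (approx_add np nq); lra.
by rewrite addrC; apply: approx_le (approx_add nq np); lra.
Qed.

Lemma cond_addA (x x' x'' : condReal A R) :
  cond_add x (cond_add x' x'') = cond_add (cond_add x x') x''.
Proof.
apply: agree_top; apply: agree_approx => c s c0 _ s0.
have s4 : 0 < s / 4 by rewrite divr_gt0.
have [p [e [e0 ec np]]] := approx_pick x s4 c0.
have [q [f [f0 fe nq]]] := approx_pick x' s4 e0.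
have [r [g [g0 gf nr]]] := approx_pick x'' s4 f0.
have {}np := approx_sub gf (approx_sub fe np); have {}nq := approx_sub gf nq.
exists g, (p + (q + r)); split; first by [].
- by rewrite (le_trans gf)// (le_trans fe).
- by apply: approx_le (approx_add np (approx_add nq nr)); lra.
- by rewrite addrA; apply: approx_le (approx_add (approx_add np nq) nr); lra.
Qed.

Lemma cond_add0r (x : condReal A R) : cond_add (crcst A 0) x = x.
Proof.
apply: agree_top; apply: agree_approx => c s c0 _ s0.
have [p [e [e0 ec np]]] := approx_pick x s0 c0.
exists e, p; split => //; have := approx_add (approx_crcst e (0 : R)) np.
by rewrite !add0r.
Qed.

Definition is_seminorm (n : X -> R) := [/\ forall v, 0 <= n v,
  forall t v, n (t *: v) = `|t| * n v & forall u v, n (u + v) <= n u + n v].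

(** On a ball the conditional seminorm is uniformly close to a genuine one, the sum of [|b v w|]
    over approximations [w] of the entries of [ys]; homogeneity and subadditivity thus hold without
    error. *)
Lemma cnorm_pick ys c N s : c != \bot%O -> 0 <= N -> 0 < s -> exists n e,
  [/\ e != \bot%O, (e <= c)%O, is_seminorm n &
    forall v, `|v| <= N -> approx e (cnorm ys v) (n v) s].
Proof.
move=> c0 N0; elim: ys c c0 s => [|y ys IH] c c0 s s0.
  exists (fun=> 0), c; split => //.
    by split => [//|t v|u v]; rewrite ?mulr0 ?addr0.
  by move=> v _; apply: approx_le (approx_crcst _ _); exact: ltW.
have [n [e [e0 ec [n1 n2 n3] hn]]] := IH c c0 _ (half_gt0 s0).
have [w [f [f0 fe hw]]] := cpair_pick b_le y e0 N0 (half_gt0 s0).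
exists (fun v => `|b v w| + n v), f; split => //; first exact: le_trans ec.
  split=> [v|t v|u v]; first by rewrite addr_ge0.
    by rewrite linearZl normrM n2 mulrDr.
  rewrite linearDl addrACA lerD//; exact: ler_normD.
move=> v vN; rewrite [s]splitr; apply: approx_add; first exact/approx_abs/hw.
exact: approx_sub fe (hn v vN).
Qed.

Lemma cnonneg_cnorm ys v : cnonneg (cnorm ys v).
Proof.
move=> c s c0 s0; have [n [e [e0 ec [n1 _ _] hn]]] := cnorm_pick ys c0 (normr_ge0 v) s0.
by exists e, (n v); split => //; exact: hn.
Qed.

Lemma cnorm_cat ys ys' v : cnorm (ys ++ ys') v = cond_add (cnorm ys v) (cnorm ys' v).
Proof.
by elim: ys => [|y ys IH] /=; rewrite ?cond_add0r// IH cond_addA.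
Qed.

Lemma rle_cnorm_catl ys ys' v c q : rle c (cnorm (ys ++ ys') v) q -> rle c (cnorm ys v) q.
Proof. by rewrite cnorm_cat; apply: rle_addl; exact: cnonneg_cnorm. Qed.

Lemma rle_cnorm_catr ys ys' v c q : rle c (cnorm (ys ++ ys') v) q -> rle c (cnorm ys' v) q.
Proof. by rewrite cnorm_cat cond_addC; apply: rle_addl; exact: cnonneg_cnorm. Qed.

Lemma rle_cnorm_map (g : nat -> cond A Y) (l : seq nat) j v c q : j \in l ->
  rle c (cnorm [seq g i | i <- l] v) q -> rle c (cond_abs <<v, g j>>) q.
Proof.
elim: l => //= i l IH; rewrite inE => /predU1P[->|jl].
  by apply: rle_addl; exact: cnonneg_cnorm.
by rewrite cond_addC => /(rle_addl (@cnonneg_abs _)); exact: IH.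
Qed.

Lemma cpair0 v : <<v, cvec A (0 : Y)>> = crcst A 0.
Proof.
apply: agree_top; apply: agree_approx => c s c0 _ s0; exists c, 0; split => //.
  have ny : approx c (cvec A (0 : Y)) 0 0 by exact: approx_cst.
  have := approx_cpair b_le v (lexx 0) ny; rewrite linear0r mulr0; apply: approx_le.
  exact: ltW.
by apply: approx_le (approx_crcst _ _); exact: ltW.
Qed.

Lemma lip_scale (p p' : R) (w w' : Y) : norm_metric Y (p *: w) (p' *: w') <=
  norm_metric R p p' * (0 + norm_metric Y w 0) +
  (0 + norm_metric R p' 0) * norm_metric Y w w'.
Proof.
rewrite /= !add0r !subr0 -!normrZ.
have -> : p *: w - p' *: w' = (p - p') *: w + p' *: (w - w').
  by rewrite scalerBl scalerBr addrA subrK.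
by rewrite (le_trans (ler_normD _ _))// normrZ.
Qed.
Definition cond_scale : condReal A R -> cond A Y -> cond A Y := lift2 (lexx 0) lip_scale.

Lemma approx_scale c (m : condReal A R) y p w r s : 0 <= r -> 0 <= s ->
  approx c m p r -> approx c y w s ->
  approx c (cond_scale m y) (p *: w) (r * (`|w| + s) + `|p| * s).
Proof.
move=> r0 s0 nm ny; have := approx_lift2_lip (lexx 0) lip_scale r0 s0 nm ny.
by rewrite /= !subr0 !add0r.
Qed.

Lemma cpair_add_scale v y (m : condReal A R) y' :
  <<v, cond_add y (cond_scale m y')>> = cond_add <<v, y>> (cond_mul m <<v, y'>>).
Proof.
apply: agree_top; apply: agree_approx => c s c0 _ s0.
(* The error involves the sizes of [p] and [w'], which are picked only after the precision [k]. They
   stay within 2 of the coarse values [p0] and [w0], which bound them in advance. *)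
have [p0 [c1 [c10 c1c np0]]] := approx_pick m ltr01 c0.
have [w0 [c2 [c20 c21 nw0]]] := approx_pick y' ltr01 c10.
pose K := 4 * (`|w0| + `|p0| + 4) * (`|v| + 1).
have K0 : 0 < K by rewrite /K !mulr_gt0// ?ltr_wpDl// addr_ge0.
have m0 : 0 < Num.min 1 (s / K) by rewrite lt_min ltr01 divr_gt0.
set k := Num.min 1 (s / K) in m0.
have k1 : k <= 1 by rewrite ge_min lexx.
have kK : k * K <= s by rewrite -ler_pdivlMr// ge_min lexx orbT.
have [p [c3 [c30 c32 np]]] := approx_pick m m0 c20.
have [w' [c4 [c40 c43 nw']]] := approx_pick y' m0 c30.
have [w [e [e0 ec4 nw]]] := approx_pick y m0 c40.
have {}np := approx_sub (le_trans ec4 c43) np; have {}nw' := approx_sub ec4 nw'.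
have ec2 := le_trans ec4 (le_trans c43 c32).
have hp := approx_coh e0 np (approx_sub (le_trans ec2 c21) np0).
have hw := approx_coh e0 nw' (approx_sub ec2 nw0).
have pb : `|p| <= `|p0| + 2.
  by have := ler_distD 0 p p0; move: hp => /=; have := ler_normD (p - p0) p0; rewrite subrK; lra.
have wb : `|w'| <= `|w0| + 2.
  by move: hw => /=; have := ler_normD (w' - w0) w0; rewrite subrK; lra.
have k0 := ltW m0.
have tot : `|v| * (1 + `|w'| + k + `|p|) * k <= s.
  apply: le_trans kK; rewrite mulrC ler_wpM2l// /K mulrC ler_pM//.
  - by rewrite !addr_ge0.
  - by have := normr_ge0 w0; have := normr_ge0 p0; lra.
  - by rewrite lerDl.
exists e, (b v w + p * b v w'); split => //.
- by rewrite (le_trans ec2)// (le_trans c21).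
- have s1 : 0 <= k + (k * (`|w'| + k) + `|p| * k) by rewrite !(addr_ge0, mulr_ge0).
  have := approx_cpair b_le v s1 (approx_add nw (approx_scale k0 k0 np nw')).
  rewrite linearDr linearZr; apply: approx_le.
  by move: tot; rewrite !mulrDr !mulrDl; lra.
- have s1 : 0 <= `|v| * k by rewrite mulr_ge0.
  have := approx_add (approx_cpair b_le v k0 nw) (approx_mul k0 s1 np (approx_cpair b_le v k0 nw')).
  apply: approx_le; have h : k * `|b v w'| <= k * (`|v| * `|w'|) by rewrite ler_wpM2l.
  by move: tot h; rewrite !mulrDr !mulrDl; lra.
Qed.

End Separation.

(** * A lower bound of [f] by a concave cone, from convexity *)

Section Affine.
Context {d : Order.disp_t} {A : completeBoolType d} {R : realType}.
Context {X Y : normedModType R} {b : @dualPair R X Y}.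
Hypothesis b_le : forall x y, `|b x y| <= `|x| * `|y|.
Context (f : X -> condEReal A R).
Implicit Types (a c e g : A) (x z u v : X) (w : Y) (y : cond A Y) (ys : seq (cond A Y)).
Implicit Types (p q r s t M N : R).

Local Notation "<< v , y >>" := (cpair b_le v y).

Definition conic y M ys v : condReal A R :=
  cond_add <<v, y>> (cond_mul (crcst A (- M)) (cnorm b_le ys v)).

Lemma approx_conic c y M ys v p q r s : 0 <= s ->
  approx c <<v, y>> p r -> approx c (cnorm b_le ys v) q s ->
  approx c (conic y M ys v) (p - M * q) (r + `|M| * s).
Proof.
move=> s0 np nq; have := approx_add np (approx_mul (lexx 0) s0 (approx_crcst c (- M)) nq).
by rewrite mul0r add0r normrN mulNr.
Qed.

(* [f z >= t + <z - x0, y> - M * sum_(y' in ys) |<z - x0, y'>|] on [e] *)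
Definition minorant e x0 t y M ys := forall z c s, c != \bot%O -> (c <= e)%O ->
  le_at c (f z) s -> rle c (conic y M ys (z - x0)) (s - t).

Lemma joint_pick c y y' ys N s : c != \bot%O -> 0 <= N -> 0 < s -> exists w w' n e,
  [/\ e != \bot%O, (e <= c)%O, is_seminorm n &
  forall v, `|v| <= N -> [/\ approx e <<v, y>> (b v w) s,
    approx e <<v, y'>> (b v w') s & approx e (cnorm b_le ys v) (n v) s]].
Proof.
move=> c0 N0 s0; have [w [e [e0 ec hw]]] := cpair_pick b_le y c0 N0 s0.
have [w' [f' [f0 fe hw']]] := cpair_pick b_le y' e0 N0 s0.
have [n [g [g0 gf sn hn]]] := cnorm_pick b_le ys f0 N0 s0.
exists w, w', n, g; split => //; first by rewrite (le_trans gf)// (le_trans fe).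
move=> v vN; split; last exact: hn.
  by apply: approx_sub (hw v vN); exact: le_trans fe.
exact: approx_sub gf (hw' v vN).
Qed.

Hypothesis f_conv : forall u v t c p q, 0 < t -> t < 1 ->
  le_at c (f u) p -> le_at c (f v) q ->
  le_at c (f (t *: u + (1 - t) *: v)) (t * p + (1 - t) * q).

Section LowerBound.
Context (e : A) (x0 x1 : X) (q0 q1 s1 k : R) (ys : seq (cond A Y)).
Hypothesis e0 : e != \bot%O.
Hypothesis k0 : 0 < k.
Hypothesis bound0 : forall z c, c != \bot%O -> (c <= e)%O ->
  rle c (cnorm b_le ys (z - x0)) k -> ge_at c (f z) q0.
Hypothesis bound1 : forall z c, c != \bot%O -> (c <= e)%O ->
  rle c (cnorm b_le ys (z - x1)) k -> ge_at c (f z) q1.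
Hypothesis fx1 : le_at e (f x1) s1.

(** Close to [x0] the bound [q0] is enough. For [z] further away, a point of the segment from [x1]
    to [z] still lies in the neighbourhood of [x1], where [f >= q1]; convexity then prevents [f z]
    from falling faster than linearly in the distance. *)
Lemma minorant_ex : exists e' M, [/\ e' != \bot%O, (e' <= e)%O, 0 <= M &
  minorant e' x0 q0 (cvec A (0 : Y)) M ys].
Proof.
have q1s1 : q1 <= s1.
  apply: (bound1 (z := x1) e0 (lexx e) _ e0 (lexx e) fx1); rewrite subrr.
  apply: (@rleI _ _ _ 1) => // c s c0 ce s0.
  have [n [g [g0 gc [n1 n2 n3] hn]]] := cnorm_pick b_le ys c0 (lexx (0 : R)) s0.
  exists g, (n 0); split => //; first by apply: hn; rewrite normr0.
  have := n2 0 0; rewrite scale0r normr0 mul0r => ->; move: k0 s0; lra.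
have [C0 [e' [e'0 e'e hC]]] := approx_pick (cnorm b_le ys (x1 - x0)) ltr01 e0.
(* [C] has to bound the distance from [x0] to [x1] before [z] and the seminorm [n] are known: 1 for
   the radius of [C0], 1 for the later precision [r]. *)
pose C := `|C0| + 2; pose D := s1 - q1.
have C_ge : 0 <= C by rewrite addr_ge0.
have D_ge : 0 <= D by rewrite subr_ge0.
have DCk : 0 <= D / k * C by rewrite mulr_ge0 ?divr_ge0// ltW.
(* The slope along the segment is [2 * (D / k)]; [M2] absorbs the constants left over, since the
   distance exceeds [k / 2] outside the neighbourhood of [x0]. *)
pose M2 := 2 * (`|q0| + `|s1| + 2 * D + 2 * (D / k * C)) / k.
have M2_ge : 0 <= M2 by rewrite /M2 divr_ge0 ?(ltW k0)// mulr_ge0// !addr_ge0// mulr_ge0.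
have Dk : 0 <= D / k by rewrite divr_ge0// ltW.
pose M := 2 * (D / k) + M2.
have M_ge : 0 <= M by rewrite addr_ge0// mulr_ge0.
exists e', M; split => // z c s c0 ce lz.
apply: (@rleI _ _ _ 0) => // c1 u c10 c1c u0.
pose N := `|z - x0| + `|z - x1| + `|x1 - x0|.
have N0 : 0 <= N by rewrite !addr_ge0.
have m0 : 0 < Num.min (u / (M + 1)) (Num.min 1 (k / 4)).
  by rewrite !lt_min ltr01 !divr_gt0// ltr_wpDl.
set r := Num.min _ _ in m0.
have ru : M * r <= u.
  have : r * (M + 1) <= u by rewrite -ler_pdivlMr ?ltr_wpDl// ge_min lexx.
  by move: m0; lra.
have r1 : r <= 1 by rewrite !ge_min lexx orbT.
have rk : r <= k / 4 by rewrite !ge_min lexx !orbT.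
have [n [g [g0 gc1 [n1 n2 n3] hn]]] := cnorm_pick b_le ys c10 N0 m0.
have gc := le_trans gc1 c1c; have ge' := le_trans gc ce.
have na : approx g (cnorm b_le ys (z - x0)) (n (z - x0)) r.
  by apply: hn; rewrite /N -addrA lerDl addr_ge0.
have nC : approx g (cnorm b_le ys (x1 - x0)) (n (x1 - x0)) r.
  by apply: hn; rewrite /N lerDr addr_ge0.
have a_le : n (x1 - x0) <= C.
  have := approx_ball nC (approx_sub ge' hC) g0; have := ler_norm C0.
  by rewrite /C; lra.
have n0 : approx g <<z - x0, cvec A (0 : Y)>> 0 0 by rewrite cpair0; exact: approx_crcst.
exists g, (0 - M * n (z - x0)); split => //.
  apply: (approx_le _ (approx_conic M (ltW m0) n0 na)).
  by rewrite add0r (ger0_norm M_ge).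
set a := n (z - x0) in na *; have a0 : 0 <= a by exact: n1.
have [ak|ak] := leP (a + r) k.
  have := bound0 g0 (le_trans ge' e'e) (approx_rle na ak) g0 (lexx _) (le_at_sub gc lz).
  have : 0 <= M * a by rewrite mulr_ge0.
  lra.
pose a1 := n (z - x1).
have a1_ge : 0 <= a1 by exact: n1.
have a1_le : a1 <= a + C.
  have -> : a1 = n ((z - x0) + (-1) *: (x1 - x0)).
    by rewrite /a1 scaleN1r opprB addrA subrK.
  by apply: (le_trans (n3 _ _)); rewrite n2 normrN1 mul1r lerD2l.
have den : 0 < 2 * (k + a1) by rewrite mulr_gt0// ltr_wpDr.
(* Places the point at distance [l * a1 <= k / 2] from [x1]; the other half of [k] covers the
   precision. *)
pose l := k / (2 * (k + a1)).
have l0 : 0 < l by rewrite divr_gt0.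
have l1 : l < 1 by rewrite ltr_pdivrMr//; lra.
have lE : l * (2 * (k + a1)) = k by rewrite /l divfK// gt_eqF.
have lw := f_conv l0 l1 (le_at_sub gc lz) (le_at_sub (le_trans ge' e'e) fx1).
have wE : l *: z + (1 - l) *: x1 - x1 = l *: (z - x1).
  by rewrite scalerBl scale1r scalerBr addrA addrAC addrK.
have nw : approx g (cnorm b_le ys (l *: z + (1 - l) *: x1 - x1)) (l * a1) r.
  rewrite wE -[l in l * a1]gtr0_norm// -n2; apply: hn.
  rewrite normrZ gtr0_norm// (@le_trans _ _ `|z - x1|)//; last first.
    by rewrite /N addrAC lerDr addr_ge0.
  by rewrite ler_piMl// ltW.
have lk : l * a1 + r <= k.
  have : l * a1 <= k / 2.
    have : 0 <= l * k by rewrite mulr_ge0// ltW.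
    by move: lE; rewrite !mulrDr; lra.
  lra.
have h1 := bound1 g0 (le_trans ge' e'e) (approx_rle nw lk) g0 (lexx _) lw.
have h2 : D = D / k * l * (2 * (k + a1)).
  by rewrite -mulrA lE divfK// gt_eqF.
have h3 : s1 - D / k * (2 * (k + a1)) <= s.
  rewrite -(ler_pM2l l0).
  have -> : l * (s1 - D / k * (2 * (k + a1))) = l * s1 - D.
    by rewrite [in RHS]h2; ring.
  by move: h1; rewrite /D; lra.
have h4 : D / k * (2 * (k + a1)) = 2 * D + 2 * (D / k * a1) by field; rewrite gt_eqF.
have h5 : D / k * a1 <= D / k * a + D / k * C by rewrite -mulrDr ler_wpM2l.
have h6 : `|q0| + `|s1| + 2 * D + 2 * (D / k * C) <= M2 * a.
  have -> : `|q0| + `|s1| + 2 * D + 2 * (D / k * C) = M2 * (k / 2).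
    by rewrite /M2; field; rewrite gt_eqF.
  by rewrite ler_wpM2l//; lra.
have h7 : M * a = 2 * (D / k * a) + M2 * a by rewrite /M; ring.
have := ler_norm q0; have := ler_norm (- s1); rewrite normrN; lra.
Qed.
End LowerBound.

End Affine.

(** * Real inequalities that close the cases of the elimination *)

Section Estimates.
Context {R : realFieldType}.
Implicit Types (K M k G T u w p q r j l : R).

Lemma le_normM w r : 0 <= r -> - r <= w -> `|w| <= w + 2 * r.
Proof. by case: (ger0P w) => ? ? ?; lra. Qed.

Lemma gt0_approx w r j : 0 < r -> j <= r / 3 -> r <= w + j -> 0 < w.
Proof. by move=> *; lra. Qed.

Lemma norm_shift K k q r : 0 < k -> k <= 1 -> `|r| <= 3 * k -> `|q| <= K - 3 -> `|q + r| <= K.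
Proof. by move=> k0 k1 rk qK; apply: (le_trans (ler_normD _ _)); lra. Qed.

Lemma balance w w' : 0 < w -> w' < 0 ->
  exists l, [/\ 0 < l, l < 1 & l * w + (1 - l) * w' = 0].
Proof.
move=> w0 w'0; have den : 0 < w - w' by rewrite subr_gt0 (lt_trans w'0).
exists (- w' / (w - w')); split.
- by rewrite divr_gt0// oppr_gt0.
- by rewrite ltr_pdivrMr// mul1r addrC ltrDl.
- by field; rewrite gt_eqF.
Qed.

(** Here [u], [w] and [p] stand for [<<v, y'>>], [<<v, y>>] and the remaining seminorm, [T] for the
    bound of [f] minus [t], and [G] for the gap to be contradicted. Raising the slope by [2 * k]
    costs at most [2 * k * K]; the factor 24 leaves a wide margin for all errors of order
    [k * (K + M)]. *)
Lemma estimate_neg K M k G T u w p q : 0 <= M -> 5 <= K -> 0 < k -> k <= 1 ->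
  0 < G -> 24 * (k * (K + M)) <= G -> `|w| <= K -> `|q + 2 * k| <= K ->
  T + G - k * (2 * K + M) <= u + q * w - M * p ->
  u - M * p + (q + 2 * k) * w - (1 + M + `|q + 2 * k|) * k <= T -> False.
Proof.
move=> M0 K5 k0 k1 G0 kG wK qK lo hi.
have h5 : `|q + 2 * k| * k <= K * k by rewrite ler_wpM2r// ltW.
have h6 : - (k * w) <= k * K.
  by rewrite -mulrN ler_wpM2l ?(ltW k0)// (le_trans (ler_norm _))// normrN.
have h8 : k * 5 <= k * K by rewrite ler_wpM2l// ltW.
have h9 : 0 <= k * M by rewrite mulr_ge0// ltW.
lra.
Qed.

Lemma estimate_shift K M k G T u w p m q : 0 <= M -> 5 <= K -> 0 < k ->
  0 < G -> 24 * (k * (K + M)) <= G -> `|w| <= K -> `|q - m| <= 3 * k ->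
  T + G - k * (2 * K + M) <= u + m * w - M * p -> T + G / 2 <= u + q * w - M * p.
Proof.
move=> M0 K5 k0 G0 kG wK qm lo.
have : `|(q - m) * w| <= (3 * k) * K by rewrite normrM ler_pM.
rewrite ler_norml => /andP[h2 _].
have h7 : k * 5 <= k * K by rewrite ler_wpM2l// ltW.
have h9 : 0 <= k * M by rewrite mulr_ge0// ltW.
lra.
Qed.

(** For [w] nonnegative up to [k] and [q < - M], the term [q * w] is at most [- M * |w|] up to the
    errors, so the bound with [M] excludes the gap. *)
Lemma estimate_low K M k G T u w p q : 0 <= M -> 5 <= K -> 0 < k ->
  0 < G -> 24 * (k * (K + M)) <= G -> - k <= w -> `|q| <= K -> q < - M ->
  T + G / 2 <= u + q * w - M * p ->
  u - M * (`|w| + p) <= T + (1 + 2 * M) * k -> False.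
Proof.
move=> M0 K5 k0 G0 kG wk qK qM lo hi.
have h2 : M * `|w| <= M * (w + 2 * k) by rewrite ler_wpM2l// le_normM// ltW.
have h3 : (- M - q) * - k <= (- M - q) * w by rewrite ler_wpM2l//; lra.
have h4 : - (q * k) <= K * k.
  by rewrite -mulNr ler_wpM2r ?(ltW k0)// (le_trans (ler_norm _))// normrN.
have h7 : k * 5 <= k * K by rewrite ler_wpM2l// ltW.
have h9 : 0 <= k * M by rewrite mulr_ge0// ltW.
lra.
Qed.

(** For [0 <= w <= j] both [q * w] and [M * w] are of the order of the errors. *)
Lemma estimate_tiny M j G T u w p q : 0 <= M -> 0 < j -> 0 <= w -> w <= j ->
  j * (4 * (2 + 4 * M + 2 * `|q|)) <= G ->
  T + G - (1 + M + `|q|) * j <= u - M * p + q * w ->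
  u - M * (w + p) <= T + (1 + 2 * M) * j -> False.
Proof.
move=> M0 j0 w0 wj jG lo hi.
have h1 : (q + M) * w <= (`|q| + M) * j.
  apply: (@le_trans _ _ ((`|q| + M) * w)).
    by rewrite ler_wpM2r// lerD2r ler_norm.
  by rewrite ler_wpM2l ?addr_ge0.
have Mj : 0 <= M * j by rewrite mulr_ge0// ltW.
have qj : 0 <= `|q| * j by rewrite mulr_ge0// ltW.
lra.
Qed.

(** In the combination the terms with [q] cancel, while the gaps add up with weights [l] and [1 - l]
    and dominate the errors of order [j]. *)
Lemma estimate_mix M j G G' l q u u' w w' p p' p'' T T' : 0 <= M -> 0 < j ->
  j * (4 * (2 + 4 * M + 2 * `|q|)) <= G -> j * (4 * (2 + 4 * M + 2 * `|q|)) <= G' ->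
  0 <= l -> l <= 1 -> l * w + (1 - l) * w' = 0 -> p'' <= l * p + (1 - l) * p' ->
  T + G / 2 <= u + q * w - M * p ->
  T' + G' - (1 + M + `|q|) * j <= u' - M * p' + q * w' ->
  l * u + (1 - l) * u' - M * p'' <= l * T + (1 - l) * T' + (1 + 2 * M) * j -> False.
Proof.
move=> M0 j0 jG jG' l0 l1 lw pp lo lo' hi.
have l1' : 0 <= 1 - l by rewrite subr_ge0.
have pn : M * p'' <= M * (l * p + (1 - l) * p') by rewrite ler_wpM2l.
have h1 : l * (T + G / 2) <= l * (u + q * w - M * p) by rewrite ler_wpM2l.
have h2 : (1 - l) * (T' + G' - (1 + M + `|q|) * j) <= (1 - l) * (u' - M * p' + q * w').
  by rewrite ler_wpM2l.
have h3 : q * (l * w + (1 - l) * w') = 0 by rewrite lw mulr0.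
have h4 := ler_wpM2l l0 jG; have h5 := ler_wpM2l l1' jG'.
have Mj : 0 <= M * j by rewrite mulr_ge0// ltW.
have qj : 0 <= `|q| * j by rewrite mulr_ge0// ltW.
have h6 := mulr_ge0 l1' Mj; have h7 := mulr_ge0 l1' qj.
have h8 := mulr_ge0 l0 Mj; have h9 := mulr_ge0 l0 qj.
have h10 := mulr_ge0 l1' (ltW j0).
lra.
Qed.
End Estimates.

(** * Replacing absolute values by linear terms, one at a time *)

Section Elimination.
Context {d : Order.disp_t} {A : completeBoolType d} {R : realType}.
Context {X Y : normedModType R} {b : @dualPair R X Y}.
Hypothesis b_le : forall x y, `|b x y| <= `|x| * `|y|.
Context (f : X -> condEReal A R).
Implicit Types (a c e g : A) (x z v : X) (ys : seq (cond A Y)).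
Implicit Types (p q r s u w : R).

Local Notation "<< v , y >>" := (cpair b_le v y).

Hypothesis f_conv : forall (u v : X) (t : R) c p q, 0 < t -> t < 1 ->
  le_at c (f u) p -> le_at c (f v) q ->
  le_at c (f (t *: u + (1 - t) *: v)) (t * p + (1 - t) * q).

Section Step.
Context (e : A) (x0 : X) (t M : R) (y' y : cond A Y) (ys : seq (cond A Y)).
Hypothesis M0 : 0 <= M.
Hypothesis fM : minorant b_le f e x0 t y' M (y :: ys).

Let lin q v : condReal A R := cond_add (conic b_le y' M ys v) (cond_mul (crcst A q) <<v, y>>).

Let approx_lin c q v u w p s : 0 <= s -> approx c <<v, y'>> u s -> approx c <<v, y>> w s ->
  approx c (cnorm b_le ys v) p s -> approx c (lin q v) (u - M * p + q * w) ((1 + M + `|q|) * s).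
Proof.
move=> s0 nu nw np.
have := approx_add (approx_conic M s0 nu np) (approx_mul (lexx 0) s0 (approx_crcst c q) nw).
by rewrite mul0r add0r (ger0_norm M0); apply: approx_le; rewrite !mulrDl mul1r.
Qed.

Let fM_at z c s u w p r : c != \bot%O -> (c <= e)%O -> le_at c (f z) s -> 0 <= r ->
  approx c <<z - x0, y'>> u r -> approx c <<z - x0, y>> w r ->
  approx c (cnorm b_le ys (z - x0)) p r -> u - M * (`|w| + p) <= s - t + (1 + 2 * M) * r.
Proof.
move=> c0 ce lz r0 nu nw np.
have nn : approx c (cnorm b_le (y :: ys) (z - x0)) (`|w| + p) (r + r).
  exact: approx_add (approx_abs nw) np.
have := fM c0 ce lz c0 (lexx _) (approx_conic M (addr_ge0 r0 r0) nu nn).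
by rewrite (ger0_norm M0); lra.
Qed.

(** Where [<<z - x0, y>> <= 0] the inequality weakens as [q] grows, so admissible slopes are closed
    upwards. The clause [- M <= q] bounds them from below; slopes above [M] are admissible, because
    [M * <<z - x0, y>>] is there [- M] times the absolute value. *)
Let P0 c q := (c != \bot%O -> - M <= q) /\ forall z g s, g != \bot%O -> (g <= c)%O ->
  (g <= e)%O -> le_at g (f z) s -> rle g <<z - x0, y>> 0 -> rle g (lin q (z - x0)) (s - t).
(* Quantifying over [q' > q] makes right continuity automatic. *)
Let P c q := forall q', q < q' -> P0 c q'.

Let P_cut : cut P.
Proof.
split.
- move=> a c q ca h q' qq; have [h1 h2] := h q' qq; split.
    by move=> c0; apply: h1; apply: contra_neq c0 => a0; apply/eqP; rewrite -lex0 -a0.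
  by move=> z g s g0 gc; apply: h2 => //; exact: le_trans ca.
- by move=> a q q' qq h q'' lt''; apply: h; exact: le_lt_trans lt''.
- move=> a q h q' qq; split.
    by move=> a0; have [c [c0 ca /(_ _ qq)[h1 _]]] := h a a0 (lexx _); exact: h1.
  move=> z g s g0 ga ge lz ly; apply: rle_local => c c0 cg.
  have [c' [c'0 c'c /(_ _ qq)[_ h1]]] := h c c0 (le_trans cg ga).
  have c'g := le_trans c'c cg.
  exists c'; split => //; apply: h1 => //; first exact: le_trans ge.
    exact: le_at_sub lz.
  exact: rle_sub ly.
- move=> a q h q' qq; have [] : q < (q + q') / 2 /\ (q + q') / 2 < q' by split; lra.
  by move=> /h; apply.
Qed.

Let P_ub c : c != \bot%O -> exists c' q, [/\ c' != \bot%O, (c' <= c)%O & P c' q].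
Proof.
move=> c0; exists c, M; split => // q Mq; split => [_|]; first by move: M0; lra.
move=> z g s g0 gc ge lz ly.
have q0 : 0 <= q := ltW (le_lt_trans M0 Mq).
have K0 : 0 < 1 + M + q by rewrite -addrA ltr_pwDl// addr_ge0.
apply: (@rleI _ _ _ 4) => // h r h0 hg r0.
have s0 : 0 < r / (1 + M + q) by rewrite divr_gt0.
have [w1 [w2 [n [i [i0 ih [n1 n2 n3] hn]]]]] :=
  joint_pick b_le y' y ys h0 (normr_ge0 (z - x0)) s0.
have [na nb nc] := hn _ (lexx _).
set k := r / _ in s0 na nb nc.
have rE : r = (1 + M + q) * k by rewrite /k mulrC divfK// gt_eqF.
exists i, (b (z - x0) w1 - M * n (z - x0) + q * b (z - x0) w2); split => //.
  by apply: (approx_le _ (approx_lin q (ltW s0) na nb nc)); rewrite ger0_norm// rE.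
have ig := le_trans ih hg.
have := fM_at i0 (le_trans ig ge) (le_at_sub ig lz) (ltW s0) na nb nc.
have := ly i _ _ i0 ig nb.
set w := b _ w2; set p := n _; set u := b _ _.
rewrite subr_le0 => wk h1.
have h2 : `|w| <= - w + 2 * k.
  by case: (ger0P w) => w0; move: s0; lra.
have h3 : M * `|w| <= M * (- w + 2 * k) by rewrite ler_wpM2l.
have h4 : (q - M) * w <= (q - M) * k by rewrite ler_wpM2l// subr_ge0 ltW.
have h5 : 0 <= M * k by rewrite mulr_ge0// ltW.
have h6 : 0 <= q * k by rewrite mulr_ge0// ltW.
by rewrite rE; lra.
Qed.

Let P_lb c : c != \bot%O -> exists c' q, [/\ c' != \bot%O, (c' <= c)%O &
  forall h, h != \bot%O -> (h <= c')%O -> ~ P h q].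
Proof.
(* [P] speaks of larger slopes only; among those above [- M - 2], the slope [- M - 1] still violates
   the lower clause. *)
move=> c0; exists c, (- M - 2); split => // h h0 _ Ph.
have [] : - M - 2 < - M - 1 /\ True by split=> //; lra.
by move=> /Ph[/(_ h0)]; lra.
Qed.

(** Where [<<v, y>> > 0], a real slope [q] close to [m] is refused either by the clause [- M <= q]
    or by some [z'] on the other side. In the second case a convex combination of [z] and [z'] makes
    [<<., y>>] vanish; the given minorant has no term in [y] there and contradicts the two
    violations together. *)
Lemma minorant_step : exists m : condReal A R,
  minorant b_le f e x0 t (cond_add y' (cond_scale m y)) M ys.
Proof.
have [m hm] := rcut P_cut P_ub P_lb; exists m => z c s c0 ce lz.
apply: contrapT => /not_rle[c1 [p0 [r0 [c10 c1c np0 gap]]]].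
rewrite /conic cpair_add_scale in np0.
set v := z - x0 in np0 *.
have [v0 [c2 [c20 c21 nv0]]] := approx_pick <<v, y>> ltr01 c10.
have [m0 [c3 [c30 c32 nm0]]] := approx_pick m ltr01 c20.
pose G := p0 - r0 - (s - t).
have G0 : 0 < G by rewrite subr_gt0.
(* Approximations of [<<v, y>>] and [m] are within 2 of [v0] and [m0]; the remaining 3 is the margin
   for moving the slope by at most [3 * k]. *)
pose K := `|v0| + `|m0| + 5.
have K5 : 5 <= K by rewrite /K lerDr addr_ge0.
have KM : 0 < 24 * (K + M) by move: M0 K5; lra.
have [k [k0 k1 kG]] : exists k, [/\ 0 < k, k <= 1 & 24 * (k * (K + M)) <= G].
  exists (Num.min 1 (G / (24 * (K + M)))); split.
  - by rewrite lt_min ltr01 divr_gt0.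
  - by rewrite ge_min lexx.
  - by rewrite mulrCA -ler_pdivlMr// ge_min lexx orbT.
have c31 := le_trans c32 c21; have c3c := le_trans c31 c1c; have c3e := le_trans c3c ce.
have base h u w p q : h != \bot%O -> (h <= c3)%O -> approx h <<v, y'>> u k ->
    approx h <<v, y>> w k -> approx h (cnorm b_le ys v) p k -> approx h m q k ->
    [/\ `|w| <= K - 3, `|q| <= K - 3 & s - t + G - k * (2 * K + M) <= u + q * w - M * p].
  move=> h0 hc nu nw np nq.
  have h1 := approx_coh h0 nw (approx_sub (le_trans hc c32) nv0).
  have h2 := approx_coh h0 nq (approx_sub hc nm0).
  have wb : `|w| <= K - 3.
    have := ler_normD (w - v0) v0; rewrite subrK; move: h1 => /=.
    by have := normr_ge0 m0; rewrite /K; lra.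
  have qb : `|q| <= K - 3.
    have := ler_normD (q - m0) m0; rewrite subrK; move: h2 => /=.
    by have := normr_ge0 v0; rewrite /K; lra.
  split => //.
  have := approx_add (approx_add nu (approx_mul (ltW k0) (ltW k0) nq nw))
    (approx_mul (lexx 0) (ltW k0) (approx_crcst h (- M)) np).
  move=> /(approx_ball (approx_sub (le_trans hc c31) np0) )/(_ h0).
  rewrite mul0r add0r normrN (ger0_norm M0) /G.
  have h3 : k * `|w| <= k * (K - 3) by rewrite ler_wpM2l// ltW.
  have h4 : `|q| * k <= (K - 3) * k by rewrite ler_wpM2r// ltW.
  have h5 : k * k <= k by rewrite -[leRHS]mulr1 ler_wpM2l// ltW.
  lra.
(* If [<<v, y>> <= 0] on some part, slopes just above [m] are admissible there and contradict the
   gap; otherwise a part is found where [<<v, y>>] exceeds a positive real. *)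
have [[c4 [c40 c43 ly]]|noA] :=
  pselect (exists c4, [/\ c4 != \bot%O, (c4 <= c3)%O & rle c4 <<v, y>> 0]).
  have [w1 [w2 [n [c5 [c50 c54 _ hn]]]]] := joint_pick b_le y' y ys c40 (normr_ge0 v) k0.
  have [q [h [h0 hc5 nq]]] := approx_pick m k0 c50.
  have [/(approx_sub hc5) na /(approx_sub hc5) nb /(approx_sub hc5) nc] := hn _ (lexx _).
  have h4 := le_trans hc5 c54; have h3 := le_trans h4 c43.
  have [wb qb lo] := base _ _ _ _ _ h0 h3 na nb nc nq.
  have Pq : P h (q + k) by apply/hm; exact: approx_rle nq (lexx _).
  have [_ Pq2] := Pq (q + 2 * k) ltac:(lra).
  have {Pq2} := Pq2 z h s h0 (lexx _) (le_trans h3 c3e) (le_at_sub (le_trans h3 c3c) lz)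
    (rle_sub h4 ly).
  move=> /(_ h _ _ h0 (lexx _) (approx_lin _ (ltW k0) na nb nc)).
  apply: (estimate_neg M0 K5 k0 k1 G0 kG _ _ lo); first by rewrite (le_trans wb)// gerBl.
  apply: (norm_shift k0 k1 _ qb).
  by rewrite ger0_norm ?mulr_ge0 ?(ltW k0)// ler_wpM2r ?(ltW k0)// ler_nat.
have [|c4 [v1 [r1 [c40 c43 nv1 v1r1]]]] := @not_rle _ _ _ c3 <<v, y>> 0.
  by move=> ly; apply: noA; exists c3.
have [m1 [c5 [c50 c54 nm1]]] := approx_pick m k0 c40.
(* On [c5] the slope [m] is at least [m1 - k], so the reals above [m1 - 3 * k] are not all
   admissible. Being real, the refused [q] can replace [m] in the estimates. *)
have [q mq nPq] : exists2 q, m1 - 3 * k < q & ~ P0 c5 q.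
  apply: contrapT => no; have /hm/(_ c5 _ _ c50 (lexx _) nm1) : P c5 (m1 - 3 * k).
    by move=> q mq; apply: contrapT => nP; apply: no; exists q.
  by move: k0; lra.
have qm : q <= m1 + k.
  rewrite leNgt; apply/negP => lt'; apply: nPq.
  have /hm Pm : rle c5 m (m1 + k) by exact: approx_rle nm1 (lexx _).
  exact: Pm.
have c53 := le_trans c54 c43.
have base2 h u w p : h != \bot%O -> (h <= c5)%O -> approx h <<v, y'>> u k ->
    approx h <<v, y>> w k -> approx h (cnorm b_le ys v) p k ->
    [/\ v1 - r1 - k <= w, `|q| <= K & s - t + G / 2 <= u + q * w - M * p].
  move=> h0 hc nu nw np.
  have [wb qb lo] := base _ _ _ _ _ h0 (le_trans hc c53) nu nw np (approx_sub hc nm1).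
  have h1 := approx_ball (approx_sub (le_trans hc c54) nv1) nw h0.
  have qm1 : `|q - m1| <= 3 * k.
    by rewrite ler_norml lerBrDl ltW//= lerBlDl (le_trans qm)// lerD2l ler_peMl ?(ltW k0)// ler1n.
  split; first by rewrite lerBlDr.
    by rewrite -[q](subrKC m1); exact: norm_shift qm1 qb.
  by apply: (estimate_shift M0 K5 k0 G0 kG _ qm1 lo); rewrite (le_trans wb)// gerBl.
have c5e := le_trans c53 c3e; have c5c := le_trans c53 c3c.
have [/not_implyP[_ /negP]|] := proj1 (not_andP _ _) nPq.
  rewrite -ltNge => qM.
  have [w1 [w2 [n [h [h0 hc5 _ hn]]]]] := joint_pick b_le y' y ys c50 (normr_ge0 v) k0.
  have [na nb nc] := hn _ (lexx _).
  have [wv qb lo] := base2 _ _ _ _ h0 hc5 na nb nc.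
  have := fM_at h0 (le_trans hc5 c5e) (le_at_sub (le_trans hc5 c5c) lz) (ltW k0) na nb nc.
  apply: (estimate_low M0 K5 k0 G0 kG _ qb qM lo).
  by apply: le_trans wv; rewrite lerDr ltW// subr_gt0.
move=> /existsNP[z' /existsNP[g /existsNP[s' ]]].
move=> /not_implyP[g0 /not_implyP[gc5 /not_implyP[ge /not_implyP[lz' /not_implyP[ly']]]]].
set v' := z' - x0 in ly' * => /not_rle[g1 [p1 [r1' [g10 g1g np1 gap']]]].
pose G' := p1 - r1' - (s' - t).
have G'0 : 0 < G' by rewrite subr_gt0.
(* A second, finer precision [j] is needed: it depends on [q], on the gap [G'] at [z'] and on the
   positive lower bound [v1 - r1] of [<<v, y>>], all obtained after [k]. *)
pose L := 4 * (2 + 4 * M + 2 * `|q|).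
have L0 : 0 < L by rewrite /L mulr_gt0// !ltr_pwDl// mulr_ge0.
have [j [j0 jk jv jG jG']] : exists j,
    [/\ 0 < j, j <= k, j <= (v1 - r1) / 3, j * L <= G & j * L <= G'].
  exists (Num.min k (Num.min (Num.min (G / L) (G' / L)) ((v1 - r1) / 3))); split.
  - by rewrite !lt_min k0 !divr_gt0.
  - by rewrite ge_min lexx.
  - by rewrite !ge_min lexx !orbT.
  - by rewrite -ler_pdivlMr// !ge_min lexx !orbT.
  - by rewrite -ler_pdivlMr// !ge_min lexx !orbT.
have N0 : 0 <= `|v| + `|v'| by rewrite addr_ge0.
have [w1 [w2 [n [h [h0 hg1 [n1 n2 n3] hn]]]]] := joint_pick b_le y' y ys g10 N0 j0.
have [na nb nc] : _ := hn v ltac:(by rewrite lerDl).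
have [na' nb' nc'] : _ := hn v' ltac:(by rewrite lerDr).
have hg := le_trans hg1 g1g; have hc5 := le_trans hg gc5; have he := le_trans hc5 c5e.
have [wv qb lo] := base2 _ _ _ _ h0 hc5 (approx_le jk na) (approx_le jk nb) (approx_le jk nc).
have lo' := approx_ball (approx_sub hg1 np1) (approx_lin q (ltW j0) na' nb' nc') h0.
have wv' := ly' _ _ _ h0 hg nb'.
have wv2 := approx_ball (approx_sub (le_trans hc5 c54) nv1) nb h0.
have w_gt0 : 0 < b v w2 := gt0_approx v1r1 jv wv2.
have w'j : b v' w2 <= j by move: wv'; rewrite subr_le0.
(* The approximate value is nonpositive only up to [j]; when it is not negative, [z'] alone
   contradicts the minorant. *)
have [w'0|w'0] := leP 0 (b v' w2).
  have := fM_at h0 he (le_at_sub hg lz') (ltW j0) na' nb' nc'; rewrite (ger0_norm w'0).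
  apply: (estimate_tiny M0 j0 w'0 w'j jG').
  by rewrite /G' (addrC (s' - t)) subrK lerBlDr.
(* Both vectors are paired with the same [w2], so a real [l] makes the approximate pairing vanish
   exactly at the combination. *)
have [l [l0 l1 lw]] := balance w_gt0 w'0.
have lf := f_conv l0 l1 (le_at_sub (le_trans hc5 c5c) lz) (le_at_sub hg lz').
have vE : l *: z + (1 - l) *: z' - x0 = l *: v + (1 - l) *: v'.
  by rewrite /v /v' !scalerBr addrACA -opprD -scalerDl subrKC scale1r.
have l1' : 0 <= 1 - l by rewrite subr_ge0 ltW.
have [] : _ := hn (l *: v + (1 - l) *: v') _.
  rewrite (le_trans (ler_normD _ _))// lerD// normrZ ger0_norm ?(ltW l0)//.
    by rewrite ler_piMl// ltW.
  by rewrite ler_piMl// gerBl ltW.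
rewrite -vE => na'' nb'' nc''.
have := fM_at h0 he lf (ltW j0) na'' nb'' nc''.
have bE (w : Y) : b (l *: v + (1 - l) *: v') w = l * b v w + (1 - l) * b v' w.
  by rewrite linearDl !linearZl_LR.
rewrite vE !bE lw normr0 add0r.
move=> hi; apply: (estimate_mix (T := s - t) (T' := s' - t) (p'' := n (l *: v + (1 - l) *: v'))
  (u' := b v' w1) (p' := n v') M0 j0 jG jG' (ltW l0) (ltW l1) lw _ lo).
- by rewrite (le_trans (n3 _ _))// !n2 !ger0_norm ?(ltW l0).
- by rewrite /G' (addrC (s' - t)) subrK lerBlDr.
- have -> : l * (s - t) + (1 - l) * (s' - t) = l * s + (1 - l) * s' - t by ring.
  exact: hi.
Qed.
End Step.

Lemma minorant_affine e x0 t M ys y' : 0 <= M -> minorant b_le f e x0 t y' M ys ->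
  exists y, minorant b_le f e x0 t y M [::].
Proof.
move=> M0; elim: ys y' => [|y ys IH] y' h; first by exists y'.
by have [m /IH] := minorant_step M0 h.
Qed.

End Elimination.

(** * From lower semi-continuity to the biconjugate *)

Section Lsc.
Context {d : Order.disp_t} {A : completeBoolType d} {R : realType}.
Context {X Y : normedModType R} {b : @dualPair R X Y}.
Hypothesis b_le : forall x y, `|b x y| <= `|x| * `|y|.
Context (f : X -> condEReal A R).
Implicit Types (a c e g : A) (x z u v : X) (ys : seq (cond A Y)).
Implicit Types (p q r s t : R).

Local Notation "<< v , y >>" := (cpair b_le v y).

Lemma stable_on_agree (S T : condSet A) (D : set S) (g : S -> T) c (x y : S) :
  stable_on D g -> D x -> D y -> agree c x y -> agree c (g x) (g y).
Proof.
move=> st Dx Dy xy; pose z (i : bool) := if i then x else y.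
have -> : y = concat (cut_part c) z.
  by apply: concat_uniq => -[] /=; [exact: agree_sym|exact: agree_refl].
rewrite st; last by case.
by apply: agree_sym; exact: (concatP (cut_part c) (fun i => g (z i)) true).
Qed.

Definition step_if (E : Type) c (p q : step A E) : step A E :=
  concat (cut_part c) (fun i : bool => if i then p else q).

Lemma step_if_in (E : Type) c (p q : step A E) e (v : E) : e != \bot%O -> (e <= c)%O ->
  (e <= p v)%O -> (e <= step_if c p q v)%O.
Proof.
move=> e0 ec ep; have /agree_sym ag : agree c (step_if c p q) p.
  exact: (concatP (cut_part c) (fun i : bool => if i then p else q) true).
by move/step_agreeP: ag; apply.
Qed.

Lemma step_if_out (E : Type) c (p q : step A E) e (v : E) : e != \bot%O -> (e <= ~` c)%O ->
  (e <= q v)%O -> (e <= step_if c p q v)%O.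
Proof.
move=> e0 ec ep; have /agree_sym ag : agree (~` c)%O (step_if c p q) q.
  exact: (concatP (cut_part c) (fun i : bool => if i then p else q) false).
by move/step_agreeP: ag; apply.
Qed.

Lemma sinterval_step_if c (n l : step A nat) j m : (c <= n m)%O -> (0 < j <= m)%N ->
  sinterval n l -> sinterval n (step_if c (step_cst A j) l).
Proof.
move=> cn /andP[j0 jm] [/srelP h1 /srelP h2]; split; apply/srelP => e u w e0 eu ew.
  have [g [g0 ge [gc|gc]]] := split_piece c e0.
    have wj : w = j.
      apply: (part_uniq g0 (le_trans ge ew)); apply: step_if_in => //.
      exact: step_cst_top.
    by rewrite (step_cst_at e0 eu) wj.
  have [w' [h [h0 hg hl]]] := part_hit l g0.
  have -> : w = w'.
    apply: (part_uniq h0 (le_trans hg (le_trans ge ew))); apply: step_if_out => //.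
    exact: le_trans gc.
  exact: h1 h0 (le_trans hg (le_trans ge eu)) hl.
have [g [g0 ge [gc|gc]]] := split_piece c e0.
  have uj : u = j.
    apply: (part_uniq g0 (le_trans ge eu)); apply: step_if_in => //.
    exact: step_cst_top.
  by rewrite uj -(part_uniq g0 (le_trans gc cn) (le_trans ge ew)).
have [u' [h [h0 hg hl]]] := part_hit l g0.
have -> : u = u'.
  apply: (part_uniq h0 (le_trans hg (le_trans ge eu))); apply: step_if_out => //.
  exact: le_trans gc.
exact: h2 h0 hl (le_trans hg (le_trans ge ew)).
Qed.

(** On a small piece the conditional length [n] of the family is a natural number [m] and the
    conditional radius is at least a positive real, so a weak neighbourhood contains one given by a
    genuine finite family. *)
Lemma lsc_bound x c q : cond_lower_semicontinuous b_le f -> c != \bot%O -> ~ le_at c (f x) q ->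
  exists e ys k q', [/\ e != \bot%O, (e <= c)%O, 0 < k, q < q' &
    forall z g, g != \bot%O -> (g <= e)%O -> rle g (cnorm b_le ys (z - x)) k -> ge_at g (f z) q'].
Proof.
move=> lsc c0; rewrite (lsc x) => /(le_at_esup _ _ c0)/existsNP[i /not_implyP[[V nV <-] nlV]].
have [q' qq' nlV'] : exists2 q', q < q' & ~ le_at c (nbhd_inf f V) q'.
  apply: contrapT => no; apply: nlV; apply: (cut_rc (le_at_cut _)) => q' qq'.
  by apply: contrapT => nl; apply: no; exists q'.
have [c1 [c10 c1c hc1]] := not_le_at nlV'.
have VV := nV; case: VV hc1 nlV' nlV => [r [n [y [r0 st ->]]]] hc1 nlV' nlV.
have [c2 [k [c20 c21 k0 hk]]] := clt_pos r0 c10.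
have [m [c3 [c30 c32 c3m]]] := part_hit n c20.
(* The constant index [j] may leave the interval off [c3], so an index [l0] of the interval takes
   over there. If the interval is empty, the implication holds for any [l0]. *)
have [l0 Dl0] : exists l0, forall l, sinterval n l -> sinterval n l0.
  by have [[l0 D0]|no] := pselect (exists l, sinterval n l);
    [exists l0|exists n => l Dl; case: no; exists l].
pose y' (j : nat) := y (step_if c3 (step_cst A j) l0).
exists c3, [seq y' j | j <- iota 1 m], k, q'; split => //.
  by rewrite (le_trans c32)// (le_trans c21).
move=> z g g0 gc3 hQ e s e0 eg lz; rewrite leNgt; apply/negP => sq'.
have ec3 := le_trans eg gc3.
have ec1 : (e <= c1)%O by rewrite (le_trans ec3)// (le_trans c32).
apply: (hc1 e e0 ec1).
(* The competitor is [z] on [e] and the centre [x] elsewhere, where the conditions of the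
   neighbourhood are trivially met. *)
apply: (nbhd_inf_le (z := step_if e (step_cst A z) (step_cst A x))) => //; last first.
  apply: (cut_trans (le_at_cut _) (ltW sq')).
  apply: le_at_agree lz; apply: agree_sym; apply: step_ext_at.
  by apply: step_if_in => //; exact: step_cst_top.
move=> l Dl; apply/cle_onP => g1 p t r' s' g10 _ np nr.
have ts0 : 0 <= t + s'.
  have [e1 [k1 [e10 e1g k10 h]]] := clt_pos r0 g10.
  have := h e1 _ _ e10 (lexx _) (approx_sub e1g nr); exact: le_trans (ltW k10).
set z' := step_if _ _ _ in np.
have nx h : approx h (cvec A x) x 0 by exact: approx_cst.
have [g2 [g20 g21 [g2e|g2e]]] := split_piece e g10; last first.
  have [w [h [h0 hg2 nw]]] := approx_pick (y l) ltr01 g20.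
  have nz : approx h (completion_step (norm_metric X) z') x 0.
    apply: approx_step; apply: step_if_out => //; first exact: le_trans g2e.
    exact: step_cst_top.
  have := approx_abs (approx_pairing b_le (addr_ge0 (lexx 0) (lexx 0)) ler01
    (approx_csub nz (nx h)) nw).
  rewrite subrr linear0l normr0 !(addr0, mul0r, normr0) => np'.
  have := approx_ball (approx_sub (le_trans hg2 g21) np) np' h0; lra.
have [j [g3 [g30 g32 g3l]]] := part_hit l g20.
have g3c := le_trans (le_trans g32 g2e) ec3.
have jm : (0 < j <= m)%N.
  case: Dl => /srelP h1 /srelP h2; apply/andP; split.
    exact: h1 g30 (step_cst_top _ _) g3l.
  exact: h2 g30 g3l (le_trans g3c c3m).
have ag : agree g3 (y l) (y' j).
  apply: (stable_on_agree st Dl (sinterval_step_if c3m jm (Dl0 l Dl))).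
  apply/step_agreeP => h v h0 hg hv.
  rewrite (part_uniq h0 hv (le_trans hg g3l)); apply: step_if_in => //.
    exact: le_trans g3c.
  exact: step_cst_top.
have lek : rle g3 (cond_abs <<z - x, y' j>>) k.
  apply: (rle_cnorm_map (l := iota 1 m)); first by rewrite mem_iota add1n ltnS.
  apply: rle_sub hQ; exact: le_trans (le_trans g32 g2e) eg.
apply/ler_addgt0Pr => u u0.
have N1 : 0 < `|z - x| + 1 by rewrite ltr_wpDl.
have j0 : 0 < u / 2 / (`|z - x| + 1) by rewrite !divr_gt0.
have [w [h [h0 hg3 nw]]] := approx_pick (y l) j0 g30.
set u' := u / 2 / _ in j0 nw.
have iu : `|z - x| * u' <= u / 2.
  have -> : u / 2 = (`|z - x| + 1) * u' by rewrite /i mulrCA divff ?mulr1// gt_eqF.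
  by rewrite ler_wpM2r ?(ltW j0)// lerDl.
have nz : approx h (completion_step (norm_metric X) z') z 0.
  apply: approx_step; apply: step_if_in => //; last exact: step_cst_top.
  by rewrite (le_trans hg3)// (le_trans g32).
have := approx_abs (approx_pairing b_le (addr_ge0 (lexx 0) (lexx 0)) (ltW j0)
    (approx_csub nz (nx h)) nw).
rewrite addr0 mul0r add0r => np'.
have h1 := approx_ball (approx_sub (le_trans hg3 (le_trans g32 g21)) np) np' h0.
have nw' := approx_agree (agree_le hg3 ag) nw.
have h2 := lek _ _ _ h0 hg3 (approx_abs (approx_cpair b_le (z - x) (ltW j0) nw')).
have hc2 : (h <= c2)%O by rewrite (le_trans hg3)// (le_trans g3c).
have h3 := hk _ _ _ h0 hc2 (approx_sub (le_trans hg3 (le_trans g32 g21)) nr).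
lra.
Qed.

Hypothesis f_convex : proper_convex f.

Lemma convex_le_at (u v : X) t c p q : 0 < t -> t < 1 ->
  le_at c (f u) p -> le_at c (f v) q -> le_at c (f (t *: u + (1 - t) *: v)) (t * p + (1 - t) * q).
Proof.
move=> t0 t1 lu lv; case: (eqVneq c \bot%O) => [->|c0]; first exact: le_at_bot.
have [_ _ h] := f_convex.
have t01 : 0 <= t <= 1 by rewrite !ltW.
have /eleP := h u v t t01; apply=> //; apply: le_at_eadd; apply: le_at_escale => //.
by rewrite subr_gt0.
Qed.

Lemma lsc_biconj : cond_lower_semicontinuous b_le f -> forall x, f x = biconj b_le f x.
Proof.
move=> lsc x; apply: ele_anti; last exact: biconj_le.
apply/eleP => c q c0 lq; apply: contrapT => nl.
have [e0 [ys0 [k0 [q0 [e00 e0c k00 qq0 bound0]]]]] := lsc_bound lsc c0 nl.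
have [_ [x1 [r1 fx1]] _] := f_convex.
have [s [e1 [e10 e1e0 nr1]]] := approx_pick r1 ltr01 e00.
have lx1 : le_at e1 (f x1) (s + 1) by rewrite fx1; apply/le_at_creal; exact: approx_rle nr1 _.
(* On [e1] the value [f x1] is within 1 of [s], so the bound [s - 2] fails; lower semi-continuity at
   [x1] then bounds [f] from below near [x1]. *)
have nlx1 : ~ le_at e1 (f x1) (s - 2).
  by rewrite fx1 => /le_at_creal h; have := h _ _ _ e10 (lexx _) nr1; lra.
have [e2 [ys1 [k1 [q1 [e20 e21 k10 _ bound1]]]]] := lsc_bound lsc e10 nlx1.
(* One family and one radius for both points: the sum over the concatenated family dominates the sum
   over each part. *)
have kk : 0 < Num.min k0 k1 by rewrite lt_min k00.
have b0 z g : g != \bot%O -> (g <= e2)%O ->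
    rle g (cnorm b_le (ys0 ++ ys1) (z - x)) (Num.min k0 k1) -> ge_at g (f z) q0.
  move=> g0 ge h; apply: bound0 => //; first by rewrite (le_trans ge)// (le_trans e21).
  by apply: rle_trans (rle_cnorm_catl h); rewrite ge_min lexx.
have b1 z g : g != \bot%O -> (g <= e2)%O ->
    rle g (cnorm b_le (ys0 ++ ys1) (z - x1)) (Num.min k0 k1) -> ge_at g (f z) q1.
  move=> g0 ge h; apply: bound1 => //.
  by apply: rle_trans (rle_cnorm_catr h); rewrite ge_min lexx orbT.
have [e3 [M [e30 e32 M0 min3]]] := minorant_ex convex_le_at e20 kk b0 b1 (le_at_sub e21 lx1).
have [y miny] := minorant_affine convex_le_at M0 min3.
(* The affine minorant gives [<x, y> - q0] as a bound for the conjugate at [y]. With two errors of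
   size [r] the biconjugate is at least [q0 - 2 * r], midway between [q] and [q0]. *)
pose r := (q0 - q) / 4.
have r0 : 0 < r by rewrite divr_gt0// subr_gt0.
have [p [e4 [e40 e43 np]]] := approx_pick <<x, y>> r0 e30.
have lc : le_at e4 (fenchel_conj b_le f y) (p + r - q0).
  apply/(le_at_conj _ _ _ _ e40) => z g t g0 ge4 lz.
  apply: (@rleI _ _ _ 2) => // h u h0 hg u0.
  have N0 : 0 <= `|z| + `|x| by rewrite addr_ge0.
  have [w [i [i0 ih hw]]] := cpair_pick b_le y h0 N0 u0.
  exists i, (b z w); split => //; first by apply: hw; rewrite lerDl.
  have nx : approx i <<x, y>> (b x w) u by apply: hw; rewrite lerDr.
  have nzx : approx i <<z - x, y>> (b (z - x) w) u by apply: hw; exact: ler_normB.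
  have ig := le_trans ih hg; have ie4 := le_trans ig ge4.
  have n0 : approx i (cnorm b_le [::] (z - x)) 0 0 by exact: approx_crcst.
  have := miny z i t i0 (le_trans ie4 e43) (le_at_sub ig lz) i _ _ i0 (lexx _)
    (approx_conic M (lexx 0) nzx n0).
  have := approx_ball nx (approx_sub ie4 np) i0.
  by rewrite linearBl !mulr0 subr0 addr0; lra.
have := proj1 (le_at_biconj _ _ _ _ c0) lq y e4 _ e40 _ lc.
have e4c : (e4 <= c)%O.
  by rewrite (le_trans e43)// (le_trans e32)// (le_trans e21)// (le_trans e1e0).
move=> /(_ e4c) /(_ e4 _ _ e40 (lexx _) np); rewrite /r in r0 *; lra.
Qed.

End Lsc.

Theorem theorem3p6 (d : Order.disp_t) (A : completeBoolType d) (R : realType)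
    (X Y : normedModType R) (b : @dualPair R X Y)
    (b_le : forall (x : X) (y : Y), `|b x y| <= `|x| * `|y|)
    (ballX_closed : closed ([set x : X | `|x| <= 1] : set (weakl b)))
    (ballY_closed : closed ([set y : Y | `|y| <= 1] : set (weakr b)))
    (f : X -> condEReal A R) (f_convex : proper_convex f) :
  cond_lower_semicontinuous b_le f <->
  (forall x : X, f x =
     esup [set esub (creal_ereal (pairing b_le (cvec A x) y)) (fenchel_conj b_le f y) |
            y in [set: cond A Y]]).
Proof.
split; first exact: lsc_biconj.
exact: biconj_lsc.
Qed.
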